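(* Let $\rho\in\mathbb R$ and let $\eta^{\rho,z_0}$ denote the $\mathrm{SLE}_0(\rho)$ in $\mathbb H$ starting at $0$, with reference point $\infty$ and force point $z_0\in\overline{\mathbb H}\setminus\{0\}$, re-parametrized by arc-length. If $z_0\in\mathbb R\setminus\{0\}$, let $h_{\rho,z_0}:\mathbb H\to\mathbb R$ be the field $$h_{\rho,z_0}(z)=\begin{cases}\pi(1+\tfrac\rho2)-\arg(z)-\tfrac\rho2\arg(z-z_0),&z_0>0,\\ \pi-\arg(z)-\tfrac\rho2\arg(z-z_0),&z_0<0,\end{cases}$$ where the branches of $\arg(z)$ and $\arg(z-z_0)$ take values in $(0,\pi)$. Then $\eta^{\rho,z_0}$ is a flow-line of $h_{\rho,z_0}$. If $z_0=re^{i\theta}\in\mathbb H$, $\theta\in(0,\pi)$, let $h_{\rho,z_0}:\mathbb H_{z_0}\to\mathbb R$, where $\mathbb H_{z_0}:=\pi_{z_0}^{-1}(\mathbb H)\subset M_{z_0}$, be the field $$h_{\rho,z_0}(z)=\pi-\arg(z)-\tfrac\rho4\big(\arg(z-z_0)+\arg(z-\bar z_0)\big),$$ where the branches of $\arg(z)$ and $\arg(z-\bar z_0)$ take values in $(0,\pi)$. Then the lift of $\eta^{\rho,z_0}$ by $\pi_{z_0}$, starting at $(r,\theta-\pi)$, is a flow-line of $h_{\rho,z_0}$.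
   Context: $\mathbb H$ is the upper half-plane. The $\mathrm{SLE}_0(\rho)$ in $\mathbb H$ starting at $0$ with reference point $\infty$ and force point $z_0$ is the curve whose (half-plane capacity) driving function solves $\dot W_t=\mathrm{Re}\frac{\rho}{W_t-z_t}$, $W_0=0$, where $z_t=g_t(z_0)$ and $\partial_tg_t(z)=\frac2{g_t(z)-W_t}$, $g_0(z)=z$, $\gamma(t)=\lim_{y\to0+}g_t^{-1}(W_t+iy)$, run up to $\tau_{0+}=\lim_{\varepsilon\to0+}\inf\{t:|W_t-z_t|=\varepsilon\}$. For $z_0\in\mathbb C$, $M_{z_0}=\{(r,\theta):r>0,\theta\in\mathbb R\}$ is the logarithmic Riemann surface centered at $z_0$, with the complex structure induced by $\pi_{z_0}:M_{z_0}\to\mathbb C$, $(r,\theta)\mapsto z_0+re^{i\theta}$. A point $(r,\theta)\in M_{z_0}$ is written as $z=z_0+re^{i\theta}$, so $M_{z_0}$ is locally identified with $\mathbb C$ and $\arg(\cdot-z_0):M_{z_0}\to\mathbb R$, $(r,\theta)\mapsto\theta$, is single-valued; other functions of $z$ such as $\arg(z)$ and $\arg(z-\bar z_0)$ are evaluated at the projection $\pi_{z_0}(z)$. A $C^1$ curve $\eta$, parametrized by arc-length, is a flow-line of a field $h$ if $\eta'(t)=e^{ih(\eta(t))}$ (on $M_{z_0}$, using the local identification with $\mathbb C$). *)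

(* Defs.v *)
From Stdlib Require Import Reals.
From Coquelicot Require Import Coquelicot.

Open Scope R_scope.

(* The half-open interval [0, T), where T may be infinite. *)
Definition ico (T : Rbar) (t : R) : Prop := 0 <= t /\ Rbar_lt t T.

(* Derivative relative to a set of times D; at an endpoint of D which belongs
   to D this is the one-sided derivative. *)
Definition is_derive_on {V : NormedModule R_AbsRing}
  (D : R -> Prop) (f : R -> V) (t : R) (v : V) : Prop :=
  filterdiff f (within D (locally t)) (fun h : R => scal h v).

Definition cis (a : R) : C := (cos a, sin a).

Definition upper_half_plane (z : C) : Prop := 0 < Im z.

Definition closed_half_plane (z : C) : Prop := 0 <= Im z.

(* The branch of arg with values in (0, pi) on the upper half-plane, from
   Re z = |z| cos (arg z); meaningful only there. *)
Definition arg_H (z : C) : R := acos (Re z / Cmod z).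

(* f(e) -> l as e -> 0+, in the order topology of the extended reals. *)
Definition Rbar_lim_at_0plus (f : R -> Rbar) (l : Rbar) : Prop :=
  (forall a : Rbar, Rbar_lt a l -> at_right 0 (fun e => Rbar_lt a (f e))) /\
  (forall a : Rbar, Rbar_lt l a -> at_right 0 (fun e => Rbar_lt (f e) a)).

(* u is the Loewner trajectory of z on [0, T) for the driving function W. *)
Definition loewner_solution (W : R -> R) (T : Rbar) (z : C) (u : R -> C) : Prop :=
  u 0 = z /\
  forall t : R, ico T t ->
    u t <> RtoC (W t) /\
    is_derive_on (V := C_R_NormedModule) (ico T) u t (2 / (u t - W t))%C.

(* g t z is the maximal solution started at z, for a driving function defined
   on [0, T); its lifetime is life z, so that g t is defined on
   {z | t < life z}, the complement of the hull at time t. *)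
Definition loewner_chain (W : R -> R) (T : Rbar)
  (g : R -> C -> C) (life : C -> Rbar) : Prop :=
  forall z : C, closed_half_plane z -> z <> RtoC (W 0) ->
    Rbar_le (life z) T /\
    loewner_solution W (life z) z (fun t => g t z) /\
    (forall (T' : Rbar) (u : R -> C), Rbar_le T' T ->
       loewner_solution W T' z u -> Rbar_le T' (life z)).

(* ginv t is the inverse of the bijection g t from
   {z in the upper half-plane | t < life z} to the upper half-plane
   (the injectivity of g t is automatic, by uniqueness of solutions). *)
Definition loewner_inverse (T : Rbar) (g : R -> C -> C) (life : C -> Rbar)
  (ginv : R -> C -> C) : Prop :=
  forall (t : R) (w : C), ico T t -> upper_half_plane w ->
    upper_half_plane (ginv t w) /\ Rbar_lt t (life (ginv t w)) /\
    g t (ginv t w) = w.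

(* Everything is defined on [0, tau). The equation sle_tau says that tau is the
   limit as e -> 0+ of the first time at which |W_t - z_t| = e (an infimum,
   equal to +oo if there is no such time); in particular it forces tau > 0 and
   forbids stopping before |W_t - z_t| gets arbitrarily close to 0. *)
Record sle0_rho_data (rho : R) (z0 : C) (tau : Rbar) (gamma : R -> C)
  (W : R -> R) (g : R -> C -> C) (life : C -> Rbar) (ginv : R -> C -> C)
  : Prop := {
  sle_chain : loewner_chain W tau g life;
  sle_inverse : loewner_inverse tau g life ginv;
  sle_force : life z0 = tau;
  sle_start : W 0 = 0;
  sle_drive : forall t : R, ico tau t ->
    is_derive_on (V := R_NormedModule) (ico tau) W t
      (Re (rho / (W t - g t z0))%C);
  sle_tau : Rbar_lim_at_0plus
    (fun e => Glb_Rbar (fun t => ico tau t /\ Cmod (W t - g t z0)%C = e)) tau;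
  sle_trace : forall t : R, ico tau t ->
    filterlim (fun y : R => ginv t (W t, y)) (at_right 0) (locally (gamma t))
}.

(* gamma, on [0, tau), is the SLE_0(rho) in the upper half-plane started at 0,
   with reference point oo and force point z0. *)
Definition is_sle0_rho (rho : R) (z0 : C) (tau : Rbar) (gamma : R -> C) : Prop :=
  exists (W : R -> R) (g : R -> C -> C) (life : C -> Rbar) (ginv : R -> C -> C),
    sle0_rho_data rho z0 tau gamma W g life ginv.

(* The length of c restricted to [a, b], as the supremum of the lengths of the
   inscribed polygonal lines a = p_0 <= ... <= p_(n+1) = b. *)
Definition is_length (c : R -> C) (a b l : R) : Prop :=
  is_lub (fun x => exists (n : nat) (p : nat -> R),
    p 0%nat = a /\ p (S n) = b /\
    (forall i : nat, (i <= n)%nat -> p i <= p (S i)) /\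
    x = sum_f_R0 (fun i => Cmod (c (p (S i)) - c (p i))%C) n) l.

(* eta, on [0, L), is the arc-length reparametrization of c, on [0, T):
   eta (s t) = c t where s t is the length of c on [0, t]. *)
Definition is_arc_length_reparam (c : R -> C) (T : Rbar)
  (eta : R -> C) (L : Rbar) : Prop :=
  exists s : R -> R,
    (forall t : R, ico T t ->
       is_length c 0 t (s t) /\ ico L (s t) /\ eta (s t) = c t) /\
    (forall r : R, ico L r -> exists t : R, ico T t /\ s t = r).

(* eta is C^1 on [0, L), with derivative v (one-sided at 0), and |v| = 1. *)
Definition is_C1_unit_speed (eta : R -> C) (L : Rbar) (v : R -> C) : Prop :=
  forall t : R, ico L t ->
    is_derive_on (V := C_R_NormedModule) (ico L) eta t (v t) /\
    filterlim v (within (ico L) (locally t)) (locally (v t)) /\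
    Cmod (v t) = 1.

(* The fields live on the open set D, whereas eta 0 is allowed to be a boundary
   point of D (the origin, for the SLE_0(rho) curves): the equation is imposed
   at the times t in (0, L), and eta is C^1 up to t = 0. *)
Definition is_flow_line (D : C -> Prop) (h : C -> R)
  (eta : R -> C) (L : Rbar) : Prop :=
  exists v : R -> C, is_C1_unit_speed eta L v /\
    forall t : R, 0 < t -> Rbar_lt t L ->
      D (eta t) /\ v t = cis (h (eta t)).

(* The logarithmic surface M_(z0) is {(r, theta) | 0 < r} in R * R, with the
   product topology, which is the one making log_proj z0 a local
   homeomorphism. *)
Definition log_surface (p : R * R) : Prop := 0 < fst p.

Definition log_proj (z0 : C) (p : R * R) : C :=
  (z0 + RtoC (fst p) * cis (snd p))%C.

Definition log_half_plane (z0 : C) (p : R * R) : Prop :=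
  log_surface p /\ upper_half_plane (log_proj z0 p).

Definition is_continuous_log_path (q : R -> R * R) (L : Rbar) : Prop :=
  forall t : R, ico L t ->
    log_surface (q t) /\
    filterlim q (within (ico L) (locally t)) (locally (q t)).

Definition is_log_lift (z0 : C) (eta : R -> C) (L : Rbar) (p0 : R * R)
  (q : R -> R * R) : Prop :=
  is_continuous_log_path q L /\ q 0 = p0 /\
  forall t : R, ico L t -> log_proj z0 (q t) = eta t.

(* The local charts of M_(z0) are the restrictions of log_proj z0, so q is C^1
   with derivative v in these charts iff it is continuous and log_proj z0 o q
   is C^1 with derivative v. The field is evaluated at q t itself. *)
Definition is_log_flow_line (z0 : C) (D : R * R -> Prop) (h : R * R -> R)
  (q : R -> R * R) (L : Rbar) : Prop :=
  is_continuous_log_path q L /\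
  exists v : R -> C, is_C1_unit_speed (fun t => log_proj z0 (q t)) L v /\
    forall t : R, 0 < t -> Rbar_lt t L ->
      D (q t) /\ v t = cis (h (q t)).

Definition field_boundary (rho x0 : R) (z : C) : R :=
  (if Rlt_dec 0 x0 then PI * (1 + rho / 2) else PI)
  - arg_H z - rho / 2 * arg_H (z - x0)%C.

(* snd p is arg(. - z0), single-valued on M_(z0). *)
Definition field_interior (rho : R) (z0 : C) (p : R * R) : R :=
  PI - arg_H (log_proj z0 p)
  - rho / 4 * (snd p + arg_H (log_proj z0 p - Cconj z0)%C).

(* Main.v *)
Require Import Defs.
From Stdlib Require Import Reals Ranalysis5 Lra Lia ClassicalEpsilon.
From Coquelicot Require Import Coquelicot.

Open Scope R_scope.

(** Write [Z = g_t(p) - W_t]. Along the Loewner flow [Z' = 2 / Z - W'] and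
    [(log g_t'(p))' = - 2 / Z^2], hence [(log (Z g_t'))' = - W' / Z]. For the image [z_t]
    of the force point, [(log (g_t - z_t))' = - 2 / (Z (z_t - W_t))], so the equation for [W]
    says exactly that
      [F_t(p) = g_t'(p) Z ((g_t(p) - z_t) (g_t(p) - conj z_t))^{rho/4}]
    is constant in time. The field is, up to a constant, minus the argument of
    [F_0(p) = p ((p - z_0) (p - conj z_0))^{rho/4}].

    To reach the tip, let [P(t, y) = g_t^{-1}(W_t + i y)], whose limit as [y] goes to [0] is
    [gamma(t)]. Loewner's equation for the inverse map gives
    [d/dt P(t, y) = (W' + 2 i / y) / g_t'(P)] ([slits_start_derive]), and the invariant
    ([expansion_eq]) gives [1 / g_t'(P) = i y ((i y + W_t - z_t) (i y + W_t - conj z_t))^{rho/4} / F_0(P)].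
    The factors [y] cancel, and in the limit ([tip_derive])
      [gamma' = - 2 ((W_t - z_t) (W_t - conj z_t))^{rho/4} / F_0(gamma)].
    As [(W_t - z_t) (W_t - conj z_t)] is the square of the modulus of [W_t - z_t], the
    numerator has a constant argument, and [gamma'] points in the direction
    prescribed by the field.

    The map [g_t^{-1}] is only seen through differences of trajectories, which solve
    the linear equation [D' = - 2 / (Z1 Z2) D], so that [g_t'] and all the arguments are
    integrals along trajectories. The limit is justified by a
    Lipschitz estimate in [y], uniform in [t] ([above_lipschitz_height]), and by a lower bound
    for the distance from [P] to the force point ([force_gap]). The argument around
    an interior force point is multivalued: it is followed through the integral
    [swing], a continuous function of time which vanishes at time [0], and a
    determination of an argument which is continuous is unique ([angle_unique]). The
    same uniqueness takes care of the lift to the logarithmic surface.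

    Finally [gamma(t)] is close to [2 i sqrt t] near [0] ([tip_bounds]), so that in the parameter
    [sqrt t] the curve is continuously differentiable up to the start with nonzero
    derivative ([curve_steered]); its arc-length parametrization is then of class C^1
    ([reparam_C1]). *)

(** * Continuity of expressions *)

Lemma cont_plus (f g : R -> R) x :
  continuous f x -> continuous g x -> continuous (fun z => f z + g z) x.
Proof. intros Hf Hg; apply (continuous_plus f g x Hf Hg). Qed.

Lemma cont_minus (f g : R -> R) x :
  continuous f x -> continuous g x -> continuous (fun z => f z - g z) x.
Proof. intros Hf Hg; apply (continuous_minus f g x Hf Hg). Qed.

Lemma cont_mult (f g : R -> R) x :
  continuous f x -> continuous g x -> continuous (fun z => f z * g z) x.
Proof. intros Hf Hg; apply (continuous_mult f g x Hf Hg). Qed.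

Lemma cont_opp (f : R -> R) x : continuous f x -> continuous (fun z => - f z) x.
Proof. intros Hf; apply (continuous_opp f x Hf). Qed.

Lemma cont_inv (f : R -> R) x :
  continuous f x -> f x <> 0 -> continuous (fun z => / f z) x.
Proof. intros Hf H; apply (continuous_Rinv_comp f x Hf H). Qed.

Lemma cont_pow (f : R -> R) n x :
  continuous f x -> continuous (fun z => f z ^ n) x.
Proof.
  intros Hf. induction n as [|n IH]; simpl; [apply continuous_const|].
  apply cont_mult; assumption.
Qed.

Lemma cont_exp (f : R -> R) x : continuous f x -> continuous (fun z => exp (f z)) x.
Proof. intros Hf; apply (continuous_comp f exp x Hf), continuous_exp. Qed.

Lemma cont_cos (f : R -> R) x : continuous f x -> continuous (fun z => cos (f z)) x.
Proof. intros Hf; apply (continuous_comp f cos x Hf), continuous_cos. Qed.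

Lemma cont_sin (f : R -> R) x : continuous f x -> continuous (fun z => sin (f z)) x.
Proof. intros Hf; apply (continuous_comp f sin x Hf), continuous_sin. Qed.

Lemma cont_sqrt (f : R -> R) x : continuous f x -> continuous (fun z => sqrt (f z)) x.
Proof. intros Hf; apply (continuous_comp f sqrt x Hf), continuous_sqrt. Qed.

Lemma continuous_eps (f : R -> R) (x eps : R) : continuous f x -> 0 < eps ->
  exists d, 0 < d /\ forall y, Rabs (y - x) < d -> Rabs (f y - f x) < eps.
Proof.
  intros Hf He.
  destruct (proj1 (filterlim_locally (F := locally x) f (f x)) Hf (mkposreal eps He)) as [d Hd].
  exists d. split; [apply cond_pos | exact Hd].
Qed.

Lemma continuous_of_linear_bound (f : R -> R) (x C d : R) : 0 < d ->
  (forall y, Rabs (y - x) < d -> Rabs (f y - f x) <= C * Rabs (y - x)) -> continuous f x.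
Proof.
  intros Hd H. apply filterlim_locally. intros eps. pose proof (Rabs_pos C).
  assert (He : 0 < Rmin d (eps / (Rabs C + 1))).
  { apply Rmin_pos; [assumption|]. apply Rdiv_lt_0_compat; [apply cond_pos | lra]. }
  exists (mkposreal _ He). intros y Hy. change (Rabs (y - x) < Rmin d (eps / (Rabs C + 1))) in Hy.
  pose proof (Rmin_l d (eps / (Rabs C + 1))). pose proof (Rmin_r d (eps / (Rabs C + 1))).
  change (Rabs (f y - f x) < eps). eapply Rle_lt_trans; [apply H; lra|].
  pose proof (Rle_abs C). pose proof (Rabs_pos (y - x)).
  apply Rle_lt_trans with ((Rabs C + 1) * Rabs (y - x)); [nra|].
  apply Rlt_le_trans with ((Rabs C + 1) * (eps / (Rabs C + 1))).
  - apply Rmult_lt_compat_l; lra.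
  - right; field; lra.
Qed.

Lemma clamped_lipschitz_continuous (f : R -> R) (C T : R) : 0 < T ->
  (forall t1 t2, 0 <= t1 -> t1 <= t2 -> t2 < T -> Rabs (f t1 - f t2) <= C * (t2 - t1)) ->
  forall t, t < T -> continuous (fun t => f (Rmax 0 t)) t.
Proof.
  intros HT HC t Ht. pose proof (Rabs_pos C) as HC0.
  assert (HL : forall a b, a <= b -> b < T ->
    Rabs (f (Rmax 0 a) - f (Rmax 0 b)) <= Rabs C * Rabs (a - b)).
  { intros a b Hab Hb. eapply Rle_trans; [apply HC|].
    - apply Rmax_l.
    - apply Rle_max_compat_l; assumption.
    - apply Rmax_lub_lt; assumption.
    - pose proof (Rle_max_compat_l a b 0 Hab) as Hm.
      apply Rle_trans with (Rabs C * (Rmax 0 b - Rmax 0 a)).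
      + apply Rmult_le_compat_r; [lra | apply Rle_abs].
      + apply Rmult_le_compat_l; [assumption|]. rewrite (Rabs_left1 (a - b)) by lra.
        unfold Rmax; repeat destruct Rle_dec; lra. }
  assert (HL' : forall a b, a < T -> b < T ->
    Rabs (f (Rmax 0 a) - f (Rmax 0 b)) <= Rabs C * Rabs (a - b)).
  { intros a b Ha Hb. destruct (Rle_dec a b) as [Hab|Hab]; [apply HL; auto|].
    rewrite Rabs_minus_sym, (Rabs_minus_sym a). apply HL; lra. }
  apply (continuous_of_linear_bound _ t (Rabs C) (T - t)); [lra|]. intros z Hz.
  apply HL'; [apply Rabs_def2 in Hz; lra | assumption].
Qed.

Lemma exp_mono (x y : R) : x <= y -> exp x <= exp y.
Proof. intros [H | ->]; [left; apply exp_increasing; exact H | right; reflexivity]. Qed.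

(* Continuity of an expression in functions whose continuity is at hand. *)
Ltac cts := first
  [ assumption
  | lazymatch goal with
    | |- continuous (fun z => z) _ => apply continuous_id
    | |- continuous (fun z => @?f z + @?g z) _ => apply (cont_plus f g); cts
    | |- continuous (fun z => @?f z - @?g z) _ => apply (cont_minus f g); cts
    | |- continuous (fun z => @?f z / @?g z) _ =>
        apply (cont_mult f (fun z => / g z)); cts
    | |- continuous (fun z => @?f z * @?g z) _ => apply (cont_mult f g); cts
    | |- continuous (fun z => - @?f z) _ => apply (cont_opp f); cts
    | |- continuous (fun z => / @?f z) _ => apply (cont_inv f); [cts | try nra]
    | |- continuous (fun z => @?f z ^ ?n) _ => apply (cont_pow f n); cts
    | |- continuous (fun z => exp (@?f z)) _ => apply (cont_exp f); cts
    | |- continuous (fun z => cos (@?f z)) _ => apply (cont_cos f); cts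
    | |- continuous (fun z => sin (@?f z)) _ => apply (cont_sin f); cts
    | |- continuous (fun z => sqrt (@?f z)) _ => apply (cont_sqrt f); cts
    | _ => try apply continuous_const
    end ].

(* Differentiates an expression in functions whose derivatives are hypotheses. *)
Ltac dsolve :=
  auto_derive;
  [ repeat split; try (eexists; eassumption)
  | repeat match goal with
    | H : is_derive _ ?x ?l |- context [Derive ?g ?x] =>
        replace (Derive g x) with l by (symmetry; apply is_derive_unique; exact H)
    end ].

(** * Calculus on an interval *)

Lemma nonincreasing_of_derive (f : R -> R) (a b : R) :
  a <= b -> (forall x, a <= x <= b -> continuous f x) ->
  (forall x, a < x < b -> exists d, is_derive f x d /\ d <= 0) ->
  f b <= f a.
Proof.
  intros Hab Hc Hd.
  destruct (MVT_gen f a b (fun x => Rmin (Derive f x) 0)) as (c & _ & Hf).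
  - intros x Hx. rewrite Rmin_left, Rmax_right in Hx by lra.
    destruct (Hd x Hx) as (d & Hd1 & Hd2).
    rewrite (is_derive_unique _ _ _ Hd1), Rmin_left; assumption.
  - intros x Hx. rewrite Rmin_left, Rmax_right in Hx by lra.
    apply continuity_pt_filterlim, Hc, Hx.
  - pose proof (Rmin_r (Derive f c) 0). nra.
Qed.

Lemma nondecreasing_of_derive (f : R -> R) (a b : R) :
  a <= b -> (forall x, a <= x <= b -> continuous f x) ->
  (forall x, a < x < b -> exists d, is_derive f x d /\ 0 <= d) ->
  f a <= f b.
Proof.
  intros Hab Hc Hd.
  cut (- f b <= - f a); [lra|].
  apply (nonincreasing_of_derive (fun x => - f x)); auto.
  - intros x Hx. apply cont_opp, Hc, Hx.
  - intros x Hx. destruct (Hd x Hx) as (d & Hd1 & Hd2). exists (- d).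
    split; [apply (is_derive_opp f x d Hd1) | lra].
Qed.

Lemma constant_of_derive (f : R -> R) (a b : R) :
  a <= b -> (forall x, a <= x <= b -> continuous f x) ->
  (forall x, a < x < b -> is_derive f x 0) -> f b = f a.
Proof.
  intros Hab Hc Hd. apply Rle_antisym.
  - apply nonincreasing_of_derive; auto. intros x Hx; exists 0; split; auto; lra.
  - apply nondecreasing_of_derive; auto. intros x Hx; exists 0; split; auto; lra.
Qed.

Lemma increment_le (f g : R -> R) (a b : R) :
  a <= b -> (forall x, a <= x <= b -> continuous f x /\ continuous g x) ->
  (forall x, a < x < b -> exists df dg,
     is_derive f x df /\ is_derive g x dg /\ df <= dg) ->
  f b - f a <= g b - g a.
Proof.
  intros Hab Hc Hd.
  cut (f b - g b <= f a - g a); [lra|].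
  apply (nonincreasing_of_derive (fun x => f x - g x)); auto.
  - intros x Hx. apply (continuous_minus f g); apply Hc, Hx.
  - intros x Hx. destruct (Hd x Hx) as (df & dg & H1 & H2 & H3).
    exists (df - dg). split; [apply (is_derive_minus f g); auto | lra].
Qed.

Lemma continuous_of_derive (f : R -> R) (x d : R) : is_derive f x d -> continuous f x.
Proof.
  intros H. apply (ex_derive_continuous f x). exists d; exact H.
Qed.

Lemma is_derive_primitive (k : R -> R) (T s : R) :
  0 < T -> (forall x, x < T -> continuous k x) -> s < T ->
  is_derive (fun x => RInt k 0 x) s (k s).
Proof.
  intros HT Hk Hs. apply (is_derive_RInt k _ 0); [| apply Hk, Hs].
  exists (mkposreal (T - s) ltac:(lra)). intros x Hx.
  apply (RInt_correct k). apply ex_RInt_continuous. intros z Hz. apply Hk.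
  apply Rabs_def2 in Hx. simpl in Hx. unfold minus, plus, opp in Hx; simpl in Hx.
  revert Hz; unfold Rmin, Rmax; destruct (Rle_dec 0 x); lra.
Qed.

(** The quotient of [a + i b] by [exp (I1 + i I2)] has the derivative [0]. *)
Lemma linear_ode (a b k1 k2 I1 I2 : R -> R) (T s : R) :
  0 <= s < T ->
  (forall x, x < T -> continuous a x /\ continuous b x /\
     continuous I1 x /\ continuous I2 x) ->
  (forall x, 0 < x < T ->
     is_derive a x (k1 x * a x - k2 x * b x) /\
     is_derive b x (k2 x * a x + k1 x * b x) /\
     is_derive I1 x (k1 x) /\ is_derive I2 x (k2 x)) ->
  I1 0 = 0 -> I2 0 = 0 ->
  a s = exp (I1 s) * (a 0 * cos (I2 s) - b 0 * sin (I2 s)) /\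
  b s = exp (I1 s) * (a 0 * sin (I2 s) + b 0 * cos (I2 s)).
Proof.
  intros Hs Hc Hd H1 H2.
  pose (A := fun x => exp (- I1 x) * (a x * cos (I2 x) + b x * sin (I2 x))).
  pose (B := fun x => exp (- I1 x) * (b x * cos (I2 x) - a x * sin (I2 x))).
  assert (HA : A s = A 0).
  { apply constant_of_derive; [lra| |].
    - intros x Hx. destruct (Hc x) as (c1 & c2 & c3 & c4); [lra|]. unfold A; cts.
    - intros x Hx. destruct (Hd x) as (c1 & c2 & c3 & c4); [lra|]. unfold A.
      dsolve. ring. }
  assert (HB : B s = B 0).
  { apply constant_of_derive; [lra| |].
    - intros x Hx. destruct (Hc x) as (c1 & c2 & c3 & c4); [lra|]. unfold B; cts.
    - intros x Hx. destruct (Hd x) as (c1 & c2 & c3 & c4); [lra|]. unfold B.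
      dsolve. ring. }
  assert (HA0 : A 0 = a 0) by (unfold A; rewrite H1, H2, Ropp_0, exp_0, cos_0, sin_0; ring).
  assert (HB0 : B 0 = b 0) by (unfold B; rewrite H1, H2, Ropp_0, exp_0, cos_0, sin_0; ring).
  rewrite <- HA0, <- HB0, <- HA, <- HB. unfold A, B.
  assert (He : exp (I1 s) * exp (- I1 s) = 1)
    by (rewrite <- exp_plus, Rplus_opp_r, exp_0; reflexivity).
  pose proof (sin2_cos2 (I2 s)) as Hsc. unfold Rsqr in Hsc.
  set (c := cos (I2 s)) in *; set (d := sin (I2 s)) in *.
  split.
  - transitivity ((exp (I1 s) * exp (- I1 s)) * a s * (d * d + c * c)); [rewrite He, Hsc |]; ring.
  - transitivity ((exp (I1 s) * exp (- I1 s)) * b s * (d * d + c * c)); [rewrite He, Hsc |]; ring.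
Qed.

(** The function [f e^{- int k}] is nondecreasing. *)
Lemma nonpos_of_linear_le (f k : R -> R) (T s t : R) :
  0 <= s <= t -> t < T -> (forall x, x < T -> continuous f x /\ continuous k x) ->
  (forall x, 0 < x < t -> exists d, is_derive f x d /\ k x * f x <= d) ->
  f t <= 0 -> f s <= 0.
Proof.
  intros Hs Ht Hc Hd Hf.
  pose (I := fun x => RInt k 0 x).
  assert (HI : forall x, x < T -> is_derive I x (k x))
    by (intros x Hx; apply (is_derive_primitive k T); [lra | apply Hc | exact Hx]).
  assert (H : f s * exp (- I s) <= f t * exp (- I t)).
  { apply (nondecreasing_of_derive (fun x => f x * exp (- I x))); [lra| |].
    - intros x Hx. assert (H1 := HI x ltac:(lra)). apply continuous_of_derive in H1. pose proof (proj1 (Hc x ltac:(lra))). cts.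
    - intros x Hx. destruct (Hd x) as (d & H1 & H2); [lra|].
      assert (H3 := HI x ltac:(lra)).
      exists ((d - k x * f x) * exp (- I x)). split.
      + dsolve. ring.
      + apply Rmult_le_pos; [lra | left; apply exp_pos]. }
  pose proof (exp_pos (- I s)). pose proof (exp_pos (- I t)). nra.
Qed.

Lemma gronwall_derive (a b k1 k2 f : R -> R) (x df : R) :
  is_derive a x (k1 x * a x - k2 x * b x) ->
  is_derive b x (k2 x * a x + k1 x * b x) ->
  is_derive f x df ->
  is_derive (fun x => (a x ^ 2 + b x ^ 2) * exp (2 * f x)) x
    (2 * (k1 x + df) * ((a x ^ 2 + b x ^ 2) * exp (2 * f x))).
Proof. intros d1 d2 d3. dsolve. ring. Qed.

Lemma gronwall_weight_nonneg (a b c : R) : 0 <= (a ^ 2 + b ^ 2) * exp c.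
Proof.
  pose proof (exp_pos c). apply Rmult_le_pos; [|lra].
  pose proof (pow2_ge_0 a). pose proof (pow2_ge_0 b). lra.
Qed.

(** Gronwall's inequality for the modulus of [a + i b]: the squared modulus times
    [e^{2 f}] (times [e^{- 2 f}] in the forward version) is monotone, since [k1] is
    the rate of growth of the modulus and [k2] the speed of rotation. *)
Lemma gronwall_backward (a b k1 k2 f : R -> R) (s t : R) :
  s <= t ->
  (forall x, s <= x <= t -> continuous a x /\ continuous b x /\ continuous f x) ->
  (forall x, s < x < t -> exists df,
     is_derive a x (k1 x * a x - k2 x * b x) /\
     is_derive b x (k2 x * a x + k1 x * b x) /\
     is_derive f x df /\ - k1 x <= df) ->
  a s ^ 2 + b s ^ 2 <= (a t ^ 2 + b t ^ 2) * exp (2 * (f t - f s)).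
Proof.
  intros Hs Hc Hd.
  assert (H : (a s ^ 2 + b s ^ 2) * exp (2 * f s) <= (a t ^ 2 + b t ^ 2) * exp (2 * f t)).
  { apply (nondecreasing_of_derive (fun x => (a x ^ 2 + b x ^ 2) * exp (2 * f x))); [lra| |].
    - intros x Hx. destruct (Hc x Hx) as (c1 & c2 & c3). cts.
    - intros x Hx. destruct (Hd x Hx) as (df & d1 & d2 & d3 & Hle).
      eexists. split; [apply (gronwall_derive a b k1 k2 f x df); assumption|].
      apply Rmult_le_pos; [lra | apply gronwall_weight_nonneg]. }
  replace (2 * (f t - f s)) with (2 * f t + - (2 * f s)) by ring.
  rewrite exp_plus, exp_Ropp. pose proof (exp_pos (2 * f s)).
  apply (Rmult_le_reg_r (exp (2 * f s))); [assumption|].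
  apply (Rle_trans _ _ _ H). right. field. lra.
Qed.

Lemma gronwall_forward (a b k1 k2 f : R -> R) (s t : R) :
  s <= t ->
  (forall x, s <= x <= t -> continuous a x /\ continuous b x /\ continuous f x) ->
  (forall x, s < x < t -> exists df,
     is_derive a x (k1 x * a x - k2 x * b x) /\
     is_derive b x (k2 x * a x + k1 x * b x) /\
     is_derive f x df /\ k1 x <= df) ->
  a t ^ 2 + b t ^ 2 <= (a s ^ 2 + b s ^ 2) * exp (2 * (f t - f s)).
Proof.
  intros Hs Hc Hd.
  assert (H : (a t ^ 2 + b t ^ 2) * exp (2 * - f t) <= (a s ^ 2 + b s ^ 2) * exp (2 * - f s)).
  { apply (nonincreasing_of_derive (fun x => (a x ^ 2 + b x ^ 2) * exp (2 * - f x))); [lra| |].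
    - intros x Hx. destruct (Hc x Hx) as (c1 & c2 & c3). cts.
    - intros x Hx. destruct (Hd x Hx) as (df & d1 & d2 & d3 & Hle).
      eexists. split; [apply (gronwall_derive a b k1 k2 (fun x => - f x) x (- df)); try assumption;
        apply (is_derive_opp f x df d3)|].
      pose proof (gronwall_weight_nonneg (a x) (b x) (2 * - f x)). nra. }
  replace (2 * (f t - f s)) with (2 * - f s + - (2 * - f t)) by ring.
  rewrite exp_plus, exp_Ropp. pose proof (exp_pos (2 * - f t)).
  apply (Rmult_le_reg_r (exp (2 * - f t))); [assumption|].
  apply (Rle_trans _ _ _ H). right. field. lra.
Qed.

Lemma RInt_diff_le (f g : R -> R) (a b e C : R) :
  0 <= a <= b -> (forall x, 0 <= x <= a -> continuous f x) ->
  (forall x, 0 <= x <= b -> continuous g x) ->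
  (forall x, 0 <= x <= a -> Rabs (f x - g x) <= e) ->
  (forall x, a <= x <= b -> Rabs (g x) <= C) ->
  Rabs (RInt f 0 a - RInt g 0 b) <= a * e + (b - a) * C.
Proof.
  intros Hab Hf Hg He HC.
  assert (If : ex_RInt f 0 a) by (apply (@ex_RInt_continuous R_CompleteNormedModule); intros z Hz;
    rewrite Rmin_left, Rmax_right in Hz by lra; apply Hf; lra).
  assert (Ig : ex_RInt g 0 a) by (apply (@ex_RInt_continuous R_CompleteNormedModule); intros z Hz;
    rewrite Rmin_left, Rmax_right in Hz by lra; apply Hg; lra).
  assert (Ig' : ex_RInt g a b) by (apply (@ex_RInt_continuous R_CompleteNormedModule); intros z Hz;
    rewrite Rmin_left, Rmax_right in Hz by lra; apply Hg; lra).
  rewrite <- (RInt_Chasles g 0 a b Ig Ig').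
  pose proof (RInt_minus f g 0 a If Ig) as E.
  change (minus (RInt f 0 a) (RInt g 0 a)) with (RInt f 0 a - RInt g 0 a) in E.
  change (plus (RInt g 0 a) (RInt g a b)) with (RInt g 0 a + RInt g a b).
  replace (RInt f 0 a - (RInt g 0 a + RInt g a b)) with
    (RInt f 0 a - RInt g 0 a + - RInt g a b) by ring.
  rewrite <- E.
  apply (Rle_trans _ _ _ (Rabs_triang _ _)). rewrite Rabs_Ropp.
  apply Rplus_le_compat.
  - replace (a * e) with ((a - 0) * e) by ring. apply abs_RInt_le_const; try lra.
    + apply (ex_RInt_minus f g); assumption.
    + intros x Hx. apply He; lra.
  - apply abs_RInt_le_const; try lra; assumption.
Qed.

(** * Angles *)

(** The difference of the angles cannot reach [PI / 2] in absolute value, where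
    the cosine vanishes. *)
Lemma angle_diff_lt_PI2 (f g : R -> R) (T : R) :
  (forall x, 0 <= x <= T -> continuous f x /\ continuous g x /\ 0 < cos (f x - g x)) ->
  Rabs (f 0 - g 0) < PI / 2 ->
  forall t, 0 <= t <= T -> Rabs (f t - g t) < PI / 2.
Proof.
  assert (up : forall f g, (forall x, 0 <= x <= T ->
      continuous f x /\ continuous g x /\ 0 < cos (f x - g x)) ->
    f 0 - g 0 < PI / 2 -> forall t, 0 <= t <= T -> f t - g t < PI / 2).
  { clear f g; intros f g Hc H0 t Ht.
    destruct (Rlt_le_dec (f t - g t) (PI / 2)) as [|Hge]; [assumption|].
    assert (Hcos : forall x, 0 <= x <= T -> f x - g x <> PI / 2).
    { intros x Hx E. destruct (Hc x Hx) as (_ & _ & Hp).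
      rewrite E, cos_PI2 in Hp. lra. }
    assert (Hlt : PI / 2 < f t - g t) by (destruct Hge; [lra | exfalso; apply (Hcos t); auto]).
    assert (Ht0 : 0 < t) by (destruct (proj1 Ht) as [|E]; [assumption | subst t; lra]).
    destruct (IVT_interv (fun x => f x - g x - PI / 2) 0 t) as (z & Hz & E); try lra.
    - intros a Ha. apply continuity_pt_filterlim.
      destruct (Hc a ltac:(lra)) as (c1 & c2 & _).
      apply (cont_minus (fun x => f x - g x) (fun _ => PI / 2)); cts.
    - exfalso; apply (Hcos z); lra. }
  intros Hc H0 t Ht. apply Rabs_def2 in H0. apply Rabs_def1.
  - apply up; auto; lra.
  - assert (H := up g f). specialize (H ltac:(intros x Hx; destruct (Hc x Hx) as (c1 & c2 & c3);
      repeat split; auto; rewrite <- cos_neg, Ropp_minus_distr; auto) ltac:(lra) t Ht). lra.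
Qed.

Lemma sin_small (x e : R) :
  Rabs x < PI / 2 -> 0 < e < PI / 2 -> Rabs (sin x) < sin e -> Rabs x < e.
Proof.
  intros Hx He Hs. apply Rabs_def2 in Hx. apply Rabs_def2 in Hs. apply Rabs_def1.
  - apply sin_increasing_0; lra.
  - apply sin_increasing_0; try lra. rewrite sin_neg; lra.
Qed.

(** A continuous determination of the argument along a path is fixed by its
    initial value. This is what identifies arguments obtained by integration
    with values of [arg_H], and lifts to the logarithmic surface with one another. *)
Lemma angle_unique (f g : R -> R) (T : R) :
  (forall x, 0 <= x <= T -> continuous f x /\ continuous g x /\
     cos (f x) = cos (g x) /\ sin (f x) = sin (g x)) ->
  f 0 = g 0 -> forall t, 0 <= t <= T -> f t = g t.
Proof.
  intros Hc H0 t Ht.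
  assert (Hlt : Rabs (f t - g t) < PI / 2).
  { apply (angle_diff_lt_PI2 f g T); auto.
    - intros x Hx. destruct (Hc x Hx) as (c1 & c2 & c3 & c4). repeat split; auto.
      rewrite cos_minus, c3, c4. pose proof (sin2_cos2 (g x)) as E; unfold Rsqr in E. lra.
    - rewrite H0, Rminus_diag, Rabs_R0. pose proof PI2_RGT_0; lra. }
  destruct (Hc t Ht) as (_ & _ & c3 & c4).
  assert (Hs : sin (f t - g t) = 0) by (rewrite sin_minus, c3, c4; ring).
  assert (Hz : Rabs (f t - g t) <= 0).
  { apply Rnot_lt_le; intros Hp.
    assert (Hb : Rabs (f t - g t) < Rabs (f t - g t) / 2);
      [| lra].
    apply sin_small; [assumption | lra |]. rewrite Hs, Rabs_R0.
    apply sin_gt_0; pose proof PI_RGT_0; lra. }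
  pose proof (Rabs_pos (f t - g t)). 
  apply Rminus_diag_uniq. apply Rabs_eq_0. lra.
Qed.

Lemma cos_acos_clamp (x : R) :
  (x <= -1 /\ cos (acos x) = -1) \/ (-1 <= x <= 1 /\ cos (acos x) = x) \/
  (1 <= x /\ cos (acos x) = 1).
Proof.
  destruct (Rle_dec x (-1)) as [H|H].
  { left. unfold acos. destruct (Rle_dec x (-1)); [|lra]. rewrite cos_PI. auto. }
  destruct (Rle_dec 1 x) as [H1|H1].
  { right; right. unfold acos. destruct (Rle_dec x (-1)); [lra|].
    destruct (Rle_dec 1 x); [|lra]. rewrite cos_0. auto. }
  right; left. rewrite cos_acos; lra.
Qed.

(** The points [-1] and [1], where [acos] has no derivative, matter: they are the
    cosines met when the force point and the start of the curve are on the real line. *)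
Lemma continuous_acos (x : R) : continuous acos x.
Proof.
  apply filterlim_locally. intros eps. pose proof (cond_pos eps) as He.
  pose proof (acos_bound x) as Hx. set (th := acos x) in *.
  assert (Hlip : forall y, Rabs (cos (acos y) - cos th) <= Rabs (y - x)).
  { intros y. unfold th.
    destruct (cos_acos_clamp x) as [[? ->] | [[? ->] | [? ->]]];
    destruct (cos_acos_clamp y) as [[? ->] | [[? ->] | [? ->]]];
    unfold Rabs; repeat destruct Rcase_abs; lra. }
  pose (d1 := if Rle_dec (th + eps) PI then cos th - cos (th + eps) else 1).
  pose (d2 := if Rle_dec 0 (th - eps) then cos (th - eps) - cos th else 1).
  assert (Hd1 : 0 < d1).
  { unfold d1; destruct (Rle_dec (th + eps) PI); [|apply Rlt_0_1].
    assert (cos (th + eps) < cos th) by (apply cos_decreasing_1; lra). lra. }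
  assert (Hd2 : 0 < d2).
  { unfold d2; destruct (Rle_dec 0 (th - eps)); [|apply Rlt_0_1].
    assert (cos th < cos (th - eps)) by (apply cos_decreasing_1; lra). lra. }
  exists (mkposreal (Rmin d1 d2) (Rmin_pos _ _ Hd1 Hd2)). intros y Hy.
  change (Rabs (y - x) < Rmin d1 d2) in Hy.
  change (Rabs (acos y - th) < eps).
  pose proof (Rmin_l d1 d2). pose proof (Rmin_r d1 d2).
  pose proof (acos_bound y) as Hyb. specialize (Hlip y).
  assert (Hc : Rabs (cos (acos y) - cos th) < Rmin d1 d2) by lra.
  apply Rabs_def2 in Hc. apply Rabs_def1; apply Rnot_le_lt; intros Hge.
  - assert (E : d1 = cos th - cos (th + eps))
      by (unfold d1; destruct (Rle_dec (th + eps) PI); [reflexivity | lra]).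
    assert (cos (acos y) <= cos (th + eps)) by (apply cos_decr_1; lra). lra.
  - assert (E : d2 = cos (th - eps) - cos th)
      by (unfold d2; destruct (Rle_dec 0 (th - eps)); [reflexivity | lra]).
    assert (cos (th - eps) <= cos (acos y)) by (apply cos_decr_1; lra). lra.
Qed.

Lemma Cmod_pair (a b : R) : Cmod (a, b) = sqrt (a ^ 2 + b ^ 2).
Proof. reflexivity. Qed.

Lemma sqrt_sum_pos (a b : R) : 0 < a ^ 2 + b ^ 2 -> 0 < sqrt (a ^ 2 + b ^ 2).
Proof. apply sqrt_lt_R0. Qed.

Lemma continuous_arg_H (a b : R -> R) (s : R) :
  continuous a s -> continuous b s -> 0 < a s ^ 2 + b s ^ 2 ->
  continuous (fun x => arg_H (a x, b x)) s.
Proof.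
  intros Ha Hb Hp. unfold arg_H, Cmod. simpl fst; simpl snd.
  apply (continuous_comp (fun x => a x / sqrt (a x ^ 2 + b x ^ 2)) acos);
    [|apply continuous_acos].
  pose proof (sqrt_sum_pos _ _ Hp). cts.
Qed.

Lemma arg_H_polar (a b : R) : 0 < a ^ 2 + b ^ 2 -> 0 <= b ->
  a = sqrt (a ^ 2 + b ^ 2) * cos (arg_H (a, b)) /\
  b = sqrt (a ^ 2 + b ^ 2) * sin (arg_H (a, b)).
Proof.
  intros Hp Hb. unfold arg_H, Cmod. simpl fst; simpl snd. simpl Re.
  pose proof (sqrt_sum_pos _ _ Hp) as Hr.
  pose proof (sqrt_sqrt (a ^ 2 + b ^ 2) ltac:(lra)) as Hrr.
  set (r := sqrt (a ^ 2 + b ^ 2)) in *.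
  assert (Hq : (a / r)² = 1 - (b / r)²).
  { unfold Rsqr. apply (Rmult_eq_reg_r (r * r)); [|nra]. field_simplify; [nra|lra|lra]. }
  assert (Hbr : 0 <= b / r) by (apply Rdiv_le_0_compat; lra).
  assert (Hb1 : -1 <= a / r <= 1) by (unfold Rsqr in Hq; nra).
  split.
  - rewrite cos_acos by assumption. field; lra.
  - rewrite sin_acos by assumption. rewrite Hq.
    replace (1 - (1 - (b / r)²)) with ((b / r)²) by ring.
    rewrite sqrt_Rsqr by assumption. field; lra.
Qed.

Lemma arg_H_opp_conj (a b : R) : arg_H (- a, b) = PI - arg_H (a, b).
Proof.
  unfold arg_H, Cmod. simpl fst; simpl snd. rewrite <- acos_opp.
  f_equal. replace ((- a) ^ 2) with (a ^ 2) by ring. unfold Re, Rdiv; simpl fst. ring.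
Qed.

(** * Loewner trajectories seen from the driving point *)

(** For a point [p] let [Z = g_s(p) - W_s = X + i V]; Loewner's equation becomes
    [Z' = 2 / Z - w], where [w] is the derivative of the driving function. All
    functions are continued to negative times, so that continuity at [0] is
    two-sided; the equation is imposed at positive times only. *)
Record centered (w : R -> R) (T : R) (X V : R -> R) : Prop := {
  centered_cont : forall s, s < T -> continuous X s /\ continuous V s;
  centered_nz : forall s, s < T -> 0 < X s ^ 2 + V s ^ 2;
  centered_derive : forall s, 0 < s < T ->
    is_derive X s (2 * X s / (X s ^ 2 + V s ^ 2) - w s) /\
    is_derive V s (- (2 * V s / (X s ^ 2 + V s ^ 2)))
}.

Arguments centered_cont {w T X V} _ s _.
Arguments centered_nz {w T X V} _ s _.
Arguments centered_derive {w T X V} _ s _.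

Lemma centered_mono {w T T' X V} : T' <= T -> centered w T X V -> centered w T' X V.
Proof.
  intros HT [c1 c2 c3]. constructor; intros s Hs;
  [apply c1 | apply c2 | apply c3]; lra.
Qed.

Lemma centered_conj {w T X V} : centered w T X V -> centered w T X (fun s => - V s).
Proof.
  intros [c1 c2 c3]. constructor; intros s Hs.
  - destruct (c1 s Hs). split; [assumption | apply cont_opp; assumption].
  - specialize (c2 s Hs). nra.
  - destruct (c3 s Hs) as [dX dV]. replace ((- V s) ^ 2) with (V s ^ 2) by ring.
    split; [exact dX|].
    apply (is_derive_opp V) in dV. revert dV. unfold opp; simpl. intros dV.
    evar_last; [exact dV|]. unfold Rdiv; ring.
Qed.

(** The logarithmic derivative [- 2 / |Z|^2] of [V] is continuous. *)
Lemma centered_V_scale {w T X V} s : centered w T X V -> 0 <= s < T ->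
  exists c, 0 < c /\ V s = c * V 0.
Proof.
  intros H Hs.
  pose (k := fun x => - (2 / (X x ^ 2 + V x ^ 2))).
  assert (Hk : forall x, x < T -> continuous k x).
  { intros x Hx. destruct (centered_cont H x Hx).
    pose proof (centered_nz H x Hx). unfold k. cts. }
  assert (HI : forall x, x < T -> is_derive (fun z => RInt k 0 z) x (k x))
    by (intros x Hx; apply (is_derive_primitive k T); auto; lra).
  destruct (linear_ode V (fun _ => 0) k (fun _ => 0) (fun z => RInt k 0 z) (fun _ => 0) T s)
    as [E _]; auto.
  - intros x Hx. split; [apply (centered_cont H x Hx)|].
    repeat split; try apply continuous_const.
    eapply continuous_of_derive, HI, Hx.
  - intros x Hx. destruct (centered_derive H x Hx) as [_ dV].
    pose proof (centered_nz H x ltac:(lra)).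
    split; [| split; [| split]].
    + evar_last; [exact dV|]. unfold k. field. lra.
    + evar_last; [apply @is_derive_const|]. simpl. unfold zero; simpl. ring.
    + apply HI; lra.
    + apply @is_derive_const.
  - rewrite RInt_point. reflexivity.
  - exists (exp (RInt k 0 s)). split; [apply exp_pos|].
    rewrite E, sin_0, cos_0. ring.
Qed.

Lemma centered_V_pos {w T X V} s : centered w T X V -> 0 < V 0 -> 0 <= s < T -> 0 < V s.
Proof.
  intros H HV Hs. destruct (centered_V_scale _ H Hs) as (c & Hc & ->).
  apply Rmult_lt_0_compat; assumption.
Qed.

Lemma centered_V_decr {w T X V} s t : centered w T X V -> 0 < V 0 -> 0 <= s <= t -> t < T ->
  V t <= V s.
Proof.
  intros H HV Hs Ht. apply nonincreasing_of_derive; [lra | |].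
  - intros x Hx. apply (centered_cont H). lra.
  - intros x Hx. eexists. split; [apply (centered_derive H); lra|].
    pose proof (centered_nz H x ltac:(lra)).
    pose proof (centered_V_pos x H HV ltac:(lra)).
    apply Ropp_le_cancel. rewrite Ropp_0, Ropp_involutive.
    apply Rdiv_le_0_compat; lra.
Qed.

(** The trajectory of the point [g_t^{-1}(W_t + i y)], which at time [t] is straight
    above the driving point. *)
Record ends_above (w : R -> R) (T K t y : R) (X V : R -> R) : Prop := {
  above_centered : centered w T X V;
  above_time : 0 <= t < T;
  above_drive : forall s, 0 < s < t -> Rabs (w s) <= K;
  above_X : X t = 0;
  above_V : V t = y;
  above_y : 0 < y;
  above_start : 0 < V 0
}.

Arguments above_centered {w T K t y X V} _.
Arguments above_time {w T K t y X V} _.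
Arguments above_X {w T K t y X V} _.
Arguments above_V {w T K t y X V} _.
Arguments above_start {w T K t y X V} _.

(** Backwards in time the term [2 X / |Z|^2] pulls [X] to [0], and the drift moves
    it at speed [K] at most. *)
Lemma above_X_upper {w T K t y X V} : ends_above w T K t y X V ->
  forall s, 0 <= s <= t -> X s <= K * (t - s).
Proof.
  intros [H Ht Hw HX HV Hy H0] s Hs.
  cut (X s - K * (t - s) <= 0); [lra|].
  apply (nonpos_of_linear_le (fun s => X s - K * (t - s))
           (fun x => 2 / (X x ^ 2 + V x ^ 2)) T s t); [lra | lra | | | rewrite HX; lra].
  - intros x Hx. destruct (centered_cont H x Hx).
    pose proof (centered_nz H x Hx). split; cts.
  - intros x Hx. destruct (centered_derive H x ltac:(lra)) as [dX _].
    pose proof (centered_nz H x ltac:(lra)) as Hn.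
    specialize (Hw x Hx). apply Rabs_le_between in Hw.
    exists (2 * X x / (X x ^ 2 + V x ^ 2) - w x + K). split; [dsolve; ring|].
    assert (0 <= 2 / (X x ^ 2 + V x ^ 2) * (K * (t - x))).
    { apply Rmult_le_pos; [apply Rdiv_le_0_compat; lra | apply Rmult_le_pos; lra]. }
    unfold Rdiv in *. lra.
Qed.

Lemma above_mirror {w T K t y X V} : ends_above w T K t y X V ->
  ends_above (fun s => - w s) T K t y (fun s => - X s) V.
Proof.
  intros [[c1 c2 c3] Ht Hw HX HV Hy H0]. constructor; auto.
  - constructor; intros s Hs.
    + destruct (c1 s Hs). split; [apply cont_opp|]; assumption.
    + specialize (c2 s Hs). nra.
    + destruct (c3 s Hs) as [dX dV]. replace ((- X s) ^ 2) with (X s ^ 2) by ring.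
      split; [|exact dV]. apply (is_derive_opp X) in dX.
      evar_last; [exact dX|]. unfold opp; simpl. unfold Rdiv; ring.
  - intros s Hs. rewrite Rabs_Ropp. auto.
  - rewrite HX; ring.
Qed.

Section Above.
Context {w : R -> R} {T K t y : R} {X V : R -> R} (H : ends_above w T K t y X V).

Lemma above_X_bound s : 0 <= s <= t -> Rabs (X s) <= K * (t - s).
Proof.
  intros Hs. pose proof (above_X_upper H s Hs).
  pose proof (above_X_upper (above_mirror H) s Hs).
  simpl in *. apply Rabs_le. lra.
Qed.

Lemma above_V_ge s : 0 <= s <= t -> y <= V s.
Proof.
  intros Hs. destruct H as [Hc Ht Hw HX HV Hy Hv0]. rewrite <- HV.
  apply (centered_V_decr _ _ Hc); auto; lra.
Qed.

Lemma above_V_upper s : 0 <= s <= t -> V s ^ 2 <= y ^ 2 + 4 * (t - s).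
Proof.
  intros Hs. destruct H as [Hc Ht Hw HX HV Hy Hv0].
  cut (V s ^ 2 + 4 * s <= V t ^ 2 + 4 * t); [rewrite HV; lra|].
  apply (nondecreasing_of_derive (fun s => V s ^ 2 + 4 * s)); [lra| |].
  - intros x Hx. destruct (centered_cont Hc x ltac:(lra)). cts.
  - intros x Hx. destruct (centered_derive Hc x ltac:(lra)) as [dX dV].
    pose proof (centered_nz Hc x ltac:(lra)) as Hn.
    exists (4 * (X x ^ 2 / (X x ^ 2 + V x ^ 2))). split.
    + dsolve. field. lra.
    + apply Rmult_le_pos; [lra|]. apply Rdiv_le_0_compat; nra.
Qed.

(** Here [X^2 - V^2] is the real part of [Z^2], and [(Z^2)' = 4 - 2 Z w]. *)
Lemma above_V_lower s : 0 <= s <= t ->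
  X s ^ 2 + y ^ 2 + 4 * (t - s) - K ^ 2 * (t - s) ^ 2 <= V s ^ 2.
Proof.
  intros Hs. pose proof above_X_bound as HXb. destruct H as [Hc Ht Hw HX HV Hy Hv0].
  cut (X s ^ 2 - V s ^ 2 - 4 * s - K ^ 2 * (t - s) ^ 2 <=
       X t ^ 2 - V t ^ 2 - 4 * t - K ^ 2 * (t - t) ^ 2); [rewrite HX, HV; lra|].
  apply (nondecreasing_of_derive
    (fun s => X s ^ 2 - V s ^ 2 - 4 * s - K ^ 2 * (t - s) ^ 2)); [lra| |].
  - intros x Hx. destruct (centered_cont Hc x ltac:(lra)). cts.
  - intros x Hx. destruct (centered_derive Hc x ltac:(lra)) as [dX dV].
    pose proof (centered_nz Hc x ltac:(lra)) as Hn.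
    exists (2 * (K * (K * (t - x)) - X x * w x)). split.
    + dsolve. field. lra.
    + specialize (Hw x ltac:(lra)). specialize (HXb x ltac:(lra)).
      pose proof (Rle_abs (X x * w x)) as Ha. rewrite Rabs_mult in Ha.
      pose proof (Rmult_le_compat _ _ _ _ (Rabs_pos _) (Rabs_pos _) HXb Hw). lra.
Qed.

(** The final part of the trajectory, of duration [2 / K^2], is steep; before that,
    the trajectory is at height [2 / K] at least. *)
Lemma above_X_le_V s : 0 < K -> 0 <= s <= t -> t - s <= 2 / K ^ 2 -> X s ^ 2 <= V s ^ 2.
Proof.
  intros HK Hs Hts. pose proof (above_V_lower s Hs).
  assert (K ^ 2 * (t - s) <= 2).
  { apply Rle_trans with (K ^ 2 * (2 / K ^ 2)); [|right; field; lra].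
    apply Rmult_le_compat_l; [nra | assumption]. }
  pose proof (pow2_ge_0 y). nra.
Qed.

Lemma above_V_far s : 0 < K -> 0 <= s <= t -> 2 / K ^ 2 <= t - s -> 2 / K <= V s.
Proof.
  intros HK Hs Hts.
  assert (Hp : 0 < 2 / K ^ 2) by (apply Rdiv_lt_0_compat; nra).
  pose proof (above_V_lower (t - 2 / K ^ 2) ltac:(lra)) as Hl.
  replace (t - (t - 2 / K ^ 2)) with (2 / K ^ 2) in Hl by ring.
  pose proof (pow2_ge_0 y). pose proof (pow2_ge_0 (X (t - 2 / K ^ 2))).
  assert (E : 4 * (2 / K ^ 2) - K ^ 2 * (2 / K ^ 2) ^ 2 = (2 / K) ^ 2) by (field; lra).
  destruct H as [Hc Ht Hw HX HV Hy Hv0].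
  apply Rle_trans with (V (t - 2 / K ^ 2)).
  - pose proof (centered_V_pos (t - 2 / K ^ 2) Hc Hv0 ltac:(lra)).
    assert (0 < 2 / K) by (apply Rdiv_lt_0_compat; lra). nra.
  - apply (centered_V_decr _ _ Hc); auto; lra.
Qed.

Lemma above_start_height : 0 < K -> Rmin (2 * t) ((2 / K) ^ 2) <= V 0 ^ 2.
Proof.
  intros HK. assert (Ht := above_time H).
  destruct (Rle_dec (2 / K ^ 2) t) as [Hle|Hle].
  - apply Rle_trans with ((2 / K) ^ 2); [apply Rmin_r|].
    assert (0 < 2 / K) by (apply Rdiv_lt_0_compat; lra).
    pose proof (above_V_far 0 HK ltac:(lra) ltac:(lra)). nra.
  - apply Rle_trans with (2 * t); [apply Rmin_l|].
    pose proof (above_V_lower 0 ltac:(lra)).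
    assert (K ^ 2 * t <= 2).
    { apply Rle_trans with (K ^ 2 * (2 / K ^ 2)); [|right; field; lra].
      apply Rmult_le_compat_l; nra. }
    pose proof (pow2_ge_0 y). pose proof (pow2_ge_0 (X 0)). nra.
Qed.

End Above.

(** The difference [D] of two solutions of [Z' = 2 / Z - w] satisfies
    [D' = - 2 / (Z Z') D], as the drift cancels; [rate1 + i rate2] is this coefficient
    [- 2 / (Z Z')] for [Z = x + i v] and [Z' = x' + i v']. *)
Definition rate1 (x v x' v' : R) : R :=
  - (2 * (x * x' - v * v') / ((x ^ 2 + v ^ 2) * (x' ^ 2 + v' ^ 2))).
Definition rate2 (x v x' v' : R) : R :=
  2 * (x * v' + x' * v) / ((x ^ 2 + v ^ 2) * (x' ^ 2 + v' ^ 2)).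

Lemma centered_diff_derive {w T T' X V X' V'} s :
  centered w T X V -> centered w T' X' V' -> 0 < s < T -> s < T' ->
  is_derive (fun s => X s - X' s) s
    (rate1 (X s) (V s) (X' s) (V' s) * (X s - X' s)
     - rate2 (X s) (V s) (X' s) (V' s) * (V s - V' s)) /\
  is_derive (fun s => V s - V' s) s
    (rate2 (X s) (V s) (X' s) (V' s) * (X s - X' s)
     + rate1 (X s) (V s) (X' s) (V' s) * (V s - V' s)).
Proof.
  intros H H' Hs Hs'.
  destruct (centered_derive H s ltac:(lra)) as [dX dV].
  destruct (centered_derive H' s ltac:(lra)) as [dX' dV'].
  pose proof (centered_nz H s ltac:(lra)) as Hn.
  pose proof (centered_nz H' s ltac:(lra)) as Hn'.
  unfold rate1, rate2.
  split; dsolve; field; split; lra.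
Qed.

Lemma rate_cont (X V X' V' : R -> R) s :
  continuous X s -> continuous V s -> continuous X' s -> continuous V' s ->
  0 < X s ^ 2 + V s ^ 2 -> 0 < X' s ^ 2 + V' s ^ 2 ->
  continuous (fun s => rate1 (X s) (V s) (X' s) (V' s)) s /\
  continuous (fun s => rate2 (X s) (V s) (X' s) (V' s)) s.
Proof.
  intros. unfold rate1, rate2.
  pose proof (Rmult_lt_0_compat _ _ H3 H4). split; cts.
Qed.

Lemma rate1_ge (x v x' v' : R) : 0 < x ^ 2 + v ^ 2 -> 0 < x' ^ 2 + v' ^ 2 ->
  - rate1 x v x' v' <= / (x ^ 2 + v ^ 2) + / (x' ^ 2 + v' ^ 2).
Proof.
  intros Hn Hn'. unfold rate1. rewrite Ropp_involutive.
  replace (/ (x ^ 2 + v ^ 2) + / (x' ^ 2 + v' ^ 2)) with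
    ((x ^ 2 + v ^ 2 + (x' ^ 2 + v' ^ 2)) / ((x ^ 2 + v ^ 2) * (x' ^ 2 + v' ^ 2)))
    by (field; split; lra).
  pose proof (pow2_ge_0 (x - x')). pose proof (pow2_ge_0 (v + v')).
  apply Rmult_le_compat_r; [|nra].
  left; apply Rinv_0_lt_compat, Rmult_lt_0_compat; assumption.
Qed.

(** The arguments of [Z] and [Z'] are within [PI / 4] of [PI / 2], so that
    [Re (Z Z') <= 0]. *)
Lemma rate1_ge0 (x v x' v' : R) : 0 < x ^ 2 + v ^ 2 -> 0 < x' ^ 2 + v' ^ 2 ->
  0 < v -> 0 < v' -> x ^ 2 <= v ^ 2 -> x' ^ 2 <= v' ^ 2 -> - rate1 x v x' v' <= 0.
Proof.
  intros Hn Hn' Hv Hv' Hx Hx'. unfold rate1. rewrite Ropp_involutive.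
  assert (Rabs x <= v) by (apply Rabs_le; nra).
  assert (Rabs x' <= v') by (apply Rabs_le; nra).
  pose proof (Rmult_le_compat _ _ _ _ (Rabs_pos _) (Rabs_pos _) H H0) as Hm.
  rewrite <- Rabs_mult in Hm. pose proof (Rle_abs (x * x')).
  pose proof (Rmult_lt_0_compat _ _ Hn Hn').
  unfold Rdiv. apply Rmult_le_0_r; [lra|]. left; apply Rinv_0_lt_compat; assumption.
Qed.

(** While both trajectories are steep, the distance between them decreases backwards
    in time; before, they are at height [2 / K] at least. The point is that the
    constant does not depend on the heights: this is the boundary regularity of
    the inverse Loewner map at the driving point which the whole proof relies on. *)
Lemma above_lipschitz_height {w T T' K t y y' X V X' V'} : 0 < K ->
  ends_above w T K t y X V -> ends_above w T' K t y' X' V' ->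
  (X 0 - X' 0) ^ 2 + (V 0 - V' 0) ^ 2 <= (y - y') ^ 2 * exp (K ^ 2 * t).
Proof.
  intros HK H H'.
  destruct (above_time H) as [Ht0 Ht].
  destruct (above_time H') as [_ Ht'].
  assert (Hc := above_centered H).
  assert (Hc' := above_centered H').
  pose proof (gronwall_backward (fun s => X s - X' s) (fun s => V s - V' s)
    (fun s => rate1 (X s) (V s) (X' s) (V' s)) (fun s => rate2 (X s) (V s) (X' s) (V' s))
    (fun s => K ^ 2 / 2 * s) 0 t Ht0) as G. simpl in G.
  rewrite (above_X H), (above_X H'),
    (above_V H), (above_V H') in G.
  replace (K ^ 2 * t) with (2 * (K * (K * 1) / 2 * t - K * (K * 1) / 2 * 0)) by field.
  eapply Rle_trans; [apply G|right; ring].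
  - intros x Hx. destruct (centered_cont Hc x ltac:(lra)).
    destruct (centered_cont Hc' x ltac:(lra)). repeat split; cts.
  - intros x Hx. exists (K ^ 2 / 2).
    destruct (centered_diff_derive x Hc Hc') as [d1 d2]; try lra.
    split; [exact d1 | split; [exact d2 | split]].
    + auto_derive; [exact I | simpl; field].
    + pose proof (centered_nz Hc x ltac:(lra)) as Hn.
      pose proof (centered_nz Hc' x ltac:(lra)) as Hn'.
      destruct (Rle_dec (t - x) (2 / K ^ 2)) as [Hle|Hle].
      * apply Rle_trans with 0; [|apply Rdiv_le_0_compat; nra].
        apply rate1_ge0; auto.
        -- apply (centered_V_pos x Hc ); [apply (above_start H) | lra].
        -- apply (centered_V_pos x Hc' ); [apply (above_start H') | lra].
        -- apply (above_X_le_V H); auto; lra.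
        -- apply (above_X_le_V H'); auto; lra.
      * eapply Rle_trans; [apply rate1_ge; assumption|].
        assert (Hi : forall a b, 2 / K <= b -> / (a ^ 2 + b ^ 2) <= K ^ 2 / 4).
        { intros a b Hb. replace (K ^ 2 / 4) with (/ (2 / K) ^ 2) by (field; lra).
          assert (0 < 2 / K) by (apply Rdiv_lt_0_compat; lra).
          apply Rinv_le_contravar; nra. }
        pose proof (Hi (X x) (V x) (above_V_far H x HK ltac:(lra) ltac:(lra))).
        pose proof (Hi (X' x) (V' x) (above_V_far H' x HK ltac:(lra) ltac:(lra))). lra.
Qed.

(** * Slits of small height at the driving point *)

(** [X0 + i V0] is the force point and [X t y + i V t y] is the trajectory of
    [g_t^{-1}(W_t + i y)], both seen from the driving point. The starting point of
    the latter tends to the tip of the curve as [y] goes to [0], and [T] is short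
    of the end of the curve, which gives the uniform bounds [K] and [d]. *)
Record slits (w : R -> R) (T K d : R) (X0 V0 : R -> R) (X V : R -> R -> R -> R) : Prop := {
  slits_T : 0 < T;
  slits_K : 0 < K;
  slits_d : 0 < d;
  slits_w : forall s, s < T -> continuous w s /\ Rabs (w s) <= K;
  slits_force : centered w T X0 V0;
  slits_force_ge : forall s, s < T -> d ^ 2 <= X0 s ^ 2 + V0 s ^ 2;
  slits_force_bounded : exists M, forall s, s < T -> sqrt (X0 s ^ 2 + V0 s ^ 2) <= M;
  slits_force_V : 0 <= V0 0;
  slits_above : forall t y, 0 <= t < T -> 0 < y ->
    exists T', T' <= T /\ ends_above w T' K t y (X t y) (V t y)
}.

Arguments slits_T {w T K d X0 V0 X V} _.
Arguments slits_K {w T K d X0 V0 X V} _.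
Arguments slits_d {w T K d X0 V0 X V} _.
Arguments slits_w {w T K d X0 V0 X V} _ s _.
Arguments slits_force {w T K d X0 V0 X V} _.
Arguments slits_force_ge {w T K d X0 V0 X V} _ s _.
Arguments slits_force_bounded {w T K d X0 V0 X V} _.
Arguments slits_force_V {w T K d X0 V0 X V} _.
Arguments slits_above {w T K d X0 V0 X V} _ t y _ _.

Lemma dot_le (a b c d : R) : Rabs (a * c - b * d) <= sqrt (a ^ 2 + b ^ 2) * sqrt (c ^ 2 + d ^ 2).
Proof.
  pose proof (pow2_ge_0 a). pose proof (pow2_ge_0 b).
  pose proof (pow2_ge_0 c). pose proof (pow2_ge_0 d).
  rewrite <- sqrt_mult, <- sqrt_Rsqr_abs by lra. apply sqrt_le_1_alt.
  unfold Rsqr. pose proof (pow2_ge_0 (a * d + b * c)). nra.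
Qed.

Lemma rate_bound (x v x' v' : R) : 0 < x ^ 2 + v ^ 2 -> 0 < x' ^ 2 + v' ^ 2 ->
  Rabs (rate1 x v x' v') <= 2 / (sqrt (x ^ 2 + v ^ 2) * sqrt (x' ^ 2 + v' ^ 2)) /\
  Rabs (rate2 x v x' v') <= 2 / (sqrt (x ^ 2 + v ^ 2) * sqrt (x' ^ 2 + v' ^ 2)).
Proof.
  intros Hn Hn'. 
  pose proof (sqrt_sum_pos _ _ Hn) as Hr. pose proof (sqrt_sum_pos _ _ Hn') as Hr'.
  pose proof (sqrt_sqrt (x ^ 2 + v ^ 2) ltac:(lra)) as E.
  pose proof (sqrt_sqrt (x' ^ 2 + v' ^ 2) ltac:(lra)) as E'.
  pose proof (dot_le x v x' v') as D1. pose proof (dot_le x (- v) v' x') as D2.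
  replace ((- v) ^ 2) with (v ^ 2) in D2 by ring.
  replace (v' ^ 2 + x' ^ 2) with (x' ^ 2 + v' ^ 2) in D2 by ring.
  unfold rate1, rate2.
  set (r := sqrt (x ^ 2 + v ^ 2)) in *. set (r' := sqrt (x' ^ 2 + v' ^ 2)) in *.
  rewrite <- E, <- E', Rabs_Ropp.
  pose proof (Rmult_lt_0_compat _ _ Hr Hr') as Hrr.
  assert (Hb : forall z, Rabs z <= r * r' -> Rabs (2 * z / (r * r * (r' * r'))) <= 2 / (r * r')).
  { intros z Hz. unfold Rdiv. rewrite !Rabs_mult, (Rabs_pos_eq 2) by lra.
    rewrite Rabs_inv, (Rabs_pos_eq (r * r * (r' * r'))) by nra.
    rewrite Rmult_assoc. apply Rmult_le_compat_l; [lra|].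
    apply Rle_trans with (r * r' * / (r * r * (r' * r'))).
    - apply Rmult_le_compat_r; [|assumption]. left; apply Rinv_0_lt_compat; nra.
    - right. field. lra. }
  split; apply Hb; [assumption|].
  replace (x * v' + x' * v) with (x * v' - - v * x') by ring. assumption.
Qed.

Section Slits.
Context {w : R -> R} {T K d : R} {X0 V0 : R -> R} {X V : R -> R -> R -> R}
  (S : slits w T K d X0 V0 X V).

Lemma force_V_nonneg s : 0 <= s < T -> 0 <= V0 s.
Proof.
  intros Hs. destruct S as [hT hK hd hw hf hfd hM hV ha].
  destruct (centered_V_scale _ hf Hs) as (c & Hc & ->). nra.
Qed.

Lemma force_norm_ge s : s < T -> d <= sqrt (X0 s ^ 2 + V0 s ^ 2).
Proof.
  intros Hs. destruct S as [hT hK hd hw hf hfd hM hV ha].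
  rewrite <- (sqrt_pow2 d) by lra. apply sqrt_le_1_alt, hfd, Hs.
Qed.

Lemma force_top_gap t y : 0 <= t < T -> 0 < y <= d / 2 ->
  (d / 2) ^ 2 <= X0 t ^ 2 + (V0 t - y) ^ 2.
Proof.
  intros Ht Hy. pose proof (force_norm_ge t ltac:(lra)) as Hr.
  pose proof (slits_d S).
  pose proof (pow2_ge_0 (X0 t)). pose proof (pow2_ge_0 (V0 t)).
  pose proof (sqrt_sqrt (X0 t ^ 2 + V0 t ^ 2) ltac:(lra)) as E.
  assert (Hv : V0 t <= sqrt (X0 t ^ 2 + V0 t ^ 2)).
  { apply Rle_trans with (Rabs (V0 t)); [apply Rle_abs|].
    rewrite <- sqrt_Rsqr_abs. apply sqrt_le_1_alt. unfold Rsqr. nra. }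
  set (r := sqrt (X0 t ^ 2 + V0 t ^ 2)) in *. nra.
Qed.

(** Since [1 / |Z| <= - V' + K / 2] and the height [V] is bounded, the distance
    between the trajectory and the force point, which is at least [d / 2] at the
    end, has only been multiplied by a bounded factor on the way. *)
Lemma force_gap : exists c, 0 < c /\ forall t y, 0 <= t < T -> 0 < y <= Rmin 1 (d / 2) ->
  c ^ 2 <= (X0 0 - X t y 0) ^ 2 + (V0 0 - V t y 0) ^ 2.
Proof.
  pose proof force_norm_ge as Hng. pose proof force_top_gap as Htg.
  destruct S as [hT hK hd hw hf hfd hM hV ha].
  pose (L := 2 / d * (sqrt (1 + 4 * T) + K / 2 * T)).
  exists (d / 2 * exp (- L)). split.
  { apply Rmult_lt_0_compat; [lra | apply exp_pos]. }
  intros t y Ht Hy.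
  pose proof (Rmin_l 1 (d / 2)). pose proof (Rmin_r 1 (d / 2)).
  destruct (ha t y Ht ltac:(lra)) as (T' & HT' & Ha).
  assert (Hc := above_centered Ha).
  assert (HtT' := above_time Ha).
  assert (Hv0 := above_start Ha).
  pose proof (gronwall_forward (fun s => X0 s - X t y s) (fun s => V0 s - V t y s)
    (fun s => rate1 (X0 s) (V0 s) (X t y s) (V t y s))
    (fun s => rate2 (X0 s) (V0 s) (X t y s) (V t y s))
    (fun s => 2 / d * (- V t y s + K / 2 * s)) 0 t ltac:(lra)) as G. cbv beta in G.
  assert (G' : X0 t ^ 2 + (V0 t - y) ^ 2 <=
    ((X0 0 - X t y 0) ^ 2 + (V0 0 - V t y 0) ^ 2) * exp (2 * L)).
  { replace (X0 t ^ 2) with ((X0 t - X t y t) ^ 2)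
      by (rewrite (above_X Ha); ring).
    replace (V0 t - y) with (V0 t - V t y t) by (rewrite (above_V Ha); ring).
    eapply Rle_trans; [apply G|].
    - intros x Hx. destruct (centered_cont Hc x ltac:(lra)).
      destruct (centered_cont hf x ltac:(lra)). repeat split; cts.
    - intros x Hx.
      destruct (centered_diff_derive x hf Hc) as [d1 d2]; try lra.
      pose proof (centered_nz hf x ltac:(lra)) as Hn0.
      pose proof (centered_nz Hc x ltac:(lra)) as Hn.
      destruct (centered_derive Hc x ltac:(lra)) as [_ dV].
      exists (2 / d * (2 * V t y x / (X t y x ^ 2 + V t y x ^ 2) + K / 2)).
      split; [exact d1 | split; [exact d2 | split]]; [dsolve; ring|].
      eapply Rle_trans; [apply Rle_abs|].
      eapply Rle_trans; [apply rate_bound; assumption|].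
      pose proof (Hng x ltac:(lra)) as Hr0.
      pose proof (sqrt_sum_pos _ _ Hn) as Hr.
      set (r0 := sqrt (X0 x ^ 2 + V0 x ^ 2)) in *.
      pose proof (sqrt_sqrt (X t y x ^ 2 + V t y x ^ 2) ltac:(lra)) as Er.
      set (r := sqrt (X t y x ^ 2 + V t y x ^ 2)) in *.
      pose proof (centered_V_pos x Hc Hv0 ltac:(lra)) as Hv.
      assert (Hvr : V t y x <= r) by (pose proof (pow2_ge_0 (X t y x)); nra).
      replace (2 / (r0 * r)) with (2 / r0 * (/ r)) by (field; lra).
      apply Rmult_le_compat.
      { apply Rdiv_le_0_compat; lra. } { left; apply Rinv_0_lt_compat; lra. }
      { unfold Rdiv. apply Rmult_le_compat_l; [lra|]. apply Rinv_le_contravar; lra. }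
      apply Rle_trans with (/ V t y x); [apply Rinv_le_contravar; lra|].
      assert (Hp : 0 < 2 * V t y x / (X t y x ^ 2 + V t y x ^ 2)) by (apply Rdiv_lt_0_compat; lra).
      destruct (Rle_dec (t - x) (2 / K ^ 2)) as [Hle|Hle].
      + pose proof (above_X_le_V Ha x hK ltac:(lra) Hle) as HXV.
        apply Rle_trans with (2 * V t y x / (X t y x ^ 2 + V t y x ^ 2)); [|lra].
        replace (/ V t y x) with (2 * V t y x * / (2 * V t y x ^ 2)) by (field; lra).
        apply Rmult_le_compat_l; [lra|]. apply Rinv_le_contravar; lra.
      + pose proof (above_V_far Ha x hK ltac:(lra) ltac:(lra)) as HV2.
        apply Rle_trans with (K / 2); [|lra].
        replace (K / 2) with (/ (2 / K)) by (field; lra).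
        apply Rinv_le_contravar; [apply Rdiv_lt_0_compat; lra | assumption].
    - apply Rmult_le_compat_l; [apply Rplus_le_le_0_compat; apply pow2_ge_0|]. apply exp_mono. apply Rmult_le_compat_l; [lra|].
      unfold L. rewrite <- Rmult_minus_distr_l.
      apply Rmult_le_compat_l; [left; apply Rdiv_lt_0_compat; lra|].
      rewrite (above_V Ha).
      assert (V t y 0 <= sqrt (1 + 4 * T)).
      { apply Rle_trans with (sqrt (V t y 0 ^ 2)); [rewrite sqrt_pow2; lra|].
        apply sqrt_le_1_alt. pose proof (above_V_upper Ha 0 ltac:(lra)). nra. }
      assert (K / 2 * t <= K / 2 * T) by (apply Rmult_le_compat_l; lra). lra. }
  specialize (Htg t y Ht ltac:(lra)).
  assert (Hle := Rle_trans _ _ _ Htg G').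
  replace ((d / 2 * exp (- L)) ^ 2) with ((d / 2) ^ 2 * exp (- (2 * L))).
  2: { replace (- (2 * L)) with (- L + - L) by ring. rewrite exp_plus. ring. }
  rewrite exp_Ropp. pose proof (exp_pos (2 * L)).
  apply (Rmult_le_reg_r (exp (2 * L))); [assumption|].
  eapply Rle_trans; [|exact Hle]. right. field. lra.
Qed.

(** In contrast to [above_lipschitz_height] the constant depends on [y]: the rate
    of the difference is only bounded by [2 / y^2]. *)
Lemma slits_lipschitz_time y : 0 < y -> exists C, 0 < C /\
  forall t1 t2 s, 0 <= s <= t1 -> t1 <= t2 -> t2 < T ->
  sqrt ((X t1 y s - X t2 y s) ^ 2 + (V t1 y s - V t2 y s) ^ 2) <= C * (t2 - t1).
Proof.
  intros Hy. destruct S as [hT hK hd hw hf hfd hM hV ha].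
  pose (B := K ^ 2 + (2 / y) ^ 2).
  assert (H2y : 0 < 2 / y) by (apply Rdiv_lt_0_compat; lra).
  assert (HB : 0 < B) by (unfold B; nra).
  exists (sqrt (B * exp (2 * (2 / y ^ 2 * T)))). split.
  { apply sqrt_lt_R0, Rmult_lt_0_compat; [assumption | apply exp_pos]. }
  intros t1 t2 s Hs H12 H2.
  destruct (ha t1 y ltac:(lra) Hy) as (T1 & HT1 & Ha1).
  destruct (ha t2 y ltac:(lra) Hy) as (T2 & HT2 & Ha2).
  assert (Hc1 := above_centered Ha1).
  assert (Hc2 := above_centered Ha2).
  assert (Ht1 := above_time Ha1).
  assert (Ht2 := above_time Ha2).
  rewrite <- (sqrt_pow2 (t2 - t1)) by lra.
  rewrite <- sqrt_mult; [| apply Rmult_le_pos; [lra | left; apply exp_pos] | apply pow2_ge_0].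
  apply sqrt_le_1_alt.
  pose proof (gronwall_backward (fun s => X t1 y s - X t2 y s) (fun s => V t1 y s - V t2 y s)
    (fun s => rate1 (X t1 y s) (V t1 y s) (X t2 y s) (V t2 y s))
    (fun s => rate2 (X t1 y s) (V t1 y s) (X t2 y s) (V t2 y s))
    (fun s => 2 / y ^ 2 * s) s t1 ltac:(lra)) as G. cbv beta in G.
  eapply Rle_trans; [apply G|].
  - intros x Hx. destruct (centered_cont Hc1 x ltac:(lra)).
    destruct (centered_cont Hc2 x ltac:(lra)). repeat split; cts.
  - intros x Hx. exists (2 / y ^ 2).
    destruct (centered_diff_derive x Hc1 Hc2) as [d1 d2]; try lra.
    split; [exact d1 | split; [exact d2 | split]]; [auto_derive; [exact I | simpl; field; lra]|].
    eapply Rle_trans.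
    { apply rate1_ge; [apply (centered_nz Hc1) | apply (centered_nz Hc2)]; lra. }
    assert (Hi : forall a b, y <= b -> / (a ^ 2 + b ^ 2) <= / y ^ 2).
    { intros a b Hb. apply Rinv_le_contravar; nra. }
    pose proof (Hi (X t1 y x) _ (above_V_ge Ha1 x ltac:(lra))).
    pose proof (Hi (X t2 y x) _ (above_V_ge Ha2 x ltac:(lra))). lra.
  - rewrite (above_X Ha1), (above_V Ha1).
    assert (E1 : Rabs (X t2 y t1) <= K * (t2 - t1)) by (apply (above_X_bound Ha2); lra).
    assert (E2 : V t2 y t1 - y <= 2 / y * (t2 - t1)).
    { assert (Hle := above_V_upper Ha2 t1 ltac:(lra)).
      assert (Hge := above_V_ge Ha2 t1 ltac:(lra)).
      apply (Rmult_le_reg_r y); [assumption|].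
      replace (2 / y * (t2 - t1) * y) with (2 * (t2 - t1)) by (field; lra). nra. }
    assert (Hge := above_V_ge Ha2 t1 ltac:(lra)).
    rewrite (Rmult_comm (B * _)), (Rmult_comm B), <- Rmult_assoc, (Rmult_comm _ B).
    rewrite <- Rmult_assoc.
    apply Rmult_le_compat; [nra | left; apply exp_pos | |].
    + unfold B. apply Rabs_le_between in E1.
      assert (X t2 y t1 ^ 2 <= (K * (t2 - t1)) ^ 2) by nra.
      assert ((V t2 y t1 - y) ^ 2 <= (2 / y * (t2 - t1)) ^ 2) by nra. nra.
    + apply exp_mono. assert (0 < 2 / y ^ 2) by (apply Rdiv_lt_0_compat; nra).
      rewrite <- Rmult_minus_distr_l.
      apply Rmult_le_compat_l; [lra|]. apply Rmult_le_compat_l; lra.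
Qed.
End Slits.

(** * Logarithms of differences of trajectories *)

Lemma rate_C (x v x' v' : R) : 0 < x ^ 2 + v ^ 2 -> 0 < x' ^ 2 + v' ^ 2 ->
  (- (2 / ((x, v) * (x', v'))))%C = (rate1 x v x' v', rate2 x v x' v').
Proof.
  intros Hn Hn'. unfold rate1, rate2, Cdiv, Copp, Cmult, Cinv, RtoC; simpl.
  assert (E : (x * x' - v * v') * ((x * x' - v * v') * 1)
    + (x * v' + v * x') * ((x * v' + v * x') * 1)
    = (x * (x * 1) + v * (v * 1)) * (x' * (x' * 1) + v' * (v' * 1))) by ring.
  rewrite E. f_equal; field; simpl in *; lra.
Qed.

Lemma C_nz (x v : R) : 0 < x ^ 2 + v ^ 2 -> ((x, v) : C) <> 0%C.
Proof. intros H E. injection E as -> ->. lra. Qed.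

Lemma rate_lipschitz (x v x1 v1 x2 v2 : R) :
  0 < x ^ 2 + v ^ 2 -> 0 < x1 ^ 2 + v1 ^ 2 -> 0 < x2 ^ 2 + v2 ^ 2 ->
  let B := 2 * sqrt ((x1 - x2) ^ 2 + (v1 - v2) ^ 2) /
    (sqrt (x ^ 2 + v ^ 2) * sqrt (x1 ^ 2 + v1 ^ 2) * sqrt (x2 ^ 2 + v2 ^ 2)) in
  Rabs (rate1 x v x1 v1 - rate1 x v x2 v2) <= B /\
  Rabs (rate2 x v x1 v1 - rate2 x v x2 v2) <= B.
Proof.
  intros Hn H1 H2 B.
  pose proof (rate_C x v x1 v1 Hn H1) as E1. pose proof (rate_C x v x2 v2 Hn H2) as E2.
  apply C_nz in Hn, H1, H2.
  assert (E : Cmod (- (2 / ((x, v) * (x1, v1))) - - (2 / ((x, v) * (x2, v2))))%C = B).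
  { replace (- (2 / ((x, v) * (x1, v1))) - - (2 / ((x, v) * (x2, v2))))%C
      with (2 * ((x1, v1) - (x2, v2)) / ((x, v) * (x1, v1) * (x2, v2)))%C
      by (field; auto).
    rewrite Cmod_div, !Cmod_mult by (repeat apply Cmult_neq_0; assumption).
    rewrite Cmod_R, Rabs_pos_eq by lra. reflexivity. }
  rewrite E1, E2 in E. rewrite <- E.
  pose proof (Rmax_Cmod ((rate1 x v x1 v1, rate2 x v x1 v1) - (rate1 x v x2 v2, rate2 x v x2 v2))%C) as M.
  simpl in M. split; (eapply Rle_trans; [|exact M]); [apply Rmax_l | apply Rmax_r].
Qed.

(** For a solution of a linear equation as in [linear_ode], the integrated
    coefficient is the increment of the logarithm. The branch of the argument is
    right because both sides are continuous in time. *)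
Section Log.
Context {a b k1 k2 I1 I2 : R -> R} {T s : R}
  (Hs : 0 <= s < T)
  (Hc : forall x, x < T -> continuous a x /\ continuous b x /\
     continuous I1 x /\ continuous I2 x)
  (Hd : forall x, 0 < x < T ->
     is_derive a x (k1 x * a x - k2 x * b x) /\
     is_derive b x (k2 x * a x + k1 x * b x) /\
     is_derive I1 x (k1 x) /\ is_derive I2 x (k2 x))
  (H1 : I1 0 = 0) (H2 : I2 0 = 0).

Lemma linear_ode_modulus x : 0 <= x < T ->
  sqrt (a x ^ 2 + b x ^ 2) = exp (I1 x) * sqrt (a 0 ^ 2 + b 0 ^ 2).
Proof.
  intros Hx. destruct (linear_ode a b k1 k2 I1 I2 T x Hx Hc Hd H1 H2) as [Ea Eb].
  pose proof (exp_pos (I1 x)) as He. pose proof (sin2_cos2 (I2 x)) as Hsc. unfold Rsqr in Hsc.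
  rewrite Ea, Eb. set (c := cos (I2 x)) in *; set (e := sin (I2 x)) in *.
  rewrite <- (sqrt_pow2 (exp (I1 x))) at 3 by lra.
  rewrite <- sqrt_mult; [f_equal | apply pow2_ge_0 | pose proof (pow2_ge_0 (a 0)); pose proof (pow2_ge_0 (b 0)); lra].
  transitivity (exp (I1 x) ^ 2 * ((a 0 ^ 2 + b 0 ^ 2) * (e * e + c * c))); [ring|].
  rewrite Hsc; ring.
Qed.

Lemma linear_ode_log_modulus : 0 < a 0 ^ 2 + b 0 ^ 2 ->
  I1 s = ln (sqrt (a s ^ 2 + b s ^ 2)) - ln (sqrt (a 0 ^ 2 + b 0 ^ 2)).
Proof.
  intros Hp. rewrite (linear_ode_modulus s Hs), ln_mult, ln_exp;
    [ring | apply exp_pos | apply sqrt_sum_pos, Hp].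
Qed.

Lemma linear_ode_angle : (forall x, 0 <= x <= s -> 0 < b x) ->
  I2 s = arg_H (a s, b s) - arg_H (a 0, b 0).
Proof.
  intros Hb. 
  apply (angle_unique I2 (fun x => arg_H (a x, b x) - arg_H (a 0, b 0)) s); [| rewrite H2; ring | lra].
  intros x Hx. destruct (Hc x ltac:(lra)) as (c1 & c2 & c3 & c4).
  pose proof (Hb x ltac:(lra)) as Hbx. pose proof (Hb 0 ltac:(lra)) as Hb0.
  assert (Hn : 0 < a x ^ 2 + b x ^ 2) by (pose proof (pow2_ge_0 (a x)); nra).
  assert (Hn0 : 0 < a 0 ^ 2 + b 0 ^ 2) by (pose proof (pow2_ge_0 (a 0)); nra).
  split; [assumption|]. split.
  { pose proof (continuous_arg_H a b x c1 c2 Hn). cts. }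
  destruct (linear_ode a b k1 k2 I1 I2 T x ltac:(lra) Hc Hd H1 H2) as [Ea Eb].
  pose proof (exp_pos (I1 x)) as He.
  assert (Em : sqrt (a x ^ 2 + b x ^ 2) = exp (I1 x) * sqrt (a 0 ^ 2 + b 0 ^ 2))
    by (apply linear_ode_modulus; lra).
  destruct (arg_H_polar (a x) (b x) Hn ltac:(lra)) as [Pa Pb].
  destruct (arg_H_polar (a 0) (b 0) Hn0 ltac:(lra)) as [Pa0 Pb0].
  pose proof (sqrt_sum_pos _ _ Hn0) as Hr.
  rewrite cos_minus, sin_minus.
  rewrite Em in Pa, Pb. set (r := sqrt (a 0 ^ 2 + b 0 ^ 2)) in *.
  set (th := arg_H (a x, b x)) in *. set (th0 := arg_H (a 0, b 0)) in *.
  rewrite Pa0, Pb0 in Ea, Eb.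
  pose proof (sin2_cos2 (th0)) as Hsc. unfold Rsqr in Hsc.
  assert (Qc : cos th = cos th0 * cos (I2 x) - sin th0 * sin (I2 x)).
  { apply (Rmult_eq_reg_l (exp (I1 x) * r)); [|nra]. rewrite <- Pa, Ea. ring. }
  assert (Qs : sin th = cos th0 * sin (I2 x) + sin th0 * cos (I2 x)).
  { apply (Rmult_eq_reg_l (exp (I1 x) * r)); [|nra]. rewrite <- Pb, Eb. ring. }
  rewrite Qc, Qs. split.
  - transitivity (cos (I2 x) * (sin th0 * sin th0 + cos th0 * cos th0)); [rewrite Hsc|]; ring.
  - transitivity (sin (I2 x) * (sin th0 * sin th0 + cos th0 * cos th0)); [rewrite Hsc|]; ring.
Qed.
End Log.

Section DiffLog.
Context {w : R -> R} {T T' s : R} {X V X' V' : R -> R}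
  (H : centered w T X V) (H' : centered w T' X' V') (HT : T <= T') (Hs : 0 <= s < T).

Let k1 x := rate1 (X x) (V x) (X' x) (V' x).
Let k2 x := rate2 (X x) (V x) (X' x) (V' x).

Lemma rate_cont_centered x : x < T -> continuous k1 x /\ continuous k2 x.
Proof.
  intros Hx. destruct (centered_cont H x ltac:(lra)) as [h1 h2].
  destruct (centered_cont H' x ltac:(lra)) as [h1' h2'].
  apply (rate_cont X V X' V' x h1 h2 h1' h2');
    [apply (centered_nz H); lra | apply (centered_nz H'); lra].
Qed.

Lemma diff_ode_cont : forall x, x < T -> continuous (fun x => X x - X' x) x /\ continuous (fun x => V x - V' x) x /\
     continuous (fun x => RInt k1 0 x) x /\ continuous (fun x => RInt k2 0 x) x.
Proof.
  intros x Hx. destruct (centered_cont H x ltac:(lra)).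
  destruct (centered_cont H' x ltac:(lra)).
  split; [cts | split; [cts|]]. split; eapply continuous_of_derive;
    apply (is_derive_primitive _ T); try lra; intros z Hz; apply (rate_cont_centered z Hz).
Qed.

Lemma diff_ode_derive : forall x, 0 < x < T ->
     is_derive (fun x => X x - X' x) x (k1 x * (X x - X' x) - k2 x * (V x - V' x)) /\
     is_derive (fun x => V x - V' x) x (k2 x * (X x - X' x) + k1 x * (V x - V' x)) /\
     is_derive (fun x => RInt k1 0 x) x (k1 x) /\ is_derive (fun x => RInt k2 0 x) x (k2 x).
Proof.
  intros x Hx. destruct (centered_diff_derive x H H' ltac:(lra) ltac:(lra)).
  split; [assumption | split; [assumption|]]. split;
    apply (is_derive_primitive _ T); try lra; intros z Hz; apply (rate_cont_centered z Hz).
Qed.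

Lemma diff_linear_ode :
  X s - X' s = exp (RInt k1 0 s) * ((X 0 - X' 0) * cos (RInt k2 0 s) - (V 0 - V' 0) * sin (RInt k2 0 s)) /\
  V s - V' s = exp (RInt k1 0 s) * ((X 0 - X' 0) * sin (RInt k2 0 s) + (V 0 - V' 0) * cos (RInt k2 0 s)).
Proof.
  exact (linear_ode _ _ _ _ _ _ T s Hs diff_ode_cont diff_ode_derive (RInt_point 0 k1) (RInt_point 0 k2)).
Qed.

Lemma diff_log_modulus : 0 < (X 0 - X' 0) ^ 2 + (V 0 - V' 0) ^ 2 ->
  RInt k1 0 s = ln (sqrt ((X s - X' s) ^ 2 + (V s - V' s) ^ 2))
    - ln (sqrt ((X 0 - X' 0) ^ 2 + (V 0 - V' 0) ^ 2)).
Proof.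
  exact (linear_ode_log_modulus Hs diff_ode_cont diff_ode_derive (RInt_point 0 k1) (RInt_point 0 k2)).
Qed.

Lemma diff_angle : (forall x, 0 <= x <= s -> 0 < V x - V' x) ->
  RInt k2 0 s = arg_H (X s - X' s, V s - V' s) - arg_H (X 0 - X' 0, V 0 - V' 0).
Proof.
  exact (linear_ode_angle Hs diff_ode_cont diff_ode_derive (RInt_point 0 k1) (RInt_point 0 k2)).
Qed.
End DiffLog.

(** * Tools for limits of expressions *)

Lemma rate1_sym x v x' v' : rate1 x v x' v' = rate1 x' v' x v.
Proof. unfold rate1. rewrite (Rmult_comm (x ^ 2 + v ^ 2)). do 2 f_equal. ring. Qed.

Lemma rate2_sym x v x' v' : rate2 x v x' v' = rate2 x' v' x v.
Proof. unfold rate2. rewrite (Rmult_comm (x ^ 2 + v ^ 2)). f_equal. ring. Qed.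

Section Flim.
Context {U : Type} {F : (U -> Prop) -> Prop} {FF : Filter F}.

Lemma flim_plus (f g : U -> R) a b : filterlim f F (locally a) -> filterlim g F (locally b) ->
  filterlim (fun u => f u + g u) F (locally (a + b)).
Proof. intros Hf Hg. exact (filterlim_comp_2 _ _ Rplus Hf Hg (filterlim_plus a b)). Qed.

Lemma flim_mult (f g : U -> R) a b : filterlim f F (locally a) -> filterlim g F (locally b) ->
  filterlim (fun u => f u * g u) F (locally (a * b)).
Proof. intros Hf Hg. exact (filterlim_comp_2 _ _ Rmult Hf Hg (filterlim_mult a b)). Qed.

Lemma flim_cont (g : R -> R) (f : U -> R) a : continuous g a -> filterlim f F (locally a) ->
  filterlim (fun u => g (f u)) F (locally (g a)).
Proof. intros Hg Hf. exact (filterlim_comp _ _ _ f g F (locally a) _ Hf Hg). Qed.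

Lemma flim_opp (f : U -> R) a : filterlim f F (locally a) ->
  filterlim (fun u => - f u) F (locally (- a)).
Proof. apply (flim_cont Ropp). apply cont_opp, continuous_id. Qed.

Lemma flim_minus (f g : U -> R) a b : filterlim f F (locally a) -> filterlim g F (locally b) ->
  filterlim (fun u => f u - g u) F (locally (a - b)).
Proof. intros Hf Hg. apply flim_plus; [assumption | apply flim_opp; assumption]. Qed.

Lemma flim_const (a : R) : filterlim (fun _ : U => a) F (locally a).
Proof. apply filterlim_const. Qed.

Lemma flim_inv (f : U -> R) a : a <> 0 -> filterlim f F (locally a) ->
  filterlim (fun u => / f u) F (locally (/ a)).
Proof. intros Ha. apply (flim_cont Rinv). apply cont_inv; [apply continuous_id | exact Ha]. Qed.
End Flim.

(* Limits of an expression in functions whose limits are at hand; the limit has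
   to be given as the same expression in the limits. *)
Ltac flim := first
  [ eassumption
  | lazymatch goal with
    | |- filterlim (fun z => @?f z + @?g z) _ (locally (?a + ?b)) => apply (flim_plus f g a b); flim
    | |- filterlim (fun z => @?f z - @?g z) _ (locally (?a - ?b)) => apply (flim_minus f g a b); flim
    | |- filterlim (fun z => @?f z / @?g z) _ (locally (?a / ?b)) =>
        apply (flim_mult f (fun z => / g z) a (/ b)); flim
    | |- filterlim (fun z => @?f z * @?g z) _ (locally (?a * ?b)) => apply (flim_mult f g a b); flim
    | |- filterlim (fun z => - @?f z) _ (locally (- ?a)) => apply (flim_opp f a); flim
    | |- filterlim (fun z => / @?f z) _ (locally (/ ?a)) => apply (flim_inv f a); [try lra | flim]
    | |- filterlim (fun z => exp (@?f z)) _ (locally (exp ?a)) =>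
        apply (flim_cont exp f a); [apply continuous_exp | flim]
    | |- filterlim (fun z => cos (@?f z)) _ (locally (cos ?a)) =>
        apply (flim_cont cos f a); [apply continuous_cos | flim]
    | |- filterlim (fun z => sin (@?f z)) _ (locally (sin ?a)) =>
        apply (flim_cont sin f a); [apply continuous_sin | flim]
    | |- filterlim (fun z => sqrt (@?f z)) _ (locally (sqrt ?a)) =>
        apply (flim_cont sqrt f a); [apply continuous_sqrt | flim]
    | |- filterlim (fun z => @?f z ^ 2) _ (locally (?a ^ 2)) =>
        apply (flim_cont (fun x => x ^ 2) f a); [apply (cont_pow (fun x => x)), continuous_id | flim]
    | _ => try apply flim_const
    end ].

Lemma flim_lipschitz (f : R -> R) (l C dl : R) : 0 < dl ->
  (forall h, h <> 0 -> Rabs h < dl -> Rabs (f h - l) <= C * Rabs h) ->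
  filterlim f (locally' 0) (locally l).
Proof.
  intros Hdl H. apply filterlim_locally. intros eps.
  assert (He : 0 < Rmin dl (eps / (Rabs C + 1))).
  { apply Rmin_pos; [assumption|]. apply Rdiv_lt_0_compat; [apply cond_pos | pose proof (Rabs_pos C); lra]. }
  exists (mkposreal _ He). intros h Hh Hnz. change (Rabs (h - 0) < Rmin dl (eps / (Rabs C + 1))) in Hh.
  rewrite Rminus_0_r in Hh.
  pose proof (Rmin_l dl (eps / (Rabs C + 1))). pose proof (Rmin_r dl (eps / (Rabs C + 1))).
  change (Rabs (f h - l) < eps).
  eapply Rle_lt_trans; [apply H; [assumption | lra]|].
  pose proof (Rabs_pos C). pose proof (Rle_abs C). pose proof (Rabs_pos h).
  apply Rle_lt_trans with ((Rabs C + 1) * Rabs h); [nra|].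
  apply Rlt_le_trans with ((Rabs C + 1) * (eps / (Rabs C + 1))).
  - apply Rmult_lt_compat_l; lra.
  - right; field; lra.
Qed.

Lemma is_derive_of_slope (f : R -> R) (x l : R) :
  filterlim (fun h => (f (x + h) - f x) / h) (locally' 0) (locally l) -> is_derive f x l.
Proof.
  intros H. apply is_derive_Reals. intros eps Heps.
  destruct (proj1 (filterlim_locally _ _) H (mkposreal eps Heps)) as [dl Hdl].
  exists dl. intros h Hh Hlt. apply Hdl; [|assumption].
  change (Rabs (h - 0) < dl). rewrite Rminus_0_r. assumption.
Qed.

(** * Rotation and expansion along slit trajectories *)

(** The angle by which the segment from the force point to the trajectory turns
    between the times [0] and [t]. As an integral it is a number, and not only a
    number modulo [2 PI]: this is how the argument around the force point becomes
    single-valued. *)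
Definition swing (X0 V0 : R -> R) (X V : R -> R -> R -> R) (t y : R) : R :=
  RInt (fun s => rate2 (X t y s) (V t y s) (X0 s) (V0 s)) 0 t.

(** Real and imaginary part of the logarithm of the derivative at [W_t + i y] of
    [g_t^{-1}]. *)
Definition expansion1 (X V : R -> R -> R -> R) (t y : R) : R :=
  RInt (fun s => - rate1 (X t y s) (V t y s) (X t y s) (V t y s)) 0 t.
Definition expansion2 (X V : R -> R -> R -> R) (t y : R) : R :=
  RInt (fun s => - rate2 (X t y s) (V t y s) (X t y s) (V t y s)) 0 t.

Section Slits.
Context {w : R -> R} {T K d : R} {X0 V0 : R -> R} {X V : R -> R -> R -> R}
  (S : slits w T K d X0 V0 X V).

Lemma slits_traj t y : 0 <= t < T -> 0 < y ->
  exists T', t < T' <= T /\ centered w T' (X t y) (V t y) /\ ends_above w T' K t y (X t y) (V t y).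
Proof.
  intros Ht Hy. destruct (slits_above S t y Ht Hy) as (T' & HT & Ha).
  exists T'. pose proof (above_time Ha).
  split; [lra | split; [apply (above_centered Ha) | exact Ha]].
Qed.

Lemma slits_norm_ge t y s : 0 <= t < T -> 0 < y -> 0 <= s <= t ->
  0 < X t y s ^ 2 + V t y s ^ 2 /\ y <= sqrt (X t y s ^ 2 + V t y s ^ 2).
Proof.
  intros Ht Hy Hs. destruct (slits_traj t y Ht Hy) as (T' & HT & _ & Ha).
  pose proof (above_V_ge Ha s Hs). pose proof (pow2_ge_0 (X t y s)).
  split; [nra|]. rewrite <- (sqrt_pow2 y) at 1 by lra. apply sqrt_le_1_alt. nra.
Qed.

Lemma rate_diff_bound (D y m x v x1 v1 x2 v2 : R) :
  0 < y -> 0 < m -> 0 < x ^ 2 + v ^ 2 -> 0 < x1 ^ 2 + v1 ^ 2 -> 0 < x2 ^ 2 + v2 ^ 2 ->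
  m <= sqrt (x ^ 2 + v ^ 2) -> y <= sqrt (x1 ^ 2 + v1 ^ 2) -> y <= sqrt (x2 ^ 2 + v2 ^ 2) ->
  sqrt ((x1 - x2) ^ 2 + (v1 - v2) ^ 2) <= D ->
  Rabs (rate1 x v x1 v1 - rate1 x v x2 v2) <= 2 / (m * y ^ 2) * D /\
  Rabs (rate2 x v x1 v1 - rate2 x v x2 v2) <= 2 / (m * y ^ 2) * D.
Proof.
  intros Hy Hm Hn H1 H2 Lm L1 L2 HD.
  destruct (rate_lipschitz x v x1 v1 x2 v2 Hn H1 H2) as [B1 B2]. cbv zeta in B1, B2.
  pose proof (sqrt_pos ((x1 - x2) ^ 2 + (v1 - v2) ^ 2)).
  set (D0 := sqrt ((x1 - x2) ^ 2 + (v1 - v2) ^ 2)) in *.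
  set (r := sqrt (x ^ 2 + v ^ 2)) in *. set (r1 := sqrt (x1 ^ 2 + v1 ^ 2)) in *.
  set (r2 := sqrt (x2 ^ 2 + v2 ^ 2)) in *.
  assert (Hle : 2 * D0 / (r * r1 * r2) <= 2 / (m * y ^ 2) * D).
  { replace (2 / (m * y ^ 2) * D) with (2 * D * / (m * y ^ 2)) by (unfold Rdiv; ring).
    assert (m * y <= r * r1) by (apply Rmult_le_compat; lra).
    assert (m * y ^ 2 <= r * r1 * r2).
    { replace (m * y ^ 2) with (m * y * y) by ring. apply Rmult_le_compat; nra. }
    assert (0 < m * y ^ 2) by (apply Rmult_lt_0_compat; nra).
    apply Rmult_le_compat; try lra.
    - left; apply Rinv_0_lt_compat; lra.
    - apply Rinv_le_contravar; lra. }
  lra.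
Qed.

Lemma rate_unif_bound (y m x v x1 v1 : R) :
  0 < y -> 0 < m -> 0 < x ^ 2 + v ^ 2 -> 0 < x1 ^ 2 + v1 ^ 2 ->
  m <= sqrt (x ^ 2 + v ^ 2) -> y <= sqrt (x1 ^ 2 + v1 ^ 2) ->
  Rabs (rate1 x v x1 v1) <= 2 / (m * y) /\ Rabs (rate2 x v x1 v1) <= 2 / (m * y).
Proof.
  intros Hy Hm Hn H1 Lm L1. destruct (rate_bound x v x1 v1 Hn H1) as [B1 B2].
  assert (Hmy : 0 < m * y) by (apply Rmult_lt_0_compat; lra).
  assert (2 / (sqrt (x ^ 2 + v ^ 2) * sqrt (x1 ^ 2 + v1 ^ 2)) <= 2 / (m * y)).
  { apply Rmult_le_compat_l; [lra|]. apply Rinv_le_contravar; [assumption|].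
    apply Rmult_le_compat; lra. }
  lra.
Qed.

Lemma swing_lipschitz y : 0 < y -> exists C, forall t1 t2, 0 <= t1 -> t1 <= t2 -> t2 < T ->
  Rabs (swing X0 V0 X V t1 y - swing X0 V0 X V t2 y) <= C * (t2 - t1).
Proof.
  intros Hy. destruct (slits_lipschitz_time S y Hy) as (C & HC & HL).
  pose proof (slits_d S) as Hd.
  pose proof (slits_force S) as Hf.
  exists (T * (2 / (d * y ^ 2) * C) + 2 / (d * y)). intros t1 t2 H1 H12 H2.
  destruct (slits_traj t1 y ltac:(lra) Hy) as (T1 & HT1 & Hc1 & Ha1).
  destruct (slits_traj t2 y ltac:(lra) Hy) as (T2 & HT2 & Hc2 & Ha2).
  assert (B0 : 0 <= 2 / (d * y ^ 2)) by (apply Rdiv_le_0_compat; [lra | apply Rmult_lt_0_compat; nra]).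
  eapply Rle_trans; [apply (RInt_diff_le _ _ t1 t2 (2 / (d * y ^ 2) * (C * (t2 - t1))) (2 / (d * y))); [lra | | | |]|].
  - intros x Hx. apply (rate_cont_centered Hc1 Hf); lra.
  - intros x Hx. apply (rate_cont_centered Hc2 Hf); lra.
  - intros x Hx. rewrite (rate2_sym _ _ (X0 x)), (rate2_sym (X t2 y x)).
    pose proof (slits_norm_ge t1 y x ltac:(lra) Hy ltac:(lra)).
    pose proof (slits_norm_ge t2 y x ltac:(lra) Hy ltac:(lra)).
    apply rate_diff_bound; try tauto.
    + apply (centered_nz Hf); lra.
    + apply (force_norm_ge S); lra.
    + apply HL; lra.
  - intros x Hx. rewrite rate2_sym.
    pose proof (slits_norm_ge t2 y x ltac:(lra) Hy ltac:(lra)).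
    apply rate_unif_bound; try tauto.
    + apply (centered_nz Hf); lra.
    + apply (force_norm_ge S); lra.
  - assert (0 <= 2 / (d * y ^ 2) * (C * (t2 - t1))) by (apply Rmult_le_pos; [lra | apply Rmult_le_pos; lra]).
    assert (t1 * (2 / (d * y ^ 2) * (C * (t2 - t1))) <= T * (2 / (d * y ^ 2) * (C * (t2 - t1))))
      by (apply Rmult_le_compat_r; lra). lra.
Qed.

(** [P(t2) - P(t1)], for the starting points [P] of the trajectories ending at the
    height [y], is computed by flowing back the difference from time [t1]. *)
Lemma slits_increment y t1 t2 : 0 < y -> 0 <= t1 -> t1 <= t2 -> t2 < T ->
  let J1 := RInt (fun s => - rate1 (X t2 y s) (V t2 y s) (X t1 y s) (V t1 y s)) 0 t1 in
  let J2 := RInt (fun s => - rate2 (X t2 y s) (V t2 y s) (X t1 y s) (V t1 y s)) 0 t1 in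
  X t2 y 0 - X t1 y 0 = exp J1 * (X t2 y t1 * cos J2 - (V t2 y t1 - y) * sin J2) /\
  V t2 y 0 - V t1 y 0 = exp J1 * (X t2 y t1 * sin J2 + (V t2 y t1 - y) * cos J2).
Proof.
  intros Hy H1 H12 H2 J1 J2.
  destruct (slits_traj t1 y ltac:(lra) Hy) as (T1 & HT1 & Hc1 & Ha1).
  destruct (slits_traj t2 y ltac:(lra) Hy) as (T2 & HT2 & Hc2 & Ha2).
  pose (Tm := Rmin T1 T2). assert (HTm : t1 < Tm) by (unfold Tm, Rmin; destruct Rle_dec; lra).
  destruct (diff_linear_ode (w := w) (T := Tm) (T' := T1) (s := t1) (X := X t2 y) (V := V t2 y) (X' := X t1 y) (V' := V t1 y)
    (centered_mono (Rmin_r T1 T2) Hc2) Hc1 (Rmin_l T1 T2) ltac:(lra)) as [E1 E2].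
  rewrite (above_X Ha1), Rminus_0_r in E1.
  rewrite (above_V Ha1) in E2.
  assert (Ho : forall k, (forall x, x < Tm -> continuous k x) -> RInt (fun x => - k x) 0 t1 = - RInt k 0 t1).
  { intros k Hk. apply (RInt_opp k). apply (@ex_RInt_continuous R_CompleteNormedModule).
    intros z Hz. apply Hk. rewrite Rmax_right in Hz; lra. }
  assert (Hrc : forall x, x < Tm ->
    continuous (fun s => rate1 (X t2 y s) (V t2 y s) (X t1 y s) (V t1 y s)) x /\
    continuous (fun s => rate2 (X t2 y s) (V t2 y s) (X t1 y s) (V t1 y s)) x).
  { intros x Hx. apply (rate_cont_centered (T := Tm) (centered_mono (Rmin_r T1 T2) Hc2) Hc1 (Rmin_l T1 T2)); lra. }
  unfold J1, J2. rewrite !Ho; [| intros x Hx; apply (Hrc x Hx) | intros x Hx; apply (Hrc x Hx)].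
  rewrite E1, E2, exp_Ropp, cos_neg, sin_neg.
  set (I1 := RInt _ 0 t1). set (I2 := RInt _ 0 t1).
  set (p := X t2 y 0 - X t1 y 0). set (q := V t2 y 0 - V t1 y 0).
  pose proof (sin2_cos2 I2) as Hsc. unfold Rsqr in Hsc. pose proof (exp_pos I1).
  split; (apply (Rmult_eq_reg_l (exp I1)); [|lra]); field_simplify; try lra.
  - transitivity (exp I1 * p * (sin I2 * sin I2 + cos I2 * cos I2)); [rewrite Hsc|]; ring.
  - transitivity (exp I1 * q * (sin I2 * sin I2 + cos I2 * cos I2)); [rewrite Hsc|]; ring.
Qed.
End Slits.

(** * Motion of the starting points *)

Section Slits.
Context {w : R -> R} {T K d : R} {X0 V0 : R -> R} {X V : R -> R -> R -> R}
  (S : slits w T K d X0 V0 X V).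

(** At the end [Z = i y], so that [Z' = 2 / (i y) - w]; the mean value theorem makes
    this quantitative. *)
Lemma slits_end_velocity t1 t2 y : 0 < t1 < t2 -> t2 < T -> 0 < y ->
  (exists c, t1 <= c <= t2 /\
     Rabs (X t2 y t1 / (t2 - t1) - w c) <= 2 * K / y ^ 2 * (t2 - t1)) /\
  Rabs ((V t2 y t1 - y) / (t2 - t1) - 2 / y) <=
    (4 / y ^ 3 + 2 * K ^ 2 * T / y ^ 3) * (t2 - t1).
Proof.
  intros H1 H2 Hy. pose proof (slits_K S) as HK.
  destruct (slits_traj S t2 y ltac:(lra) Hy) as (T' & HT & Hc & Ha).
  assert (HX := above_X Ha). assert (HV := above_V Ha).
  assert (Hb : forall c, t1 <= c <= t2 -> Rabs (X t2 y c) <= K * (t2 - t1) /\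
    y <= V t2 y c /\ V t2 y c - y <= 2 / y * (t2 - t1)).
  { intros c Hcc. split; [|split].
    - eapply Rle_trans; [apply (above_X_bound Ha); lra|]. apply Rmult_le_compat_l; lra.
    - apply (above_V_ge Ha); lra.
    - pose proof (above_V_upper Ha c ltac:(lra)). pose proof (above_V_ge Ha c ltac:(lra)).
      apply (Rmult_le_reg_r y); [assumption|].
      replace (2 / y * (t2 - t1) * y) with (2 * (t2 - t1)) by (field; lra). nra. }
  split.
  - destruct (MVT_gen (X t2 y) t1 t2 (fun s => 2 * X t2 y s / (X t2 y s ^ 2 + V t2 y s ^ 2) - w s))
      as (c & Hcc & E).
    { intros x Hx. rewrite Rmin_left, Rmax_right in Hx by lra.
      apply (centered_derive Hc); lra. }
    { intros x Hx. rewrite Rmin_left, Rmax_right in Hx by lra.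
      apply continuity_pt_filterlim, (centered_cont Hc); lra. }
    rewrite Rmin_left, Rmax_right in Hcc by lra. rewrite HX in E.
    exists c. split; [assumption|].
    replace (X t2 y t1) with (- (0 - X t2 y t1)) by ring. rewrite E.
    set (q := 2 * X t2 y c / (X t2 y c ^ 2 + V t2 y c ^ 2)).
    replace (- ((q - w c) * (t2 - t1)) / (t2 - t1) - w c) with (- q) by (field; lra).
    rewrite Rabs_Ropp. unfold q. destruct (Hb c Hcc) as (B1 & B2 & _).
    pose proof (pow2_ge_0 (X t2 y c)).
    unfold Rdiv. rewrite Rabs_mult, Rabs_inv, Rabs_mult, (Rabs_pos_eq 2) by lra.
    rewrite (Rabs_pos_eq (_ + _)) by nra.
    replace (2 * K * / y ^ 2 * (t2 - t1)) with (2 * (K * (t2 - t1)) * / y ^ 2) by ring.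
    apply Rmult_le_compat; [pose proof (Rabs_pos (X t2 y c)); lra
      | left; apply Rinv_0_lt_compat; nra | lra | apply Rinv_le_contravar; nra].
  - destruct (MVT_gen (V t2 y) t1 t2 (fun s => - (2 * V t2 y s / (X t2 y s ^ 2 + V t2 y s ^ 2))))
      as (c & Hcc & E).
    { intros x Hx. rewrite Rmin_left, Rmax_right in Hx by lra.
      apply (centered_derive Hc); lra. }
    { intros x Hx. rewrite Rmin_left, Rmax_right in Hx by lra.
      apply continuity_pt_filterlim, (centered_cont Hc); lra. }
    rewrite Rmin_left, Rmax_right in Hcc by lra. rewrite HV in E.
    replace (V t2 y t1 - y) with (- (y - V t2 y t1)) by ring. rewrite E.
    destruct (Hb c Hcc) as (B1 & B2 & B3). set (x := X t2 y c) in *. set (v := V t2 y c) in *.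
    assert (Hx2 : x ^ 2 <= (K * (t2 - t1)) ^ 2).
    { apply Rabs_le_between in B1. nra. }
    assert (Hn : 0 < x ^ 2 + v ^ 2) by (pose proof (pow2_ge_0 x); nra).
    replace (- (- (2 * v / (x ^ 2 + v ^ 2)) * (t2 - t1)) / (t2 - t1) - 2 / y)
      with (- (2 * (v * (v - y) + x ^ 2) / (y * (x ^ 2 + v ^ 2)))) by (field; lra).
    rewrite Rabs_Ropp, Rabs_pos_eq.
    2: { apply Rdiv_le_0_compat; [pose proof (pow2_ge_0 x); nra | apply Rmult_lt_0_compat; lra]. }
    replace (2 * (v * (v - y) + x ^ 2) / (y * (x ^ 2 + v ^ 2))) with
      (2 / y * ((v - y) * (v / (x ^ 2 + v ^ 2))) + 2 / y * (x ^ 2 * / (x ^ 2 + v ^ 2))) by (field; lra).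
    assert (H2y : 0 < 2 / y) by (apply Rdiv_lt_0_compat; lra).
    replace ((4 / y ^ 3 + 2 * K ^ 2 * T / y ^ 3) * (t2 - t1)) with
      (2 / y * (2 / y * (t2 - t1) * / y) + 2 / y * (K ^ 2 * T * (t2 - t1) * / y ^ 2)) by (field; lra).
    assert (Hvn : v / (x ^ 2 + v ^ 2) <= / y).
    { apply (Rmult_le_reg_r ((x ^ 2 + v ^ 2) * y)); [apply Rmult_lt_0_compat; lra|].
      field_simplify; [|lra|lra]. pose proof (pow2_ge_0 x). nra. }
    assert (0 < v / (x ^ 2 + v ^ 2)) by (apply Rdiv_lt_0_compat; lra).
    apply Rplus_le_compat; (apply Rmult_le_compat_l; [lra|]); apply Rmult_le_compat; try lra.
    + apply pow2_ge_0.
    + left; apply Rinv_0_lt_compat; lra.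
    + assert ((t2 - t1) * (t2 - t1) <= T * (t2 - t1)) by (apply Rmult_le_compat_r; lra).
      assert (0 <= K ^ 2) by apply pow2_ge_0. nra.
    + apply Rinv_le_contravar; [nra|]. pose proof (pow2_ge_0 x). nra.
Qed.

(** Above the height [y] the integrands are Lipschitz functions of the trajectories,
    which are Lipschitz functions of their final times. *)
Lemma expansion_lipschitz y : 0 < y -> exists C, forall t t1 t2, 0 <= t1 -> t1 <= t <= t2 -> t2 < T ->
  Rabs (RInt (fun s => - rate1 (X t2 y s) (V t2 y s) (X t1 y s) (V t1 y s)) 0 t1 -
    expansion1 X V t y) <= C * (t2 - t1) /\
  Rabs (RInt (fun s => - rate2 (X t2 y s) (V t2 y s) (X t1 y s) (V t1 y s)) 0 t1 -
    expansion2 X V t y) <= C * (t2 - t1).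
Proof.
  intros Hy. destruct (slits_lipschitz_time S y Hy) as (C & HC & HL).
  exists (T * (2 / (y * y ^ 2) * C + 2 / (y * y ^ 2) * C) + 2 / (y * y)).
  intros t t1 t2 H1 Ht H2.
  assert (B0 : 0 <= 2 / (y * y ^ 2)) by (apply Rdiv_le_0_compat; [lra | apply Rmult_lt_0_compat; nra]).
  destruct (slits_traj S t y ltac:(lra) Hy) as (T0 & HT0 & Hc0 & Ha0).
  destruct (slits_traj S t1 y ltac:(lra) Hy) as (T1 & HT1 & Hc1 & Ha1).
  destruct (slits_traj S t2 y ltac:(lra) Hy) as (T2 & HT2 & Hc2 & Ha2).
  assert (N : forall s, 0 <= s <= t1 ->
    (0 < X t y s ^ 2 + V t y s ^ 2 /\ y <= sqrt (X t y s ^ 2 + V t y s ^ 2)) /\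
    (0 < X t1 y s ^ 2 + V t1 y s ^ 2 /\ y <= sqrt (X t1 y s ^ 2 + V t1 y s ^ 2)) /\
    (0 < X t2 y s ^ 2 + V t2 y s ^ 2 /\ y <= sqrt (X t2 y s ^ 2 + V t2 y s ^ 2))).
  { intros s Hs. repeat split; apply (slits_norm_ge S); lra. }
  pose (e := 2 / (y * y ^ 2) * (C * (t2 - t1)) + 2 / (y * y ^ 2) * (C * (t2 - t1))).
  assert (He : 0 <= e).
  { assert (0 <= 2 / (y * y ^ 2) * (C * (t2 - t1))) by (apply Rmult_le_pos; [lra | apply Rmult_le_pos; lra]).
    unfold e; lra. }
  assert (Hd : forall s, 0 <= s <= t1 ->
    Rabs (rate1 (X t2 y s) (V t2 y s) (X t1 y s) (V t1 y s) - rate1 (X t y s) (V t y s) (X t y s) (V t y s)) <= e /\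
    Rabs (rate2 (X t2 y s) (V t2 y s) (X t1 y s) (V t1 y s) - rate2 (X t y s) (V t y s) (X t y s) (V t y s)) <= e).
  { intros s Hs. destruct (N s Hs) as ((n0 & m0) & (n1 & m1) & (n2 & m2)).
    assert (L1 : sqrt ((X t1 y s - X t y s) ^ 2 + (V t1 y s - V t y s) ^ 2) <= C * (t2 - t1)).
    { eapply Rle_trans; [apply HL; lra|]. apply Rmult_le_compat_l; lra. }
    assert (L2 : sqrt ((X t y s - X t2 y s) ^ 2 + (V t y s - V t2 y s) ^ 2) <= C * (t2 - t1)).
    { eapply Rle_trans; [apply HL; lra|]. apply Rmult_le_compat_l; lra. }
    destruct (rate_diff_bound _ y y _ _ _ _ _ _ Hy Hy n2 n1 n0 m2 m1 m0 L1) as [A1 A2].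
    destruct (rate_diff_bound _ y y _ _ _ _ _ _ Hy Hy n0 n0 n2 m0 m0 m2 L2) as [A3 A4].
    rewrite (rate1_sym (X t y s) (V t y s) (X t2 y s)) in A3.
    rewrite (rate2_sym (X t y s) (V t y s) (X t2 y s)) in A4.
    split; unfold e.
    - eapply Rle_trans; [|apply Rplus_le_compat; [exact A1 | exact A3]].
      rewrite <- (Rabs_Ropp (rate1 (X t y s) _ _ _ - _)).
      eapply Rle_trans; [|apply Rabs_triang]. right; f_equal; ring.
    - eapply Rle_trans; [|apply Rplus_le_compat; [exact A2 | exact A4]].
      rewrite <- (Rabs_Ropp (rate2 (X t y s) _ _ _ - _)).
      eapply Rle_trans; [|apply Rabs_triang]. right; f_equal; ring. }
  assert (Hc12 : forall s, 0 <= s <= t1 ->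
    continuous (fun s => rate1 (X t2 y s) (V t2 y s) (X t1 y s) (V t1 y s)) s /\
    continuous (fun s => rate2 (X t2 y s) (V t2 y s) (X t1 y s) (V t1 y s)) s).
  { intros s Hs. destruct (N s Hs) as (_ & (n1 & _) & (n2 & _)).
    destruct (centered_cont Hc1 s ltac:(lra)). destruct (centered_cont Hc2 s ltac:(lra)).
    apply (rate_cont (X t2 y) (V t2 y) (X t1 y) (V t1 y)); assumption. }
  assert (Hc00 : forall s, 0 <= s <= t ->
    continuous (fun s => rate1 (X t y s) (V t y s) (X t y s) (V t y s)) s /\
    continuous (fun s => rate2 (X t y s) (V t y s) (X t y s) (V t y s)) s).
  { intros s Hs. apply (rate_cont_centered Hc0 Hc0 ltac:(lra)); lra. }
  assert (Hf : t1 * e + (t - t1) * (2 / (y * y)) <=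
    (T * (2 / (y * y ^ 2) * C + 2 / (y * y ^ 2) * C) + 2 / (y * y)) * (t2 - t1)).
  { assert (t1 * e <= T * e) by (apply Rmult_le_compat_r; lra).
    assert (0 < 2 / (y * y)) by (apply Rdiv_lt_0_compat; nra).
    assert ((t - t1) * (2 / (y * y)) <= (t2 - t1) * (2 / (y * y))) by (apply Rmult_le_compat_r; lra).
    unfold e in *. lra. }
  split; (eapply Rle_trans; [|exact Hf]); apply RInt_diff_le; try lra.
  - intros s Hs. exact (cont_opp _ _ (proj1 (Hc12 s Hs))).
  - intros s Hs. exact (cont_opp _ _ (proj1 (Hc00 s Hs))).
  - intros s Hs. rewrite <- Rabs_Ropp. replace (- (- _ - - _)) with
      (rate1 (X t2 y s) (V t2 y s) (X t1 y s) (V t1 y s) - rate1 (X t y s) (V t y s) (X t y s) (V t y s)) by ring.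
    apply Hd, Hs.
  - intros s Hs. rewrite Rabs_Ropp. pose proof (slits_norm_ge S t y s ltac:(lra) Hy ltac:(lra)) as [? ?].
    apply rate_unif_bound; assumption.
  - intros s Hs. exact (cont_opp _ _ (proj2 (Hc12 s Hs))).
  - intros s Hs. exact (cont_opp _ _ (proj2 (Hc00 s Hs))).
  - intros s Hs. rewrite <- Rabs_Ropp. replace (- (- _ - - _)) with
      (rate2 (X t2 y s) (V t2 y s) (X t1 y s) (V t1 y s) - rate2 (X t y s) (V t y s) (X t y s) (V t y s)) by ring.
    apply Hd, Hs.
  - intros s Hs. rewrite Rabs_Ropp. pose proof (slits_norm_ge S t y s ltac:(lra) Hy ltac:(lra)) as [? ?].
    apply rate_unif_bound; assumption.
Qed.

(** With [f_t = g_t^{-1}], this is the formula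
    [d/dt f_t(W_t + i y) = f_t'(W_t + i y) (w + 2 i / y)] given by Loewner's equation
    for [f_t]. The two lemmas above evaluate the difference quotients given by
    [slits_increment]. *)
Lemma slits_start_derive t y : 0 < t < T -> 0 < y ->
  let J1 := expansion1 X V t y in let J2 := expansion2 X V t y in
  is_derive (fun t => X t y 0) t (exp J1 * (w t * cos J2 - 2 / y * sin J2)) /\
  is_derive (fun t => V t y 0) t (exp J1 * (w t * sin J2 + 2 / y * cos J2)).
Proof.
  intros Ht Hy J1 J2.
  destruct (expansion_lipschitz y Hy) as (C & HC).
  pose (t1 := fun h => Rmin t (t + h)). pose (t2 := fun h => Rmax t (t + h)).
  pose (dl := Rmin t (T - t)).
  assert (Hdl : 0 < dl) by (apply Rmin_pos; lra).
  assert (Hh : forall h, h <> 0 -> Rabs h < dl ->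
    0 < t1 h < t2 h /\ t1 h <= t <= t2 h /\ t2 h < T /\ t2 h - t1 h = Rabs h).
  { intros h Hnz Hlt. unfold dl in Hlt.
    pose proof (Rmin_l t (T - t)). pose proof (Rmin_r t (T - t)).
    unfold t1, t2, Rmin, Rmax, Rabs in *. destruct (Rcase_abs h); destruct (Rle_dec t (t + h)); lra. }
  pose (A := fun h => X (t2 h) y (t1 h) / (t2 h - t1 h)).
  pose (B := fun h => (V (t2 h) y (t1 h) - y) / (t2 h - t1 h)).
  pose (j1 := fun h : R => RInt (fun s => - rate1 (X (t2 h) y s) (V (t2 h) y s) (X (t1 h) y s) (V (t1 h) y s)) 0 (t1 h) : R).
  pose (j2 := fun h => RInt (fun s => - rate2 (X (t2 h) y s) (V (t2 h) y s) (X (t1 h) y s) (V (t1 h) y s)) 0 (t1 h) : R).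
  assert (LA : filterlim A (locally' 0) (locally (w t))).
  { pose (Kc := 2 * K / y ^ 2).
    assert (HKc : 0 < Kc).
    { pose proof (slits_K S). apply Rdiv_lt_0_compat; nra. }
    apply filterlim_locally. intros eps.
    assert (He2 : 0 < eps / 2) by (pose proof (cond_pos eps); lra).
    destruct (continuous_eps w t (eps / 2) (proj1 (slits_w S t ltac:(lra))) He2)
      as (d1 & Hd1p & Hd1).
    assert (Hm : 0 < Rmin dl (Rmin d1 (eps / 2 / Kc))).
    { apply Rmin_pos; [assumption | apply Rmin_pos; [assumption | apply Rdiv_lt_0_compat; lra]]. }
    exists (mkposreal _ Hm). intros h Hlt Hnz.
    change (Rabs (h - 0) < Rmin dl (Rmin d1 (eps / 2 / Kc))) in Hlt. rewrite Rminus_0_r in Hlt.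
    pose proof (Rmin_l dl (Rmin d1 (eps / 2 / Kc))). pose proof (Rmin_r dl (Rmin d1 (eps / 2 / Kc))).
    pose proof (Rmin_l d1 (eps / 2 / Kc)). pose proof (Rmin_r d1 (eps / 2 / Kc)).
    destruct (Hh h Hnz ltac:(lra)) as (h1 & h2 & h3 & h4).
    destruct (slits_end_velocity (t1 h) (t2 h) y h1 h3 Hy) as [(c & Hc & Hb) _].
    fold (A h) in Hb. fold Kc in Hb. change (Rabs (A h - w t) < eps).
    assert (Hw : Rabs (w c - w t) < eps / 2).
    { apply (Hd1 c). change (Rabs (c - t) < d1).
      apply Rle_lt_trans with (Rabs h); [|lra]. rewrite <- h4.
      apply Rabs_le; lra. }
    assert (Kc * (t2 h - t1 h) < eps / 2).
    { rewrite h4. apply Rlt_le_trans with (Kc * (eps / 2 / Kc)).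
      - apply Rmult_lt_compat_l; lra.
      - right; field; lra. }
    replace (A h - w t) with (A h - w c + (w c - w t)) by ring.
    eapply Rle_lt_trans; [apply Rabs_triang|]. lra. }
  assert (LB : filterlim B (locally' 0) (locally (2 / y))).
  { apply (flim_lipschitz B (2 / y) (4 / y ^ 3 + 2 * K ^ 2 * T / y ^ 3) dl Hdl).
    intros h Hnz Hlt. destruct (Hh h Hnz Hlt) as (h1 & h2 & h3 & h4).
    rewrite <- h4. apply (slits_end_velocity (t1 h) (t2 h) y h1 h3 Hy). }
  assert (L1 : filterlim j1 (locally' 0) (locally J1)).
  { apply (flim_lipschitz j1 J1 C dl Hdl).
    intros h Hnz Hlt. destruct (Hh h Hnz Hlt) as (h1 & h2 & h3 & h4).
    rewrite <- h4. exact (proj1 (HC t (t1 h) (t2 h) ltac:(lra) h2 h3)). }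
  assert (L2 : filterlim j2 (locally' 0) (locally J2)).
  { apply (flim_lipschitz j2 J2 C dl Hdl).
    intros h Hnz Hlt. destruct (Hh h Hnz Hlt) as (h1 & h2 & h3 & h4).
    rewrite <- h4. exact (proj2 (HC t (t1 h) (t2 h) ltac:(lra) h2 h3)). }
  assert (Hloc : forall P : R -> Prop, (forall h, h <> 0 -> Rabs h < dl -> P h) -> locally' 0 P).
  { intros P HP. exists (mkposreal dl Hdl). intros h Hlt Hnz.
    change (Rabs (h - 0) < dl) in Hlt. rewrite Rminus_0_r in Hlt. apply HP; assumption. }
  assert (Hswap : forall (f : R -> R) h, h <> 0 -> Rabs h < dl ->
    (f (t + h) - f t) / h = (f (t2 h) - f (t1 h)) / (t2 h - t1 h)).
  { intros f h Hnz Hlt. unfold t1, t2, Rmin, Rmax.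
    destruct (Rle_dec t (t + h)); field; lra. }
  split; apply is_derive_of_slope.
  - apply (filterlim_ext_loc (fun h => exp (j1 h) * (A h * cos (j2 h) - B h * sin (j2 h)))); [|flim].
    apply Hloc. intros h Hnz Hlt. destruct (Hh h Hnz Hlt) as (h1 & h2 & h3 & h4).
    rewrite (Hswap (fun t => X t y 0) h Hnz Hlt).
    destruct (slits_increment S y (t1 h) (t2 h) Hy ltac:(lra) ltac:(lra) h3) as [E _]. cbv zeta in E.
    rewrite E. fold (j1 h). fold (j2 h). unfold A, B. field. lra.
  - apply (filterlim_ext_loc (fun h => exp (j1 h) * (A h * sin (j2 h) + B h * cos (j2 h)))); [|flim].
    apply Hloc. intros h Hnz Hlt. destruct (Hh h Hnz Hlt) as (h1 & h2 & h3 & h4).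
    rewrite (Hswap (fun t => V t y 0) h Hnz Hlt).
    destruct (slits_increment S y (t1 h) (t2 h) Hy ltac:(lra) ltac:(lra) h3) as [_ E]. cbv zeta in E.
    rewrite E. fold (j1 h). fold (j2 h). unfold A, B. field. lra.
Qed.
End Slits.

(** * The invariant of the Loewner flow *)

Lemma arg_H_vertical y : arg_H (0, y) = PI / 2.
Proof.
  unfold arg_H. simpl Re. unfold Rdiv at 1. rewrite Rmult_0_l. apply acos_0.
Qed.

Section Slits.
Context {w : R -> R} {T K d : R} {X0 V0 : R -> R} {X V : R -> R -> R -> R}
  (S : slits w T K d X0 V0 X V) {rho : R}
  (Hrho : forall s, s < T -> w s = - rho * X0 s / (X0 s ^ 2 + V0 s ^ 2)).

(** The expression [g' (g - W) ((g - z) (g - conj z))^{rho/4}], where [g] is the Loewner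
    map and [z] the image of the force point, is constant in time: in its
    logarithmic derivative [- 2 / Z^2 + (2 / Z^2 - w / Z) + w / Z] the last term comes
    from the factors with the force point, by the equation for the driving function. *)
Lemma expansion_eq t y : 0 <= t < T -> 0 < y ->
  let P1 := X t y 0 in let P2 := V t y 0 in
  0 < (P1 - X0 0) ^ 2 + (P2 - V0 0) ^ 2 ->
  expansion1 X V t y = ln y - ln (sqrt (P1 ^ 2 + P2 ^ 2)) + rho / 4 *
    (ln (sqrt (X0 t ^ 2 + (y - V0 t) ^ 2)) - ln (sqrt ((P1 - X0 0) ^ 2 + (P2 - V0 0) ^ 2)) +
    (ln (sqrt (X0 t ^ 2 + (y + V0 t) ^ 2)) - ln (sqrt ((P1 - X0 0) ^ 2 + (P2 + V0 0) ^ 2)))) /\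
  expansion2 X V t y = PI / 2 - arg_H (P1, P2) + rho / 4 *
    (swing X0 V0 X V t y + (arg_H (- X0 t, y + V0 t) - arg_H (P1 - X0 0, P2 + V0 0))).
Proof.
  intros Ht Hy P1 P2 HP.
  destruct (slits_traj S t y Ht Hy) as (T' & HT & Hc & Ha).
  pose proof (slits_force S) as Hf.
  pose proof (centered_conj Hf) as Hf'.
  assert (HV : forall x, 0 <= x < T' -> 0 < V t y x)
    by (intros x Hx; apply (centered_V_pos x Hc ); [apply (above_start Ha) | lra]).
  assert (HV0 : forall x, 0 <= x < T' -> 0 <= V0 x) by (intros x Hx; apply (force_V_nonneg S); lra).
  assert (HX : X t y t = 0) by apply (above_X Ha).
  assert (HVt : V t y t = y) by apply (above_V Ha).
  pose proof (HV 0 ltac:(lra)) as HP2. fold P2 in HP2. pose proof (HV0 0 ltac:(lra)) as HV00.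
  pose proof (diff_log_modulus Hc Hf ltac:(lra) (s := t) ltac:(lra) HP) as M1.
  pose proof (diff_log_modulus Hc Hf' ltac:(lra) (s := t) ltac:(lra)) as M2.
  specialize (M2 ltac:(pose proof (pow2_ge_0 (X t y 0 - X0 0)); fold P2; nra)).
  pose proof (diff_angle Hc Hf' ltac:(lra) (s := t) ltac:(lra)) as A2. cbv beta in A2.
  specialize (A2 ltac:(intros x Hx; specialize (HV x ltac:(lra)); specialize (HV0 x ltac:(lra)); lra)).
  rewrite HX, HVt in M1, M2, A2. fold P1 P2 in M1, M2, A2.
  replace ((0 - X0 t) ^ 2) with (X0 t ^ 2) in M1, M2 by ring.
  replace (y - - V0 t) with (y + V0 t) in M2, A2 by ring.
  replace (P2 - - V0 0) with (P2 + V0 0) in M2, A2 by ring.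
  rewrite Rminus_0_l in A2.
  (* Subtracting the rates of the two force points turns [2 / Z^2] into the
     logarithmic derivative [2 / Z^2 - w / Z] of the trajectory. *)
  pose (r1 := fun x => rate1 (X t y x) (V t y x) (X t y x) (V t y x)).
  pose (r2 := fun x => rate2 (X t y x) (V t y x) (X t y x) (V t y x)).
  pose (a1 := fun x => rate1 (X t y x) (V t y x) (X0 x) (V0 x)).
  pose (a2 := fun x => rate2 (X t y x) (V t y x) (X0 x) (V0 x)).
  pose (b1 := fun x => rate1 (X t y x) (V t y x) (X0 x) (- V0 x)).
  pose (b2 := fun x => rate2 (X t y x) (V t y x) (X0 x) (- V0 x)).
  assert (Cr : forall x, x < T' -> continuous r1 x /\ continuous r2 x)
    by (intros x Hx; apply (rate_cont_centered Hc Hc); lra).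
  assert (Ca : forall x, x < T' -> continuous a1 x /\ continuous a2 x)
    by (intros x Hx; apply (rate_cont_centered Hc Hf); lra).
  assert (Cb : forall x, x < T' -> continuous b1 x /\ continuous b2 x)
    by (intros x Hx; apply (rate_cont_centered Hc Hf'); lra).
  assert (Dp : forall k, (forall x, x < T' -> continuous k x) -> forall x, x < T' ->
    is_derive (fun z => RInt k 0 z) x (k x))
    by (intros k Hk x Hx; apply (is_derive_primitive k T'); auto; lra).
  pose (k1 := fun x => - r1 x - rho / 4 * (a1 x + b1 x)).
  pose (k2 := fun x => - r2 x - rho / 4 * (a2 x + b2 x)).
  pose (I1 := fun x => RInt (fun z => - r1 z) 0 x - rho / 4 * (RInt a1 0 x + RInt b1 0 x)).
  pose (I2 := fun x => RInt (fun z => - r2 z) 0 x - rho / 4 * (RInt a2 0 x + RInt b2 0 x)).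
  assert (HI : forall x, x < T' -> is_derive I1 x (k1 x) /\ is_derive I2 x (k2 x)).
  { intros x Hx.
    assert (e1 := Dp (fun z => - r1 z) (fun z Hz => cont_opp _ _ (proj1 (Cr z Hz))) x Hx).
    assert (e2 := Dp (fun z => - r2 z) (fun z Hz => cont_opp _ _ (proj2 (Cr z Hz))) x Hx).
    assert (e3 := Dp a1 (fun z Hz => proj1 (Ca z Hz)) x Hx).
    assert (e4 := Dp a2 (fun z Hz => proj2 (Ca z Hz)) x Hx).
    assert (e5 := Dp b1 (fun z Hz => proj1 (Cb z Hz)) x Hx).
    assert (e6 := Dp b2 (fun z Hz => proj2 (Cb z Hz)) x Hx).
    split.
    - apply (is_derive_minus (fun x => RInt (fun z => - r1 z) 0 x)); [exact e1|].
      apply (is_derive_scal (fun x => RInt a1 0 x + RInt b1 0 x)).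
      apply (is_derive_plus (fun x => RInt a1 0 x)); assumption.
    - apply (is_derive_minus (fun x => RInt (fun z => - r2 z) 0 x)); [exact e2|].
      apply (is_derive_scal (fun x => RInt a2 0 x + RInt b2 0 x)).
      apply (is_derive_plus (fun x => RInt a2 0 x)); assumption. }
  assert (R0 : forall k : R -> R, RInt k 0 0 = 0) by (intros k; apply (RInt_point 0 k)).
  assert (I10 : I1 0 = 0) by (unfold I1; rewrite !R0; ring).
  assert (I20 : I2 0 = 0) by (unfold I2; rewrite !R0; ring).
  assert (Hcont : forall x, x < T' -> continuous (X t y) x /\ continuous (V t y) x /\
     continuous I1 x /\ continuous I2 x).
  { intros x Hx. destruct (centered_cont Hc x Hx). destruct (HI x Hx) as [e1 e2].
    apply continuous_of_derive in e1, e2. auto. }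
  assert (Hder : forall x, 0 < x < T' ->
     is_derive (X t y) x (k1 x * X t y x - k2 x * V t y x) /\
     is_derive (V t y) x (k2 x * X t y x + k1 x * V t y x) /\
     is_derive I1 x (k1 x) /\ is_derive I2 x (k2 x)).
  { intros x Hx. destruct (centered_derive Hc x Hx) as [e1 e2].
    pose proof (centered_nz Hc x ltac:(lra)) as n.
    pose proof (centered_nz Hf x ltac:(lra)) as n0.
    split; [|split; [|apply HI; lra]].
    - evar_last; [exact e1|]. rewrite (Hrho x ltac:(lra)).
      unfold k1, k2, r1, r2, a1, a2, b1, b2, rate1, rate2.
      replace ((- V0 x) ^ 2) with (V0 x ^ 2) by ring. field; split; lra.
    - evar_last; [exact e2|].
      unfold k1, k2, r1, r2, a1, a2, b1, b2, rate1, rate2.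
      replace ((- V0 x) ^ 2) with (V0 x ^ 2) by ring. field; split; lra. }
  pose proof (linear_ode_log_modulus (a := X t y) (b := V t y) (T := T') (s := t)
    ltac:(lra) Hcont Hder I10 I20) as M.
  pose proof (linear_ode_angle (a := X t y) (b := V t y) (T := T') (s := t)
    ltac:(lra) Hcont Hder I10 I20) as A.
  fold P1 P2 in M, A. rewrite HX, HVt in M, A.
  specialize (M ltac:(pose proof (pow2_ge_0 P1); nra)).
  specialize (A ltac:(intros x Hx; apply HV; lra)). rewrite arg_H_vertical in A.
  replace (sqrt (0 ^ 2 + y ^ 2)) with y in M
    by (rewrite pow_i, Rplus_0_l, sqrt_pow2 by (try lia; lra); reflexivity).
  unfold expansion1, expansion2, swing.
  change (RInt (fun s => rate2 (X t y s) (V t y s) (X0 s) (V0 s)) 0 t) with (RInt a2 0 t).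
  unfold I1, r1 in M. unfold I2, r2 in A.
  unfold a1, b1 in M. unfold b2 in A. split.
  - rewrite <- M1, <- M2. lra.
  - rewrite <- A2. lra.
Qed.

(** The number in question is [(i y - Z0(t)) conj (P - z0)], with [P] the starting point. *)
Lemma swing_polar t y : 0 <= t < T -> 0 < y ->
  let P1 := X t y 0 - X0 0 in let P2 := V t y 0 - V0 0 in
  let A := - X0 t in let B := y - V0 t in
  let r := sqrt (A ^ 2 + B ^ 2) * sqrt (P1 ^ 2 + P2 ^ 2) in
  A * P1 + B * P2 = r * cos (swing X0 V0 X V t y) /\
  B * P1 - A * P2 = r * sin (swing X0 V0 X V t y).
Proof.
  intros Ht Hy P1 P2 A B r.
  destruct (slits_traj S t y Ht Hy) as (T' & HT & Hc & Ha).
  pose proof (slits_force S) as Hf.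
  destruct (diff_linear_ode Hc Hf ltac:(lra) (s := t) ltac:(lra)) as [E1 E2].
  pose proof (linear_ode_modulus (diff_ode_cont Hc Hf ltac:(lra) (s := t) ltac:(lra))
    (diff_ode_derive Hc Hf ltac:(lra) (s := t) ltac:(lra)) (RInt_point 0 _) (RInt_point 0 _) t ltac:(lra)) as M.
  cbv beta in M.
  rewrite (above_X Ha), Rminus_0_l in E1, M.
  rewrite (above_V Ha) in E2, M.
  fold P1 P2 in E1, E2, M. fold A in E1, M. fold B in E2, M.
  change (RInt (fun x => rate2 (X t y x) (V t y x) (X0 x) (V0 x)) 0 t) with (swing X0 V0 X V t y) in E1, E2.
  unfold r. rewrite M.
  set (I := exp _) in *. set (th := swing X0 V0 X V t y) in *.
  pose proof (pow2_ge_0 P1). pose proof (pow2_ge_0 P2).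
  pose proof (sqrt_sqrt (P1 ^ 2 + P2 ^ 2) ltac:(lra)) as Q.
  set (q := sqrt (P1 ^ 2 + P2 ^ 2)) in *.
  replace (I * q * q) with (I * (q * q)) by ring. rewrite Q, E1, E2. split; ring.
Qed.
End Slits.

(** * Uniform convergence of the swing *)

(** Multiply the difference of the vectors by [e^{- i b'}]: its imaginary part is
    [r sin (b - b')], and its real part is [r cos (b - b') - r']. *)
Lemma close_vectors_angle (r r' b b' c e : R) :
  0 < c <= r -> c <= r' -> 2 * e < c ->
  Rabs (r * cos b - r' * cos b') <= e -> Rabs (r * sin b - r' * sin b') <= e ->
  0 < cos (b - b') /\ Rabs (sin (b - b')) <= 2 * e / c.
Proof.
  intros Hr Hr' He Hc Hs.
  assert (Bc : Rabs (cos b') <= 1) by (apply Rabs_le, COS_bound).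
  assert (Bs : Rabs (sin b') <= 1) by (apply Rabs_le, SIN_bound).
  pose proof (sin2_cos2 b') as Hsc. unfold Rsqr in Hsc.
  assert (Hp : forall u v, Rabs u <= e -> Rabs v <= 1 -> Rabs (u * v) <= e).
  { intros u v Hu Hv. rewrite Rabs_mult. pose proof (Rabs_pos u). pose proof (Rabs_pos v). nra. }
  split.
  - assert (E : r * cos (b - b') = r' + ((r * cos b - r' * cos b') * cos b' + (r * sin b - r' * sin b') * sin b')).
    { rewrite cos_minus.
      transitivity (r * (cos b * cos b' + sin b * sin b') + r' * (1 - (sin b' * sin b' + cos b' * cos b')));
        [rewrite Hsc|]; ring. }
    pose proof (Hp _ _ Hc Bc) as P1. pose proof (Hp _ _ Hs Bs) as P2.
    apply Rabs_le_between in P1, P2. apply (Rmult_lt_reg_l r); [lra|]. rewrite E. lra.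
  - assert (E : r * sin (b - b') = (r * sin b - r' * sin b') * cos b' - (r * cos b - r' * cos b') * sin b')
      by (rewrite sin_minus; ring).
    pose proof (Hp _ _ Hs Bc) as P1. pose proof (Hp _ _ Hc Bs) as P2.
    apply Rabs_le_between in P1, P2.
    assert (Hrs : Rabs (r * sin (b - b')) <= 2 * e) by (rewrite E; apply Rabs_le; lra).
    rewrite Rabs_mult, Rabs_pos_eq in Hrs by lra. pose proof (Rabs_pos (sin (b - b'))).
    apply (Rmult_le_reg_l c); [lra|]. replace (c * (2 * e / c)) with (2 * e) by (field; lra). nra.
Qed.

Section Slits.
Context {w : R -> R} {T K d : R} {X0 V0 : R -> R} {X V : R -> R -> R -> R}
  (S : slits w T K d X0 V0 X V).

Lemma slits_lipschitz_height t y y' : 0 <= t < T -> 0 < y -> 0 < y' ->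
  Rabs (X t y 0 - X t y' 0) <= exp (K ^ 2 * T) * Rabs (y - y') /\
  Rabs (V t y 0 - V t y' 0) <= exp (K ^ 2 * T) * Rabs (y - y').
Proof.
  intros Ht Hy Hy'.
  destruct (slits_traj S t y Ht Hy) as (T1 & HT1 & Hc1 & Ha1).
  destruct (slits_traj S t y' Ht Hy') as (T2 & HT2 & Hc2 & Ha2).
  pose proof (above_lipschitz_height (slits_K S) Ha1 Ha2) as L.
  pose proof (pow2_ge_0 (X t y 0 - X t y' 0)). pose proof (pow2_ge_0 (V t y 0 - V t y' 0)).
  pose proof (pow2_ge_0 K) as HK2.
  assert (E1 : 1 <= exp (K ^ 2 * T)) by (rewrite <- exp_0; apply exp_mono; nra).
  assert (E2 : exp (K ^ 2 * t) <= exp (K ^ 2 * T)) by (apply exp_mono, Rmult_le_compat_l; lra).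
  assert (L' : (y - y') ^ 2 * exp (K ^ 2 * t) <= (exp (K ^ 2 * T) * Rabs (y - y')) ^ 2).
  { rewrite Rpow_mult_distr, pow2_abs, Rmult_comm.
    apply Rmult_le_compat_r; [apply pow2_ge_0 | nra]. }
  pose proof (Rabs_pos (y - y')).
  assert (Hb : forall z, z ^ 2 <= (exp (K ^ 2 * T) * Rabs (y - y')) ^ 2 ->
    Rabs z <= exp (K ^ 2 * T) * Rabs (y - y')).
  { intros z Hz. rewrite <- (pow2_abs z) in Hz. pose proof (Rabs_pos z).
    apply Rnot_lt_le; intros Hlt. assert (0 <= exp (K ^ 2 * T) * Rabs (y - y')) by nra. nra. }
  split; apply Hb; lra.
Qed.

Lemma slits_start_bound : exists M, forall t y, 0 <= t < T -> 0 < y <= 1 ->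
  Rabs (X t y 0) <= M /\ Rabs (V t y 0) <= M.
Proof.
  pose proof (slits_K S) as HK. pose proof (slits_T S) as HT.
  exists (K * T + (2 + 4 * T)). intros t y Ht Hy.
  destruct (slits_traj S t y Ht ltac:(lra)) as (T1 & HT1 & Hc1 & Ha1).
  pose proof (above_X_bound Ha1 0 ltac:(lra)). pose proof (above_V_upper Ha1 0 ltac:(lra)) as B.
  pose proof (above_start Ha1).
  assert (K * (t - 0) <= K * T) by (apply Rmult_le_compat_l; lra).
  assert (0 < K * T) by (apply Rmult_lt_0_compat; lra).
  assert (V t y 0 <= 2 + 4 * T) by nra.
  split; [|rewrite Rabs_pos_eq by lra]; lra.
Qed.

(** [swing_polar] describes the angle modulo [2 PI] by a vector which is bounded below
    and Lipschitz in the height, uniformly in [t]. *)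
Lemma swing_close : exists C e, 0 < e /\ forall t y y', 0 <= t < T -> 0 < y <= e -> 0 < y' <= e ->
  0 < cos (swing X0 V0 X V t y - swing X0 V0 X V t y') /\
  Rabs (sin (swing X0 V0 X V t y - swing X0 V0 X V t y')) <= C * Rabs (y - y').
Proof.
  destruct (force_gap S) as (c & Hc & Hgap). destruct slits_start_bound as [M1 HM1].
  destruct (slits_force_bounded S) as [M0 HM0].
  pose proof (slits_d S) as Hd. pose proof (slits_T S) as HT.
  pose proof (slits_K S) as HK.
  pose (M := Rabs M0 + Rabs M1 + 1). pose (L := exp (K ^ 2 * T)).
  assert (HL : 1 <= L) by (unfold L; rewrite <- exp_0; apply exp_mono; pose proof (pow2_ge_0 K); nra).
  pose proof (Rle_abs M0). pose proof (Rle_abs M1). pose proof (Rabs_pos M0). pose proof (Rabs_pos M1).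
  assert (HM : 1 <= M) by (unfold M; lra).
  pose (c1 := d / 2 * c). assert (Hc1 : 0 < c1) by (apply Rmult_lt_0_compat; lra).
  pose (Q := 3 * M * L). assert (HQ : 0 < Q) by (unfold Q; nra).
  pose (e := Rmin (Rmin 1 (d / 2)) (c1 / (4 * Q))).
  exists (2 * Q / c1), e. split.
  { apply Rmin_pos; [apply Rmin_pos; lra | apply Rdiv_lt_0_compat; lra]. }
  intros t y y' Ht Hy Hy'.
  pose proof (Rmin_l (Rmin 1 (d / 2)) (c1 / (4 * Q))). pose proof (Rmin_r (Rmin 1 (d / 2)) (c1 / (4 * Q))).
  pose proof (Rmin_l 1 (d / 2)). pose proof (Rmin_r 1 (d / 2)). fold e in H3, H4.
  destruct (swing_polar S t y Ht ltac:(lra)) as [Pc Ps]. destruct (swing_polar S t y' Ht ltac:(lra)) as [Pc' Ps'].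
  assert (HR : forall z, 0 < z <= e ->
    c1 <= sqrt ((- X0 t) ^ 2 + (z - V0 t) ^ 2) * sqrt ((X t z 0 - X0 0) ^ 2 + (V t z 0 - V0 0) ^ 2)).
  { intros z Hz. apply Rmult_le_compat; try lra.
    - rewrite <- (sqrt_pow2 (d / 2)) by lra. apply sqrt_le_1_alt.
      pose proof (force_top_gap S t z Ht ltac:(lra)). lra.
    - rewrite <- (sqrt_pow2 c) by lra. apply sqrt_le_1_alt.
      pose proof (Hgap t z Ht ltac:(lra)). lra. }
  pose proof (HR y Hy) as Hr. pose proof (HR y' Hy') as Hr'. clear HR.
  cbv zeta in Pc, Ps, Pc', Ps'.
  set (r := sqrt _ * sqrt _) in Pc, Ps, Hr. set (r' := sqrt _ * sqrt _) in Pc', Ps', Hr'.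
  set (b := swing X0 V0 X V t y) in *. set (b' := swing X0 V0 X V t y') in *.
  pose (D := Rabs (y - y')).
  assert (HD : D <= c1 / (4 * Q)) by (unfold D; apply Rabs_le; lra).
  assert (HD0 : 0 <= D) by apply Rabs_pos.
  destruct (slits_lipschitz_height t y y' Ht ltac:(lra) ltac:(lra)) as [L1 L2]. fold L D in L1, L2.
  assert (HF : forall s, s < T -> Rabs (X0 s) <= M0 /\ Rabs (V0 s) <= M0).
  { intros s Hs. specialize (HM0 s Hs). rewrite <- Cmod_pair in HM0.
    pose proof (Rmax_Cmod (X0 s, V0 s)) as Hm. simpl in Hm.
    pose proof (Rmax_l (Rabs (X0 s)) (Rabs (V0 s))). pose proof (Rmax_r (Rabs (X0 s)) (Rabs (V0 s))). lra. }
  destruct (HF t ltac:(lra)) as [F1 F2]. destruct (HF 0 ltac:(lra)) as [F3 F4].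
  destruct (HM1 t y' Ht ltac:(lra)) as [G1 G2].
  assert (Hm : forall u v x z, Rabs u <= x -> Rabs v <= z -> Rabs (u * v) <= x * z).
  { intros u v x z Hu Hv. rewrite Rabs_mult. apply Rmult_le_compat; auto using Rabs_pos. }
  assert (HLD : 0 <= L * D) by nra.
  assert (HA : Rabs (- X0 t) <= M) by (rewrite Rabs_Ropp; unfold M; lra).
  assert (HB : Rabs (y - V0 t) <= M).
  { apply Rabs_le_between in F2. apply Rabs_le. unfold M; lra. }
  assert (HP1 : Rabs (X t y' 0 - X0 0) <= M).
  { apply Rabs_le_between in F3, G1. apply Rabs_le. unfold M; lra. }
  assert (HP2 : Rabs (V t y' 0 - V0 0) <= M).
  { apply Rabs_le_between in F4, G2. apply Rabs_le. unfold M; lra. }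
  assert (HDL : M * D <= M * (L * D)) by (apply Rmult_le_compat_l; nra).
  assert (E1 : Rabs (r * cos b - r' * cos b') <= Q * D).
  { rewrite <- Pc, <- Pc'.
    replace (_ - _) with (- X0 t * (X t y 0 - X t y' 0) + (y - V0 t) * (V t y 0 - V t y' 0)
      + (y - y') * (V t y' 0 - V0 0)) by ring.
    pose proof (Hm _ _ _ _ HA L1) as Z1. pose proof (Hm _ _ _ _ HB L2) as Z2.
    pose proof (Hm _ _ _ _ (Rle_refl D) HP2) as Z3. 
    eapply Rle_trans; [apply Rabs_triang|].
    pose proof (Rabs_triang (- X0 t * (X t y 0 - X t y' 0)) ((y - V0 t) * (V t y 0 - V t y' 0))).
    unfold Q. lra. }
  assert (E2 : Rabs (r * sin b - r' * sin b') <= Q * D).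
  { rewrite <- Ps, <- Ps'.
    replace (_ - _) with ((y - V0 t) * (X t y 0 - X t y' 0) + - (- X0 t * (V t y 0 - V t y' 0))
      + (y - y') * (X t y' 0 - X0 0)) by ring.
    pose proof (Hm _ _ _ _ HA L2) as Z1. pose proof (Hm _ _ _ _ HB L1) as Z2.
    pose proof (Hm _ _ _ _ (Rle_refl D) HP1) as Z3. rewrite <- Rabs_Ropp in Z1.
    eapply Rle_trans; [apply Rabs_triang|].
    pose proof (Rabs_triang ((y - V0 t) * (X t y 0 - X t y' 0)) (- (- X0 t * (V t y 0 - V t y' 0)))).
    unfold Q. lra. }
  assert (HQD : 4 * (Q * D) <= c1).
  { apply Rle_trans with (4 * Q * (c1 / (4 * Q))); [|right; field; lra].
    rewrite <- Rmult_assoc. apply Rmult_le_compat_l; lra. }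
  destruct (close_vectors_angle r r' b b' c1 (Q * D)) as [Z1 Z2]; try lra.
  split; [exact Z1|]. eapply Rle_trans; [exact Z2|]. right. unfold D. field. lra.
Qed.

Lemma swing_0 y : swing X0 V0 X V 0 y = 0.
Proof. unfold swing. exact (RInt_point 0 _). Qed.

Lemma swing_cont y : 0 < y -> forall t, t < T -> continuous (fun t => swing X0 V0 X V (Rmax 0 t) y) t.
Proof.
  intros Hy. destruct (swing_lipschitz S y Hy) as [C HC].
  apply (clamped_lipschitz_continuous (fun t => swing X0 V0 X V t y) C T); [|exact HC].
  apply (slits_T S).
Qed.
End Slits.

(** * Limits of small height *)

Lemma at_right_intro (P : R -> Prop) (e : R) : 0 < e -> (forall y, 0 < y < e -> P y) -> at_right 0 P.
Proof.
  intros He H. exists (mkposreal e He). intros y Hy Hp. apply H.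
  change (Rabs (y - 0) < e) in Hy. rewrite Rminus_0_r, Rabs_pos_eq in Hy; lra.
Qed.

Lemma at_right_elim (P : R -> Prop) : at_right 0 P -> exists e, 0 < e /\ forall y, 0 < y < e -> P y.
Proof.
  intros [e He]. exists e. split; [apply cond_pos|]. intros y Hy. apply He; [|lra].
  change (Rabs (y - 0) < e). rewrite Rminus_0_r, Rabs_pos_eq; lra.
Qed.

Lemma limit_le (f g : R -> R) (l m : R) :
  filterlim f (at_right 0) (locally l) -> filterlim g (at_right 0) (locally m) ->
  at_right 0 (fun y => f y <= g y) -> l <= m.
Proof.
  intros Hf Hg H. exact (filterlim_le (F := at_right 0) f g (Finite l) (Finite m) H Hf Hg).
Qed.

Lemma flim_id_right : filterlim (fun y : R => y) (at_right 0) (locally 0).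
Proof. intros P HP. apply filter_le_within. exact HP. Qed.

Lemma flim_arg_H {U : Type} {F : (U -> Prop) -> Prop} {FF : Filter F} (f g : U -> R) (a b : R) :
  filterlim f F (locally a) -> filterlim g F (locally b) -> 0 < a ^ 2 + b ^ 2 ->
  filterlim (fun u => arg_H (f u, g u)) F (locally (arg_H (a, b))).
Proof.
  intros Hf Hg Hp. pose proof (sqrt_sum_pos _ _ Hp). unfold arg_H, Cmod, Re; simpl fst; simpl snd.
  apply (flim_cont acos); [apply continuous_acos|]. flim.
Qed.

Lemma flim_ln {U : Type} {F : (U -> Prop) -> Prop} {FF : Filter F} (f : U -> R) (a : R) :
  filterlim f F (locally a) -> 0 < a -> filterlim (fun u => ln (f u)) F (locally (ln a)).
Proof.
  intros Hf Hp. apply (flim_cont ln); [|assumption]. 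
  apply (continuous_of_derive ln a (/ a)), is_derive_ln, Hp.
Qed.

(** By the mean value theorem, the difference quotients of [f_y] are close to [l] near
    [t] as soon as [y] is small; let [y] go to [0]. *)
Lemma derive_of_limit (f df : R -> R -> R) (G : R -> R) (T t l : R) : 0 < t < T ->
  (forall t' y, 0 < t' < T -> 0 < y -> is_derive (fun t => f t y) t' (df t' y)) ->
  (forall t', 0 < t' < T -> filterlim (f t') (at_right 0) (locally (G t'))) ->
  filterlim (fun p => df (fst p) (snd p)) (filter_prod (locally t) (at_right 0)) (locally l) ->
  is_derive G t l.
Proof.
  intros Ht Hd HG Hl. apply is_derive_Reals. intros eps Heps.
  assert (He2 : 0 < eps / 2) by lra.
  destruct (proj1 (filterlim_locally _ _) Hl (mkposreal _ He2)) as [Q R [dl HQ] HR HQR].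
  simpl in HQR. destruct (at_right_elim _ HR) as (e & He & HRe).
  assert (Hm : 0 < Rmin dl (Rmin t (T - t))).
  { apply Rmin_pos; [apply cond_pos | apply Rmin_pos; lra]. }
  exists (mkposreal _ Hm). intros h Hh Hlt. simpl in Hlt.
  pose proof (Rmin_l dl (Rmin t (T - t))). pose proof (Rmin_r dl (Rmin t (T - t))).
  pose proof (Rmin_l t (T - t)). pose proof (Rmin_r t (T - t)).
  assert (Hab := Rabs_def2 _ _ Hlt).
  assert (Hle : Rabs (G (t + h) - G t - l * h) <= eps / 2 * Rabs h).
  { apply (limit_le (fun y => Rabs (f (t + h) y - f t y - l * h)) (fun _ => eps / 2 * Rabs h));
      [|apply flim_const|].
    - apply (flim_cont Rabs); [apply continuous_Rabs|].
      assert (L1 := HG (t + h) ltac:(lra)). assert (L2 := HG t Ht). flim.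
    - apply (at_right_intro _ e He). intros y Hy.
      destruct (MVT_gen (fun t => f t y) t (t + h) (fun t' => df t' y)) as (c & Hc & E).
      + intros x Hx. apply Hd; [|lra]. revert Hx; unfold Rmin, Rmax; destruct (Rle_dec t (t + h)); lra.
      + intros x Hx. apply continuity_pt_filterlim.
        apply (continuous_of_derive (fun t => f t y) x (df x y)), Hd; [|lra].
        revert Hx; unfold Rmin, Rmax; destruct (Rle_dec t (t + h)); lra.
      + rewrite E. replace (df c y * (t + h - t) - l * h) with ((df c y - l) * h) by ring.
        rewrite Rabs_mult. apply Rmult_le_compat_r; [apply Rabs_pos|]. left.
        refine (HQR c y _ (HRe y Hy)). apply HQ. change (Rabs (c - t) < dl).
        apply Rle_lt_trans with (Rabs h); [|lra].
        revert Hc; unfold Rmin, Rmax; destruct (Rle_dec t (t + h)); intros Hc; unfold Rabs;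
          repeat destruct Rcase_abs; lra. }
  replace ((G (t + h) - G t) / h - l) with ((G (t + h) - G t - l * h) / h) by (field; assumption).
  unfold Rdiv. rewrite Rabs_mult, Rabs_inv. pose proof (Rabs_pos_lt h Hh) as Hp.
  apply (Rmult_lt_reg_r (Rabs h)); [assumption|].
  rewrite Rmult_assoc, Rinv_l, Rmult_1_r by lra. nra.
Qed.

(** The limit at [0+], when it exists. Being taken along a fixed sequence it is a
    total function of [u], independent of the time interval on which convergence
    is being proved. *)
Definition lim_right (u : R -> R) : R := real (Lim_seq (fun n => u (/ (INR n + 1)))).

Lemma small_index (e : R) : 0 < e -> exists N, forall n, (N <= n)%nat -> 0 < / (INR n + 1) < e.
Proof.
  intros He. destruct (archimed_cor1 e He) as (N & HN & HN0). exists N. intros n Hn.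
  apply le_INR in Hn. apply lt_INR in HN0. change (INR 0) with 0 in HN0.
  split; [apply Rinv_0_lt_compat; lra|].
  apply Rlt_trans with (/ INR N); [|assumption]. apply Rinv_lt_contravar; [|lra].
  apply Rmult_lt_0_compat; lra.
Qed.

Lemma lim_right_close (u : R -> R) :
  (forall eps, 0 < eps -> exists e, 0 < e /\
    forall y y', 0 < y < e -> 0 < y' < e -> Rabs (u y - u y') < eps) ->
  forall eps e, 0 < e ->
    (forall y y', 0 < y < e -> 0 < y' < e -> Rabs (u y - u y') < eps) ->
    forall y, 0 < y < e -> Rabs (u y - lim_right u) <= eps.
Proof.
  intros Hc. set (v := fun n => u (/ (INR n + 1))).
  assert (Hl : is_lim_seq v (lim_right u)).
  { apply Lim_seq_correct', ex_lim_seq_cauchy_corr. intros eps.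
    destruct (Hc eps (cond_pos eps)) as (e & He & HU). destruct (small_index e He) as [N HN].
    exists N. intros n m Hn Hm. apply HU; apply HN; assumption. }
  intros eps e He HU y Hy.
  apply Rnot_lt_le. intros Hlt.
  apply is_lim_seq_spec in Hl.
  destruct (Hl (mkposreal (Rabs (u y - lim_right u) - eps) ltac:(lra))) as [N1 HN1].
  destruct (small_index e He) as [N2 HN2]. simpl in HN1.
  specialize (HN1 (max N1 N2) ltac:(lia)). specialize (HN2 (max N1 N2) ltac:(lia)).
  specialize (HU y _ Hy HN2). unfold v in HN1.
  set (z := u (/ (INR (Nat.max N1 N2) + 1))) in *.
  assert (Rabs (u y - lim_right u) <= Rabs (u y - z) + Rabs (z - lim_right u)).
  { replace (u y - lim_right u) with (u y - z + (z - lim_right u)) by ring. apply Rabs_triang. }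
  lra.
Qed.

Lemma continuous_of_uniform_limit (f : R -> R -> R) (g : R -> R) (T : R) :
  (forall y t, 0 < y -> t < T -> continuous (f y) t) ->
  (forall eps, 0 < eps -> exists y, 0 < y /\ forall t, t < T -> Rabs (f y t - g t) <= eps) ->
  forall t, t < T -> continuous g t.
Proof.
  intros Hf Hu t Ht. apply filterlim_locally. intros eps. pose proof (cond_pos eps).
  destruct (Hu (eps / 4) ltac:(lra)) as (y & Hy & HU).
  destruct (continuous_eps (f y) t (eps / 4) (Hf y t Hy Ht) ltac:(lra)) as (d & Hd & Hdd).
  assert (Hm : 0 < Rmin d (T - t)) by (apply Rmin_pos; lra).
  exists (mkposreal _ Hm). intros s Hs. change (Rabs (s - t) < Rmin d (T - t)) in Hs.
  pose proof (Rmin_l d (T - t)). pose proof (Rmin_r d (T - t)).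
  change (Rabs (g s - g t) < eps).
  pose proof (HU t Ht) as U1. assert (Hs' := Rabs_def2 _ _ Hs). pose proof (HU s ltac:(lra)) as U2.
  specialize (Hdd s ltac:(lra)).
  apply Rabs_le_between in U1, U2. apply Rabs_def2 in Hdd. apply Rabs_def1; lra.
Qed.

(** * The tip *)

(** The angle by which the segment between the force point and the tip is turned by
    the Loewner map. *)
Definition tip_swing (X0 V0 : R -> R) (X V : R -> R -> R -> R) (t : R) : R :=
  lim_right (swing X0 V0 X V t).

Section Tip.
Context {w : R -> R} {T K d : R} {X0 V0 : R -> R} {X V : R -> R -> R -> R}
  (S : slits w T K d X0 V0 X V) {G1 G2 : R -> R}
  (HG1 : forall t, 0 <= t < T -> filterlim (fun y => X t y 0) (at_right 0) (locally (G1 t)))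
  (HG2 : forall t, 0 <= t < T -> filterlim (fun y => V t y 0) (at_right 0) (locally (G2 t))).

(** The angles at two heights both vanish at time [0], and by [swing_close] the cosine
    of their difference stays positive; no multiple of [2 PI] can appear. *)
Lemma swing_cauchy eps : 0 < eps -> exists e, 0 < e /\ forall t y y', 0 <= t < T ->
  0 < y < e -> 0 < y' < e -> Rabs (swing X0 V0 X V t y - swing X0 V0 X V t y') < eps.
Proof.
  intros Heps. destruct (swing_close S) as (C & e0 & He0 & H).
  pose proof PI2_RGT_0 as HPI. pose proof (slits_T S) as HT.
  pose (eps' := Rmin eps (PI / 4)).
  assert (Heps' : 0 < eps' < PI / 2).
  { pose proof (Rmin_r eps (PI / 4)). unfold eps' in *. split; [apply Rmin_pos|]; lra. }
  assert (Hle : eps' <= eps) by apply Rmin_l.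
  assert (Hsin : 0 < sin eps') by (apply sin_gt_0; lra).
  pose proof (Rabs_pos C) as HC.
  exists (Rmin e0 (sin eps' / (Rabs C + 1))). split.
  { apply Rmin_pos; [lra | apply Rdiv_lt_0_compat; lra]. }
  intros t y y' Ht Hy Hy'.
  pose proof (Rmin_l e0 (sin eps' / (Rabs C + 1))). pose proof (Rmin_r e0 (sin eps' / (Rabs C + 1))).
  apply Rlt_le_trans with eps'; [|assumption]. apply sin_small; [|assumption|].
  - replace t with (Rmax 0 t) by (apply Rmax_right; lra).
    apply (angle_diff_lt_PI2 (fun t => swing X0 V0 X V (Rmax 0 t) y) (fun t => swing X0 V0 X V (Rmax 0 t) y') t);
      [| |lra].
    + intros x Hx. split; [|split].
      * apply (swing_cont S y); lra.
      * apply (swing_cont S y'); lra.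
      * rewrite Rmax_right by lra. apply H; lra.
    + rewrite Rmax_right by lra. rewrite !swing_0, Rminus_diag, Rabs_R0. lra.
  - eapply Rle_lt_trans; [apply H; lra|].
    assert (HD : Rabs (y - y') < sin eps' / (Rabs C + 1)) by (apply Rabs_def1; lra).
    pose proof (Rabs_pos (y - y')). pose proof (Rle_abs C).
    apply Rle_lt_trans with ((Rabs C + 1) * Rabs (y - y')); [nra|].
    apply Rlt_le_trans with ((Rabs C + 1) * (sin eps' / (Rabs C + 1))).
    + apply Rmult_lt_compat_l; lra.
    + right; field; lra.
Qed.

Lemma swing_uniform eps : 0 < eps -> exists e, 0 < e /\ forall t y, 0 <= t < T ->
  0 < y < e -> Rabs (swing X0 V0 X V t y - tip_swing X0 V0 X V t) <= eps.
Proof.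
  intros Heps. destruct (swing_cauchy eps Heps) as (e & He & H). exists e. split; [assumption|].
  intros t y Ht Hy. apply (lim_right_close (swing X0 V0 X V t)) with (e := e); auto.
  intros eps' Heps'. destruct (swing_cauchy eps' Heps') as (e' & He' & H').
  exists e'. split; auto.
Qed.

Lemma tip_swing_cont t : t < T -> continuous (fun t => tip_swing X0 V0 X V (Rmax 0 t)) t.
Proof.
  apply (continuous_of_uniform_limit (fun y t => swing X0 V0 X V (Rmax 0 t) y)).
  - intros y t' Hy Ht'. apply (swing_cont S y Hy t' Ht').
  - intros eps Heps. destruct (swing_uniform eps Heps) as (e & He & H).
    exists (e / 2). split; [lra|]. intros t' Ht'. apply H; [|lra].
    split; [apply Rmax_l | apply Rmax_lub_lt; [apply (slits_T S) | assumption]].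
Qed.

Lemma swing_limit t : 0 <= t < T ->
  filterlim (swing X0 V0 X V t) (at_right 0) (locally (tip_swing X0 V0 X V t)).
Proof.
  intros Ht. apply filterlim_locally. intros eps. pose proof (cond_pos eps).
  destruct (swing_uniform (eps / 2) ltac:(lra)) as (e & He & H').
  apply (at_right_intro _ e He). intros y Hy. specialize (H' t y Ht Hy).
  change (Rabs (swing X0 V0 X V t y - tip_swing X0 V0 X V t) < eps). lra.
Qed.

Lemma tip_swing_0 : tip_swing X0 V0 X V 0 = 0.
Proof.
  pose proof (swing_limit 0 ltac:(pose proof (slits_T S); lra)) as H.
  apply (filterlim_locally_unique (F := at_right 0) (swing X0 V0 X V 0)); [assumption|].
  apply (filterlim_ext (fun _ => 0)); [intros y; symmetry; apply swing_0 | apply filterlim_const].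
Qed.

Lemma tip_close t y : 0 <= t < T -> 0 < y ->
  Rabs (X t y 0 - G1 t) <= exp (K ^ 2 * T) * y /\ Rabs (V t y 0 - G2 t) <= exp (K ^ 2 * T) * y.
Proof.
  intros Ht Hy. pose proof (exp_pos (K ^ 2 * T)).
  split.
  - apply (limit_le (fun y' => Rabs (X t y 0 - X t y' 0)) (fun _ => exp (K ^ 2 * T) * y)); [|apply flim_const|].
    + apply (flim_cont Rabs); [apply continuous_Rabs|]. specialize (HG1 t Ht). flim.
    + apply (at_right_intro _ y Hy). intros y' Hy'.
      eapply Rle_trans; [apply (slits_lipschitz_height S t y y' Ht); lra|].
      apply Rmult_le_compat_l; [lra|]. apply Rabs_le; lra.
  - apply (limit_le (fun y' => Rabs (V t y 0 - V t y' 0)) (fun _ => exp (K ^ 2 * T) * y)); [|apply flim_const|].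
    + apply (flim_cont Rabs); [apply continuous_Rabs|]. specialize (HG2 t Ht). flim.
    + apply (at_right_intro _ y Hy). intros y' Hy'.
      eapply Rle_trans; [apply (slits_lipschitz_height S t y y' Ht); lra|].
      apply Rmult_le_compat_l; [lra|]. apply Rabs_le; lra.
Qed.

Lemma slits_start_cont y : 0 < y -> forall t, t < T ->
  continuous (fun t => X (Rmax 0 t) y 0) t /\ continuous (fun t => V (Rmax 0 t) y 0) t.
Proof.
  intros Hy t Ht. destruct (slits_lipschitz_time S y Hy) as (C & HC & H).
  assert (HT := slits_T S).
  assert (Hc : forall t1 t2, 0 <= t1 -> t1 <= t2 -> t2 < T ->
    Rabs (X t1 y 0 - X t2 y 0) <= C * (t2 - t1) /\ Rabs (V t1 y 0 - V t2 y 0) <= C * (t2 - t1)).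
  { intros t1 t2 h1 h2 h3. specialize (H t1 t2 0 ltac:(lra) h2 h3). rewrite <- Cmod_pair in H.
    pose proof (Rmax_Cmod (X t1 y 0 - X t2 y 0, V t1 y 0 - V t2 y 0)) as Hm. simpl fst in Hm. simpl snd in Hm.
    split; (eapply Rle_trans; [|eapply Rle_trans; [exact Hm | exact H]]); [apply Rmax_l | apply Rmax_r]. }
  split.
  - apply (clamped_lipschitz_continuous (fun t => X t y 0) C T); auto. intros; apply Hc; auto.
  - apply (clamped_lipschitz_continuous (fun t => V t y 0) C T); auto. intros; apply Hc; auto.
Qed.

Lemma tip_cont t : t < T ->
  continuous (fun t => G1 (Rmax 0 t)) t /\ continuous (fun t => G2 (Rmax 0 t)) t.
Proof.
  intros Ht. assert (HT := slits_T S). pose proof (exp_pos (K ^ 2 * T)) as HL.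
  assert (Hm : forall t, t < T -> 0 <= Rmax 0 t < T)
    by (intros s Hs; split; [apply Rmax_l | apply Rmax_lub_lt; assumption]).
  assert (He : forall eps, 0 < eps -> exp (K ^ 2 * T) * (eps / exp (K ^ 2 * T)) = eps)
    by (intros eps Heps; field; lra).
  split.
  - apply (continuous_of_uniform_limit (fun y t => X (Rmax 0 t) y 0) _ T); [| |assumption].
    + intros y s Hy Hs. apply (slits_start_cont y Hy s Hs).
    + intros eps Heps. exists (eps / exp (K ^ 2 * T)).
      assert (Hp : 0 < eps / exp (K ^ 2 * T)) by (apply Rdiv_lt_0_compat; lra).
      split; [exact Hp|]. intros s Hs. rewrite <- (He eps Heps) at 2. apply tip_close; auto.
  - apply (continuous_of_uniform_limit (fun y t => V (Rmax 0 t) y 0) _ T); [| |assumption].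
    + intros y s Hy Hs. apply (slits_start_cont y Hy s Hs).
    + intros eps Heps. exists (eps / exp (K ^ 2 * T)).
      assert (Hp : 0 < eps / exp (K ^ 2 * T)) by (apply Rdiv_lt_0_compat; lra).
      split; [exact Hp|]. intros s Hs. rewrite <- (He eps Heps) at 2. apply tip_close; auto.
Qed.

(** The tip is at [2 i sqrt t] up to an error of order [t]. *)
Lemma tip_bounds t : 0 <= t < T ->
  Rabs (G1 t) <= K * t /\ 4 * t - K ^ 2 * t ^ 2 <= G2 t ^ 2 <= 4 * t /\
  0 <= G2 t /\ Rmin (2 * t) ((2 / K) ^ 2) <= G2 t ^ 2.
Proof.
  intros Ht. specialize (HG1 t Ht). specialize (HG2 t Ht). pose proof flim_id_right as Hid.
  pose proof (slits_K S) as HK.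
  assert (Ha : forall y, 0 < y -> exists T', ends_above w T' K t y (X t y) (V t y)).
  { intros y Hy. destruct (slits_traj S t y Ht Hy) as (T' & _ & _ & Ha). exists T'; exact Ha. }
  assert (Hin : forall P : R -> Prop, (forall y, 0 < y -> P y) -> at_right 0 P)
    by (intros P HP; apply (at_right_intro _ 1); [lra | intros y Hy; apply HP; lra]).
  assert (HV2 : filterlim (fun y => V t y 0 ^ 2) (at_right 0) (locally (G2 t ^ 2))) by flim.
  split; [|split; [split|split]].
  - apply (limit_le (fun y => Rabs (X t y 0)) (fun _ => K * t)); [|apply flim_const|].
    + apply (flim_cont Rabs); [apply continuous_Rabs | assumption].
    + apply Hin. intros y Hy. destruct (Ha y Hy) as [T' H].
      eapply Rle_trans; [apply (above_X_bound H 0); lra|]. right; ring.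
  - refine (limit_le (fun _ => 4 * t - K ^ 2 * t ^ 2) _ _ _ _ HV2 _); [apply flim_const|].
    apply Hin. intros y Hy. destruct (Ha y Hy) as [T' H].
    pose proof (above_V_lower H 0 ltac:(lra)). pose proof (pow2_ge_0 y). pose proof (pow2_ge_0 (X t y 0)).
    rewrite !Rminus_0_r in *. lra.
  - replace (4 * t) with (0 ^ 2 + 4 * t) by ring.
    refine (limit_le _ (fun y => y ^ 2 + 4 * t) _ _ HV2 _ _); [flim|].
    apply Hin. intros y Hy. destruct (Ha y Hy) as [T' H].
    pose proof (above_V_upper H 0 ltac:(lra)). lra.
  - refine (limit_le (fun _ => 0) _ _ _ _ HG2 _); [apply flim_const|].
    apply Hin. intros y Hy. destruct (Ha y Hy) as [T' H]. left; apply (above_start H).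
  - refine (limit_le (fun _ => Rmin (2 * t) ((2 / K) ^ 2)) _ _ _ _ HV2 _); [apply flim_const|].
    apply Hin. intros y Hy. destruct (Ha y Hy) as [T' H]. apply (above_start_height H HK).
Qed.

Lemma tip_upper t : 0 < t < T -> 0 < G2 t.
Proof.
  intros Ht. destruct (tip_bounds t ltac:(lra)) as (_ & _ & H0 & H1).
  pose proof (slits_K S) as HK.
  assert (0 < Rmin (2 * t) ((2 / K) ^ 2)).
  { apply Rmin_pos; [lra|]. apply pow_lt, Rdiv_lt_0_compat; lra. }
  nra.
Qed.

Lemma tip_0 : G1 0 = 0 /\ G2 0 = 0.
Proof.
  pose proof (slits_T S).
  destruct (tip_bounds 0 ltac:(lra)) as (H1 & H2 & _ & _).
  rewrite Rmult_0_r in H1. pose proof (Rabs_pos (G1 0)).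
  split; [apply Rabs_eq_0; lra | nra].
Qed.

Lemma tip_force_gap t : 0 <= t < T -> 0 < (G1 t - X0 0) ^ 2 + (G2 t - V0 0) ^ 2.
Proof.
  intros Ht. destruct (force_gap S) as (c & Hc & H). pose proof (slits_d S).
  specialize (HG1 t Ht). specialize (HG2 t Ht).
  apply Rlt_le_trans with (c ^ 2); [nra|].
  refine (limit_le (fun _ => c ^ 2) (fun y => (X t y 0 - X0 0) ^ 2 + (V t y 0 - V0 0) ^ 2) _ _ _ _ _).
  - apply flim_const.
  - flim.
  - apply (at_right_intro _ (Rmin 1 (d / 2))); [apply Rmin_pos; lra|]. intros y Hy.
    specialize (H t y Ht ltac:(lra)). lra.
Qed.

Lemma tip_swing_polar t : 0 <= t < T ->
  let P1 := G1 t - X0 0 in let P2 := G2 t - V0 0 in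
  let r := sqrt (X0 t ^ 2 + V0 t ^ 2) * sqrt (P1 ^ 2 + P2 ^ 2) in
  - X0 t * P1 - V0 t * P2 = r * cos (tip_swing X0 V0 X V t) /\
  X0 t * P2 - V0 t * P1 = r * sin (tip_swing X0 V0 X V t).
Proof.
  intros Ht P1 P2 r. pose proof (swing_limit t Ht) as HB. specialize (HG1 t Ht). specialize (HG2 t Ht).
  pose proof flim_id_right as Hid.
  pose (r' := fun y => sqrt ((- X0 t) ^ 2 + (y - V0 t) ^ 2) *
      sqrt ((X t y 0 - X0 0) ^ 2 + (V t y 0 - V0 0) ^ 2)).
  assert (Hr : filterlim r' (at_right 0) (locally r)).
  { unfold r, r', P1, P2. replace (X0 t ^ 2 + V0 t ^ 2) with ((- X0 t) ^ 2 + (0 - V0 t) ^ 2) by ring. flim. }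
  split.
  - apply (filterlim_locally_unique (F := at_right 0) (fun y => - X0 t * (X t y 0 - X0 0) + (y - V0 t) * (V t y 0 - V0 0))).
    + replace (- X0 t * P1 - V0 t * P2) with (- X0 t * (G1 t - X0 0) + (0 - V0 t) * (G2 t - V0 0))
        by (unfold P1, P2; ring). flim.
    + apply (filterlim_ext_loc (F := at_right 0) (fun y => r' y * cos (swing X0 V0 X V t y))).
      2: { flim. }
      apply (at_right_intro _ 1); [lra|]. intros y Hy.
      destruct (swing_polar S t y Ht ltac:(lra)) as [E _]. symmetry; exact E.
  - apply (filterlim_locally_unique (F := at_right 0) (fun y => (y - V0 t) * (X t y 0 - X0 0) - - X0 t * (V t y 0 - V0 0))).
    + replace (X0 t * P2 - V0 t * P1) with ((0 - V0 t) * (G1 t - X0 0) - - X0 t * (G2 t - V0 0))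
        by (unfold P1, P2; ring). flim.
    + apply (filterlim_ext_loc (F := at_right 0) (fun y => r' y * sin (swing X0 V0 X V t y))).
      2: { flim. }
      apply (at_right_intro _ 1); [lra|]. intros y Hy.
      destruct (swing_polar S t y Ht ltac:(lra)) as [_ E]. symmetry; exact E.
Qed.
End Tip.

(** * Motion of the tip *)

Lemma joint_limit (f : R -> R -> R) (g : R -> R) (T t : R) : 0 < t < T ->
  continuous (fun t => g (Rmax 0 t)) t ->
  (forall eps, 0 < eps -> exists e, 0 < e /\
     forall t y, 0 <= t < T -> 0 < y < e -> Rabs (f t y - g t) <= eps) ->
  filterlim (fun p => f (fst p) (snd p)) (filter_prod (locally t) (at_right 0)) (locally (g t)).
Proof.
  intros Ht Hg Hu. apply filterlim_locally. intros eps. pose proof (cond_pos eps).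
  destruct (Hu (eps / 2) ltac:(lra)) as (e & He & HU).
  destruct (continuous_eps _ t (eps / 2) Hg ltac:(lra)) as (d & Hd & Hgd).
  assert (Hm : 0 < Rmin d (Rmin t (T - t))) by (repeat apply Rmin_pos; lra).
  apply (Filter_prod _ _ _ (fun s => Rabs (s - t) < Rmin d (Rmin t (T - t))) (fun y => 0 < y < e)).
  - exists (mkposreal _ Hm). intros s Hs. exact Hs.
  - apply (at_right_intro _ e He). auto.
  - intros s y Hs Hy. simpl.
    pose proof (Rmin_l d (Rmin t (T - t))). pose proof (Rmin_r d (Rmin t (T - t))).
    pose proof (Rmin_l t (T - t)). pose proof (Rmin_r t (T - t)).
    assert (Hs' := Rabs_def2 _ _ Hs).
    specialize (Hgd s ltac:(lra)). rewrite !Rmax_right in Hgd by lra.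
    specialize (HU s y ltac:(lra) Hy). change (Rabs (f s y - g t) < eps).
    apply Rabs_def2 in Hgd. apply Rabs_le_between in HU. apply Rabs_def1; lra.
Qed.

(** Contribution of the force point [z] to the direction and to the speed of the tip:
    the argument and the modulus of the power [rho / 4] of
    [(z_t - W_t) (conj z_t - W_t) / ((gamma - z_0) (gamma - conj z_0))]. *)
Definition tip_angle (rho : R) (X0 V0 : R -> R) (X V : R -> R -> R -> R) (G1 G2 : R -> R) (t : R) : R :=
  rho / 4 * (tip_swing X0 V0 X V t + (arg_H (- X0 t, V0 t) - arg_H (G1 t - X0 0, G2 t + V0 0))).
Definition tip_scale (rho : R) (X0 V0 : R -> R) (G1 G2 : R -> R) (t : R) : R :=
  exp (rho / 4 *
    (ln (sqrt (X0 t ^ 2 + V0 t ^ 2)) - ln (sqrt ((G1 t - X0 0) ^ 2 + (G2 t - V0 0) ^ 2)) +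
    (ln (sqrt (X0 t ^ 2 + V0 t ^ 2)) - ln (sqrt ((G1 t - X0 0) ^ 2 + (G2 t + V0 0) ^ 2))))).

Section Tip.
Context {w : R -> R} {T K d : R} {X0 V0 : R -> R} {X V : R -> R -> R -> R}
  (S : slits w T K d X0 V0 X V) {rho : R}
  (Hrho : forall s, s < T -> w s = - rho * X0 s / (X0 s ^ 2 + V0 s ^ 2))
  {G1 G2 : R -> R}
  (HG1 : forall t, 0 <= t < T -> filterlim (fun y => X t y 0) (at_right 0) (locally (G1 t)))
  (HG2 : forall t, 0 <= t < T -> filterlim (fun y => V t y 0) (at_right 0) (locally (G2 t))).

Lemma tip_force_gap_conj t : 0 <= t < T -> 0 < (G1 t - X0 0) ^ 2 + (G2 t + V0 0) ^ 2.
Proof.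
  intros Ht. pose proof (tip_force_gap S HG1 HG2 t Ht).
  destruct (tip_bounds S HG1 HG2 t Ht) as (_ & _ & H0 & _).
  pose proof (slits_force_V S). nra.
Qed.

Lemma slits_start_derive_eq t y : 0 < t < T -> 0 < y <= Rmin 1 (d / 2) ->
  let P1 := X t y 0 in let P2 := V t y 0 in
  let E := exp (rho / 4 *
    (ln (sqrt (X0 t ^ 2 + (y - V0 t) ^ 2)) - ln (sqrt ((P1 - X0 0) ^ 2 + (P2 - V0 0) ^ 2)) +
    (ln (sqrt (X0 t ^ 2 + (y + V0 t) ^ 2)) - ln (sqrt ((P1 - X0 0) ^ 2 + (P2 + V0 0) ^ 2))))) in
  let J := PI / 2 - arg_H (P1, P2) + rho / 4 *
    (swing X0 V0 X V t y + (arg_H (- X0 t, y + V0 t) - arg_H (P1 - X0 0, P2 + V0 0))) in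
  is_derive (fun t => X t y 0) t (E / sqrt (P1 ^ 2 + P2 ^ 2) * (y * w t * cos J - 2 * sin J)) /\
  is_derive (fun t => V t y 0) t (E / sqrt (P1 ^ 2 + P2 ^ 2) * (y * w t * sin J + 2 * cos J)).
Proof.
  intros Ht Hy P1 P2 E J.
  destruct (force_gap S) as (c & Hc & H). specialize (H t y ltac:(lra) Hy).
  assert (HP : 0 < (P1 - X0 0) ^ 2 + (P2 - V0 0) ^ 2) by (unfold P1, P2; nra).
  destruct (expansion_eq S Hrho t y ltac:(lra) ltac:(lra) HP) as [E1 E2].
  destruct (slits_start_derive S t y Ht ltac:(lra)) as [d1 d2]. cbv zeta in d1, d2.
  rewrite E1, E2 in d1, d2. fold P1 P2 in d1, d2. fold J in d1, d2.
  assert (HPn : 0 < P1 ^ 2 + P2 ^ 2) by (apply (slits_norm_ge S t y 0); lra).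
  pose proof (sqrt_sum_pos _ _ HPn) as Hr.
  assert (Ee : forall u, exp (ln y - ln (sqrt (P1 ^ 2 + P2 ^ 2)) + u) = y / sqrt (P1 ^ 2 + P2 ^ 2) * exp u).
  { intros u. unfold Rminus. rewrite !exp_plus, exp_Ropp, !exp_ln by lra. reflexivity. }
  rewrite Ee in d1, d2. fold E in d1, d2.
  split; (evar_last; [first [exact d1 | exact d2]|]); field; lra.
Qed.

(** Limit of the formula for the starting points of slit trajectories: the factor [y]
    which [expansion_eq] finds in the derivative of [f_t] cancels the denominator of
    [2 i / y]. *)
Lemma tip_derive t : 0 < t < T ->
  let m := 2 * tip_scale rho X0 V0 G1 G2 t / sqrt (G1 t ^ 2 + G2 t ^ 2) in
  let a := PI - arg_H (G1 t, G2 t) + tip_angle rho X0 V0 X V G1 G2 t in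
  is_derive G1 t (m * cos a) /\ is_derive G2 t (m * sin a).
Proof.
  intros Ht m a.
  pose proof (exp_pos (K ^ 2 * T)) as HL. pose proof (slits_d S) as Hd.
  assert (Hlin : forall f g, (forall t y, 0 <= t < T -> 0 < y -> Rabs (f t y - g t) <= exp (K ^ 2 * T) * y) ->
    forall eps, 0 < eps -> exists e, 0 < e /\
     forall t y, 0 <= t < T -> 0 < y < e -> Rabs (f t y - g t) <= eps).
  { intros f g Hfg eps Heps. exists (eps / exp (K ^ 2 * T)). split; [apply Rdiv_lt_0_compat; lra|].
    intros t' y Ht' Hy. eapply Rle_trans; [apply Hfg; lra|].
    apply Rle_trans with (exp (K ^ 2 * T) * (eps / exp (K ^ 2 * T))); [|right; field; lra].
    apply Rmult_le_compat_l; lra. }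
  pose (F := filter_prod (locally t) (at_right 0)).
  assert (LX : filterlim (fun p => X (fst p) (snd p) 0) F (locally (G1 t))).
  { apply (joint_limit (fun t y => X t y 0) G1 T t Ht); [apply (tip_cont S HG1 HG2); lra|].
    apply Hlin. intros; apply (tip_close S HG1 HG2); assumption. }
  assert (LV : filterlim (fun p => V (fst p) (snd p) 0) F (locally (G2 t))).
  { apply (joint_limit (fun t y => V t y 0) G2 T t Ht); [apply (tip_cont S HG1 HG2); lra|].
    apply Hlin. intros; apply (tip_close S HG1 HG2); assumption. }
  assert (LS : filterlim (fun p => swing X0 V0 X V (fst p) (snd p)) F (locally (tip_swing X0 V0 X V t))).
  { apply (joint_limit (swing X0 V0 X V) (tip_swing X0 V0 X V) T t Ht); [apply (tip_swing_cont S); lra|].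
    apply (swing_uniform S). }
  assert (Lf : forall f : R -> R, continuous f t -> filterlim (fun p : R * R => f (fst p)) F (locally (f t))).
  { intros f Hf. apply (filterlim_comp _ _ _ fst f F (locally t)); [apply filterlim_fst | exact Hf]. }
  assert (Lw := Lf w (proj1 (slits_w S t ltac:(lra)))).
  destruct (centered_cont (slits_force S) t ltac:(lra)) as [cX cV].
  assert (LX0 := Lf X0 cX). assert (LV0 := Lf V0 cV).
  assert (Ly : filterlim (fun p : R * R => snd p) F (locally 0)).
  { apply (filterlim_comp _ _ _ snd (fun y => y) F (at_right 0)); [apply filterlim_snd | apply flim_id_right]. }
  pose proof (slits_force_ge S t ltac:(lra)) as N0.
  assert (N0' : 0 < X0 t ^ 2 + V0 t ^ 2) by nra.
  pose proof (tip_force_gap S HG1 HG2 t ltac:(lra)) as N1.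
  pose proof (tip_force_gap_conj t ltac:(lra)) as N2.
  pose proof (tip_upper S HG1 HG2 t Ht) as HG.
  assert (N3 : 0 < G1 t ^ 2 + G2 t ^ 2) by (pose proof (pow2_ge_0 (G1 t)); nra).
  pose proof (sqrt_sum_pos _ _ N0') as Q0. pose proof (sqrt_sum_pos _ _ N1) as Q1.
  pose proof (sqrt_sum_pos _ _ N2) as Q2. pose proof (sqrt_sum_pos _ _ N3) as Q3.
  pose (E := fun p : R * R => exp (rho / 4 *
    (ln (sqrt (X0 (fst p) ^ 2 + (snd p - V0 (fst p)) ^ 2)) -
       ln (sqrt ((X (fst p) (snd p) 0 - X0 0) ^ 2 + (V (fst p) (snd p) 0 - V0 0) ^ 2)) +
    (ln (sqrt (X0 (fst p) ^ 2 + (snd p + V0 (fst p)) ^ 2)) -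
       ln (sqrt ((X (fst p) (snd p) 0 - X0 0) ^ 2 + (V (fst p) (snd p) 0 + V0 0) ^ 2)))))).
  pose (J := fun p : R * R => PI / 2 - arg_H (X (fst p) (snd p) 0, V (fst p) (snd p) 0) + rho / 4 *
    (swing X0 V0 X V (fst p) (snd p) + (arg_H (- X0 (fst p), snd p + V0 (fst p)) -
       arg_H (X (fst p) (snd p) 0 - X0 0, V (fst p) (snd p) 0 + V0 0)))).
  assert (LE : filterlim E F (locally (tip_scale rho X0 V0 G1 G2 t))).
  { unfold tip_scale.
    assert (B1 : filterlim (fun p => ln (sqrt (X0 (fst p) ^ 2 + (snd p - V0 (fst p)) ^ 2))) F
      (locally (ln (sqrt (X0 t ^ 2 + V0 t ^ 2))))).
    { apply flim_ln; [|assumption].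
      replace (X0 t ^ 2 + V0 t ^ 2) with (X0 t ^ 2 + (0 - V0 t) ^ 2) by ring. flim. }
    assert (B2 : filterlim (fun p => ln (sqrt (X0 (fst p) ^ 2 + (snd p + V0 (fst p)) ^ 2))) F
      (locally (ln (sqrt (X0 t ^ 2 + V0 t ^ 2))))).
    { apply flim_ln; [|assumption].
      replace (X0 t ^ 2 + V0 t ^ 2) with (X0 t ^ 2 + (0 + V0 t) ^ 2) by ring. flim. }
    assert (B3 : filterlim (fun p => ln (sqrt ((X (fst p) (snd p) 0 - X0 0) ^ 2 + (V (fst p) (snd p) 0 - V0 0) ^ 2))) F
      (locally (ln (sqrt ((G1 t - X0 0) ^ 2 + (G2 t - V0 0) ^ 2))))).
    { apply flim_ln; [|assumption]. flim. }
    assert (B4 : filterlim (fun p => ln (sqrt ((X (fst p) (snd p) 0 - X0 0) ^ 2 + (V (fst p) (snd p) 0 + V0 0) ^ 2))) F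
      (locally (ln (sqrt ((G1 t - X0 0) ^ 2 + (G2 t + V0 0) ^ 2))))).
    { apply flim_ln; [|assumption]. flim. }
    unfold E. flim. }
  assert (LJ : filterlim J F (locally (a - PI / 2))).
  { assert (B1 : filterlim (fun p => arg_H (X (fst p) (snd p) 0, V (fst p) (snd p) 0)) F (locally (arg_H (G1 t, G2 t))))
      by (apply flim_arg_H; assumption).
    assert (B2 : filterlim (fun p => arg_H (- X0 (fst p), snd p + V0 (fst p))) F (locally (arg_H (- X0 t, V0 t)))).
    { rewrite <- (Rplus_0_l (V0 t)). apply flim_arg_H; [flim | flim |]. rewrite Rplus_0_l. nra. }
    assert (B3 : filterlim (fun p => arg_H (X (fst p) (snd p) 0 - X0 0, V (fst p) (snd p) 0 + V0 0)) F
      (locally (arg_H (G1 t - X0 0, G2 t + V0 0)))).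
    { apply flim_arg_H; [flim | flim | assumption]. }
    unfold a, tip_angle. replace (PI - arg_H (G1 t, G2 t) + rho / 4 *
      (tip_swing X0 V0 X V t + (arg_H (- X0 t, V0 t) - arg_H (G1 t - X0 0, G2 t + V0 0))) - PI / 2)
      with (PI / 2 - arg_H (G1 t, G2 t) + rho / 4 *
      (tip_swing X0 V0 X V t + (arg_H (- X0 t, V0 t) - arg_H (G1 t - X0 0, G2 t + V0 0)))) by field.
    unfold J. flim. }
  pose (r := fun p : R * R => sqrt (X (fst p) (snd p) 0 ^ 2 + V (fst p) (snd p) 0 ^ 2)).
  assert (Lr : filterlim r F (locally (sqrt (G1 t ^ 2 + G2 t ^ 2)))) by (unfold r; flim).
  assert (Hca : cos (a - PI / 2) = sin a) by (rewrite cos_minus, cos_PI2, sin_PI2; ring).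
  assert (Hsa : sin (a - PI / 2) = - cos a) by (rewrite sin_minus, cos_PI2, sin_PI2; ring).
  assert (Hm : 0 < Rmin 1 (d / 2)) by (apply Rmin_pos; lra).
  (* The formula for the derivative at height [y] holds for small [y] only. *)
  pose (cut := fun y => Rmin y (Rmin 1 (d / 2))).
  assert (Hcut : forall y, 0 < y -> 0 < cut y <= Rmin 1 (d / 2)).
  { intros y Hy. unfold cut. split; [apply Rmin_pos; lra | apply Rmin_r]. }
  assert (Hcut1 : forall y, 0 < y < Rmin 1 (d / 2) -> cut y = y) by (intros y Hy; apply Rmin_left; lra).
  assert (HFy : F (fun p => cut (snd p) = snd p)).
  { apply (Filter_prod _ _ _ (fun _ => True) (fun y => 0 < y < Rmin 1 (d / 2))).
    - apply filter_true.
    - apply (at_right_intro _ (Rmin 1 (d / 2)) Hm). auto.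
    - intros x y _ Hy. apply Hcut1, Hy. }
  assert (HGc : forall (f : R -> R -> R -> R) (G : R -> R) t', filterlim (fun y => f t' y 0) (at_right 0) (locally (G t')) ->
    filterlim (fun y : R => f t' (cut y) 0 : R) (at_right 0) (locally (G t' : R))).
  { intros f G t' Hf. refine (filterlim_ext_loc (fun y => f t' y 0) _ _ Hf).
    apply (at_right_intro _ (Rmin 1 (d / 2)) Hm). intros y Hy. rewrite Hcut1; auto. }
  split.
  - apply (derive_of_limit (fun t y => X t (cut y) 0)
      (fun t y => E (t, cut y) / r (t, cut y) * (cut y * w t * cos (J (t, cut y)) - 2 * sin (J (t, cut y)))) G1 T t _ Ht).
    + intros t' y Ht' Hy. apply (slits_start_derive_eq t' (cut y) Ht' (Hcut y Hy)).
    + intros t' Ht'. apply HGc, HG1. lra.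
    + apply (filterlim_ext_loc (fun p => E p / r p * (snd p * w (fst p) * cos (J p) - 2 * sin (J p)))).
      { revert HFy. apply filter_imp. intros [x y] Hy. simpl in *. rewrite Hy. reflexivity. }
      replace (m * cos a) with (tip_scale rho X0 V0 G1 G2 t / sqrt (G1 t ^ 2 + G2 t ^ 2) *
        (0 * w t * cos (a - PI / 2) - 2 * sin (a - PI / 2))) by (rewrite Hsa; unfold m; field; lra).
      flim.
  - apply (derive_of_limit (fun t y => V t (cut y) 0)
      (fun t y => E (t, cut y) / r (t, cut y) * (cut y * w t * sin (J (t, cut y)) + 2 * cos (J (t, cut y)))) G2 T t _ Ht).
    + intros t' y Ht' Hy. apply (slits_start_derive_eq t' (cut y) Ht' (Hcut y Hy)).
    + intros t' Ht'. apply HGc, HG2. lra.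
    + apply (filterlim_ext_loc (fun p => E p / r p * (snd p * w (fst p) * sin (J p) + 2 * cos (J p)))).
      { revert HFy. apply filter_imp. intros [x y] Hy. simpl in *. rewrite Hy. reflexivity. }
      replace (m * sin a) with (tip_scale rho X0 V0 G1 G2 t / sqrt (G1 t ^ 2 + G2 t ^ 2) *
        (0 * w t * sin (a - PI / 2) + 2 * cos (a - PI / 2))) by (rewrite Hca; unfold m; field; lra).
      flim.
Qed.
End Tip.

(** * Derivatives relative to a set of times *)

Lemma within_elim (D P : R -> Prop) (t : R) : within D (locally t) P ->
  exists d, 0 < d /\ forall s, D s -> Rabs (s - t) < d -> P s.
Proof.
  intros [d Hd]. exists d. split; [apply cond_pos|]. intros s Hs Hst. apply Hd; assumption.
Qed.

Lemma within_intro (D P : R -> Prop) (t d : R) : 0 < d ->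
  (forall s, D s -> Rabs (s - t) < d -> P s) -> within D (locally t) P.
Proof. intros Hd H. exists (mkposreal d Hd). intros s Hst Hs. apply H; assumption. Qed.

Lemma is_derive_on_eps {V : NormedModule R_AbsRing} (D : R -> Prop) (f : R -> V) (t : R) (v : V) :
  D t -> (is_derive_on D f t v <->
    forall eps, 0 < eps -> exists d, 0 < d /\ forall s, D s -> Rabs (s - t) < d ->
      norm (minus (minus (f s) (f t)) (scal (s - t) v)) <= eps * Rabs (s - t)).
Proof.
  intros Dt. split.
  - intros [_ H] eps Heps.
    assert (Ht : is_filter_lim (within D (locally t)) t) by (intros P HP; apply filter_le_within, HP).
    exact (within_elim _ _ _ (H t Ht (mkposreal eps Heps))).
  - intros H. split; [exact (is_linear_scal_l (K := R_AbsRing) v)|]. intros x Hx eps.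
    assert (E : x = t).
    { destruct (Req_dec x t) as [|Hne]; [assumption|]. exfalso.
      assert (Hp : 0 < Rabs (x - t)) by (apply Rabs_pos_lt; lra).
      assert (Hl : locally x (fun s => Rabs (s - x) < Rabs (x - t)))
        by (exists (mkposreal _ Hp); intros s Hs; exact Hs).
      destruct (within_elim _ _ _ (Hx _ Hl)) as (d & Hd & HP).
      specialize (HP t Dt). rewrite Rminus_diag, Rabs_R0 in HP. specialize (HP Hd).
      rewrite Rabs_minus_sym in HP. lra. }
    subst x. destruct (H eps (cond_pos eps)) as (d & Hd & HP).
    apply (within_intro _ _ _ d Hd). exact HP.
Qed.

Lemma norm_C (z : C) : @norm R_AbsRing C_R_NormedModule z = Cmod z.
Proof.
  destruct z as [a b]. rewrite Cmod_pair, <- (pow2_abs a), <- (pow2_abs b). reflexivity.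
Qed.

(** * Curves with a given speed and direction *)

(** A curve with speed [m] and direction [cis psi]. As above, the functions are
    continued to negative times. *)
Record steered (X : Rbar) (m psi c1 c2 : R -> R) : Prop := {
  steered_X : Rbar_lt 0 X;
  steered_cont : forall x : R, Rbar_lt x X -> continuous m x /\ continuous psi x /\
    continuous c1 x /\ continuous c2 x;
  steered_speed : forall x : R, 0 <= x -> Rbar_lt x X -> 0 < m x;
  steered_derive : forall x : R, 0 < x -> Rbar_lt x X ->
    is_derive c1 x (m x * cos (psi x)) /\ is_derive c2 x (m x * sin (psi x))
}.

Arguments steered_X {X m psi c1 c2} _.
Arguments steered_cont {X m psi c1 c2} _ x _.
Arguments steered_speed {X m psi c1 c2} _ x _ _.
Arguments steered_derive {X m psi c1 c2} _ x _ _.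

Lemma Rbar_between (a : R) (T : Rbar) : Rbar_lt a T -> exists b : R, a < b /\ Rbar_lt b T.
Proof.
  destruct T as [r | |]; simpl; intros H; [| |contradiction].
  - exists ((a + r) / 2). split; simpl; lra.
  - exists (a + 1). split; simpl; [lra | exact I].
Qed.

Lemma Rbar_le_lt_R (a b : R) (T : Rbar) : a <= b -> Rbar_lt b T -> Rbar_lt a T.
Proof. intros H. apply Rbar_le_lt_trans. exact H. Qed.

Section Steered.
Context {X : Rbar} {m psi c1 c2 : R -> R} (H : steered X m psi c1 c2).

Let sg (x : R) : R := RInt m 0 x.

Lemma arc_derive (x : R) : Rbar_lt x X -> is_derive sg x (m x).
Proof.
  intros Hx. destruct (Rbar_between x X Hx) as (b & Hb & HbX).
  assert (H0 := steered_X H).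
  destruct (Rle_dec b 0) as [Hle|Hle].
  - destruct (Rbar_between 0 X H0) as (b' & Hb' & Hb'X).
    apply (is_derive_primitive m b'); [assumption | | lra].
    intros z Hz. apply (steered_cont H). apply (Rbar_le_lt_R z b'); [lra | assumption].
  - apply (is_derive_primitive m b); [lra | | lra].
    intros z Hz. apply (steered_cont H). apply (Rbar_le_lt_R z b); [lra | assumption].
Qed.

Lemma arc_0 : sg 0 = 0.
Proof. exact (RInt_point 0 m). Qed.

Lemma arc_le (a b : R) : 0 <= a <= b -> Rbar_lt b X -> sg a <= sg b.
Proof.
  intros Hab Hb. apply nondecreasing_of_derive; [lra| |].
  - intros x Hx. apply (continuous_of_derive sg x (m x)), arc_derive, (Rbar_le_lt_R x b); [lra | assumption].
  - intros x Hx. assert (HxX : Rbar_lt x X) by (apply (Rbar_le_lt_R x b); [lra | assumption]).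
    exists (m x). split; [apply arc_derive, HxX|]. left; apply (steered_speed H); [lra | assumption].
Qed.

Lemma arc_lt (a b : R) : 0 <= a < b -> Rbar_lt b X -> sg a < sg b.
Proof.
  intros Hab Hb.
  assert (HX : forall x : R, x <= b -> Rbar_lt x X) by (intros x Hx; apply (Rbar_le_lt_R x b); assumption).
  destruct (MVT_gen sg a b m) as (c & Hc & E).
  - intros x Hx. rewrite Rmin_left, Rmax_right in Hx by lra. apply arc_derive, HX; lra.
  - intros x Hx. rewrite Rmin_left, Rmax_right in Hx by lra. apply continuity_pt_filterlim.
    apply (continuous_of_derive sg x (m x)), arc_derive, HX; lra.
  - rewrite Rmin_left, Rmax_right in Hc by lra.
    assert (0 < m c) by (apply (steered_speed H); [lra | apply HX; lra]). nra.
Qed.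

(** Taking [u + i v] in the direction of a chord gives that chords are at most as
    long as arcs; taking it opposite to a nearly constant direction [psi] gives
    the converse, up to a factor close to [1]. *)
Lemma functional_increment_le (u v k a b : R) : 0 <= a <= b -> Rbar_lt b X ->
  (forall x, a < x < b -> u * cos (psi x) + v * sin (psi x) <= k) ->
  u * (c1 b - c1 a) + v * (c2 b - c2 a) <= k * (sg b - sg a).
Proof.
  intros Hab Hb Hk.
  assert (HX : forall x : R, x <= b -> Rbar_lt x X) by (intros x Hx; apply (Rbar_le_lt_R x b); assumption).
  pose proof (increment_le (fun x => u * c1 x + v * c2 x) (fun x => k * sg x) a b ltac:(lra)) as L.
  cbv beta in L.
  replace (u * (c1 b - c1 a) + v * (c2 b - c2 a)) with (u * c1 b + v * c2 b - (u * c1 a + v * c2 a)) by ring.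
  rewrite Rmult_minus_distr_l. apply L.
  - intros x Hx. destruct (steered_cont H x (HX x ltac:(lra))) as (_ & _ & h1 & h2).
    pose proof (continuous_of_derive sg x _ (arc_derive x (HX x ltac:(lra)))). split; cts.
  - intros x Hx. destruct (steered_derive H x ltac:(lra) (HX x ltac:(lra))) as [d1 d2].
    pose proof (arc_derive x (HX x ltac:(lra))) as d3.
    pose proof (steered_speed H x ltac:(lra) (HX x ltac:(lra))).
    exists (u * (m x * cos (psi x)) + v * (m x * sin (psi x))), (k * m x).
    split; [|split].
    + apply (is_derive_plus (fun x => u * c1 x)); [apply (is_derive_scal c1); exact d1 | apply (is_derive_scal c2); exact d2].
    + apply (is_derive_scal sg); exact d3.
    + specialize (Hk x Hx). nra.
Qed.

Let c (x : R) : C := (c1 x, c2 x).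

Lemma Cmod_minus_pair (x x' y y' : R) : Cmod ((x, y) - (x', y'))%C = sqrt ((x - x') ^ 2 + (y - y') ^ 2).
Proof. reflexivity. Qed.

Lemma chord_le_arc (a b : R) : 0 <= a <= b -> Rbar_lt b X -> Cmod (c b - c a)%C <= sg b - sg a.
Proof.
  intros Hab Hb. pose proof (arc_le a b Hab Hb).
  unfold c. rewrite Cmod_minus_pair. set (p := c1 b - c1 a). set (q := c2 b - c2 a).
  pose proof (pow2_ge_0 p). pose proof (pow2_ge_0 q).
  destruct (Req_dec (p ^ 2 + q ^ 2) 0) as [E|E]; [rewrite E, sqrt_0; lra|].
  assert (Hr : 0 < sqrt (p ^ 2 + q ^ 2)) by (apply sqrt_lt_R0; lra).
  pose proof (sqrt_sqrt (p ^ 2 + q ^ 2) ltac:(lra)) as Q. set (r := sqrt (p ^ 2 + q ^ 2)) in *.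
  assert (Hu : (p / r) ^ 2 + (q / r) ^ 2 = 1) by (field_simplify_eq; [nra | lra]).
  pose proof (functional_increment_le (p / r) (q / r) 1 a b Hab Hb) as L. fold p q in L.
  replace (p / r * p + q / r * q) with r in L
    by (apply (Rmult_eq_reg_r r); [field_simplify; [nra | lra] | lra]).
  rewrite Rmult_1_l in L. apply L. intros x Hx.
  pose proof (sin2_cos2 (psi x)) as Hsc. unfold Rsqr in Hsc.
  pose proof (pow2_ge_0 (p / r - cos (psi x))). pose proof (pow2_ge_0 (q / r - sin (psi x))). nra.
Qed.

Lemma chord_ge_arc (a b al k : R) : 0 <= a <= b -> Rbar_lt b X ->
  (forall x, a < x < b -> k <= cos (psi x - al)) -> k * (sg b - sg a) <= Cmod (c b - c a)%C.
Proof.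
  intros Hab Hb Hk.
  pose proof (functional_increment_le (- cos al) (- sin al) (- k) a b Hab Hb) as L.
  assert (Hd : cos al * (c1 b - c1 a) + sin al * (c2 b - c2 a) <= Cmod (c b - c a)%C).
  { unfold c. rewrite Cmod_minus_pair. eapply Rle_trans; [apply Rle_abs|].
    pose proof (dot_le (cos al) (- sin al) (c1 b - c1 a) (c2 b - c2 a)) as D.
    pose proof (sin2_cos2 al) as Hsc. unfold Rsqr in Hsc.
    replace (cos al ^ 2 + (- sin al) ^ 2) with 1 in D by (rewrite <- Hsc; ring).
    rewrite sqrt_1, Rmult_1_l in D.
    replace (cos al * (c1 b - c1 a) + sin al * (c2 b - c2 a)) with
      (cos al * (c1 b - c1 a) - - sin al * (c2 b - c2 a)) by ring. exact D. }
  assert (L' : - cos al * (c1 b - c1 a) + - sin al * (c2 b - c2 a) <= - k * (sg b - sg a)).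
  { apply L. intros x Hx. specialize (Hk x Hx). rewrite cos_minus in Hk. lra. }
  lra.
Qed.

Lemma sum_telescope (f : nat -> R) n : sum_f_R0 (fun i => f (S i) - f i) n = f (S n) - f 0%nat.
Proof. induction n as [|n IH]; simpl; [reflexivity | rewrite IH; simpl; ring]. Qed.

(** For the lower bound, take a partition which is uniform in the parameter [sqrt t]
    and so fine that [psi] is nearly constant on its intervals. *)
Lemma length_sqrt (gamma : R -> C) (t : R) : 0 <= t -> Rbar_lt (sqrt t) X ->
  (forall s, 0 <= s <= t -> gamma s = c (sqrt s)) ->
  is_length gamma 0 t (sg (sqrt t)).
Proof.
  intros Ht HtX Hg. pose proof (sqrt_pos t) as Hs0.
  assert (HX : forall x : R, x <= sqrt t -> Rbar_lt x X) by (intros x Hx; apply (Rbar_le_lt_R x (sqrt t)); assumption).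
  split.
  - intros x (n & p & Hp0 & HpS & Hp & ->).
    assert (Hlo : forall i, (i <= S n)%nat -> 0 <= p i).
    { induction i as [|i IH]; intros Hi; [rewrite Hp0; lra|].
      eapply Rle_trans; [apply IH; lia | apply Hp; lia]. }
    assert (Hhi : forall j, (j <= S n)%nat -> p (S n - j)%nat <= t).
    { induction j as [|j IH]; intros Hj; [rewrite Nat.sub_0_r, HpS; lra|].
      eapply Rle_trans; [|apply IH; lia]. replace (S n - j)%nat with (S (S n - S j)) by lia. apply Hp. lia. }
    assert (Hhi' : forall i, (i <= S n)%nat -> p i <= t).
    { intros i Hi. replace i with (S n - (S n - i))%nat by lia. apply Hhi. lia. }
    apply Rle_trans with (sum_f_R0 (fun i => sg (sqrt (p (S i))) - sg (sqrt (p i))) n).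
    + apply sum_Rle. intros i Hi.
      rewrite !Hg by (split; [apply Hlo | apply Hhi']; lia).
      apply chord_le_arc.
      * split; [apply sqrt_pos | apply sqrt_le_1_alt, Hp; lia].
      * apply HX, sqrt_le_1_alt, Hhi'. lia.
    + rewrite (sum_telescope (fun i => sg (sqrt (p i)))), Hp0, HpS, sqrt_0, arc_0. lra.
  - intros l Hl.
    assert (Harc : 0 <= sg (sqrt t)) by (rewrite <- arc_0; apply arc_le; [lra | assumption]).
    assert (Heps : forall eps, 0 < eps < 1 -> (1 - eps) * sg (sqrt t) <= l).
    { intros eps Heps.
      destruct (continuous_eps cos 0 eps (continuous_cos 0) ltac:(lra)) as (d & Hd & Hcos).
      destruct (@Heine_cor2 psi 0 (sqrt t)
        (fun x Hx => proj2 (continuity_pt_filterlim psi x)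
           (proj1 (proj2 (steered_cont H x (HX x (proj2 Hx)))))) (mkposreal d Hd)) as [dl Hdl].
      simpl in Hdl.
      assert (Hq : 0 < dl / (sqrt t + 1)) by (apply Rdiv_lt_0_compat; [apply cond_pos | lra]).
      destruct (small_index _ Hq) as (n & Hn). specialize (Hn n (le_n n)).
      pose (h := sqrt t * / (INR n + 1)).
      assert (Hn0 : 0 < INR n + 1) by (pose proof (pos_INR n); lra).
      assert (Hh : 0 <= h < dl).
      { unfold h. split; [apply Rmult_le_pos; lra|].
        apply Rle_lt_trans with ((sqrt t + 1) * / (INR n + 1)); [apply Rmult_le_compat_r; lra|].
        apply Rlt_le_trans with ((sqrt t + 1) * (dl / (sqrt t + 1))); [apply Rmult_lt_compat_l; lra|].
        right; field; lra. }
      assert (Hlast : INR (S n) * h = sqrt t) by (rewrite S_INR; unfold h; field; lra).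
      assert (Hle : forall i, (i <= S n)%nat -> 0 <= INR i * h <= sqrt t).
      { intros i Hi. apply le_INR in Hi. pose proof (pos_INR i). split; [nra|]. rewrite <- Hlast. nra. }
      pose (p := fun i => (INR i * h) ^ 2).
      assert (Hsp : forall i, (i <= S n)%nat -> sqrt (p i) = INR i * h)
        by (intros i Hi; unfold p; apply sqrt_pow2, Hle, Hi).
      assert (Hpt : forall i, (i <= S n)%nat -> 0 <= p i <= t).
      { intros i Hi. unfold p. destruct (Hle i Hi). split; [apply pow2_ge_0|].
        rewrite <- (sqrt_sqrt t) by lra. nra. }
      apply Rle_trans with (sum_f_R0 (fun i => Cmod (gamma (p (S i)) - gamma (p i))%C) n).
      - pose proof (sum_telescope (fun i => sg (INR i * h)) n) as Et. cbv beta in Et.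
        rewrite Hlast in Et. replace (INR 0 * h) with 0 in Et by (simpl; ring).
        rewrite arc_0, Rminus_0_r in Et. rewrite <- Et, scal_sum.
        apply sum_Rle. intros i Hi.
        rewrite !Hg, !Hsp by (try apply Hpt; lia). rewrite Rmult_comm.
        destruct (Hle i ltac:(lia)) as [B0 B1]. destruct (Hle (S i) ltac:(lia)) as [B2 B3].
        rewrite S_INR in *.
        apply (chord_ge_arc _ _ (psi (INR i * h))); [nra | apply HX; lra|].
        intros x Hx. 
        assert (Hpx : Rabs (psi x - psi (INR i * h)) < d).
        { apply Hdl; try lra. rewrite Rabs_pos_eq; lra. }
        specialize (Hcos (psi x - psi (INR i * h))). rewrite Rminus_0_r, cos_0 in Hcos.
        specialize (Hcos Hpx). apply Rabs_def2 in Hcos. lra.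
      - apply Hl. exists n, p. split; [unfold p; simpl; ring|]. split.
        { unfold p. rewrite Hlast. simpl. rewrite Rmult_1_r. apply sqrt_sqrt; lra. }
        split; [|reflexivity]. intros i Hi. unfold p. rewrite S_INR.
        destruct (Hle i ltac:(lia)). apply pow_incr. nra. }
    apply Rnot_lt_le. intros Hlt.
    assert (Hs : 0 < sg (sqrt t)).
    { destruct Harc as [|E]; [assumption|]. specialize (Heps (1 / 2) ltac:(lra)). rewrite <- E in *. lra. }
    pose (e := (sg (sqrt t) - l) / (2 * (sg (sqrt t) + Rabs l))).
    pose proof (Rabs_pos l). pose proof (Rle_abs l). pose proof (Rle_abs (- l)) as Hl'. rewrite Rabs_Ropp in Hl'.
    assert (He : 0 < e < 1).
    { unfold e. split; [apply Rdiv_lt_0_compat; lra|]. apply (Rmult_lt_reg_r (2 * (sg (sqrt t) + Rabs l))); [lra|].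
      field_simplify; lra. }
    specialize (Heps e He).
    assert (e * sg (sqrt t) <= (sg (sqrt t) - l) / 2); [|lra].
    unfold e. apply (Rmult_le_reg_r (2 * (sg (sqrt t) + Rabs l))); [lra|].
    field_simplify; [|lra]. nra.
Qed.
End Steered.

(** * Arc-length reparametrization *)

Definition sqrt_Rbar (T : Rbar) : Rbar :=
  match T with Finite r => Finite (sqrt r) | p_infty => p_infty | m_infty => m_infty end.

Lemma sqrt_Rbar_lt (T : Rbar) (x : R) : 0 <= x -> (Rbar_lt x (sqrt_Rbar T) <-> Rbar_lt (x ^ 2) T).
Proof.
  intros Hx. destruct T as [r | |]; simpl; try tauto. split; intros H.
  - assert (0 < r) by (apply Rnot_le_lt; intros Hr; rewrite sqrt_neg_0 in H; lra).
    pose proof (sqrt_sqrt r ltac:(lra)). nra.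
  - rewrite <- (sqrt_pow2 x Hx). apply sqrt_lt_1_alt. simpl. nra.
Qed.

Lemma ico_sqrt T t : ico T t -> ico (sqrt_Rbar T) (sqrt t).
Proof.
  intros [H0 H1]. split; [apply sqrt_pos|]. apply sqrt_Rbar_lt; [apply sqrt_pos|].
  rewrite pow2_sqrt by assumption. exact H1.
Qed.

Lemma ico_sqr T x : ico (sqrt_Rbar T) x -> ico T (x ^ 2).
Proof. intros [H0 H1]. split; [apply pow2_ge_0 | apply sqrt_Rbar_lt; assumption]. Qed.

Lemma Cmod_cis a : Cmod (cis a) = 1.
Proof.
  unfold cis. rewrite Cmod_pair. pose proof (sin2_cos2 a) as H. unfold Rsqr in H.
  replace (cos a ^ 2 + sin a ^ 2) with 1 by lra. apply sqrt_1.
Qed.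

Lemma Cmod_le_sum (a b : R) : Cmod (a, b) <= Rabs a + Rabs b.
Proof.
  rewrite Cmod_pair. pose proof (Rabs_pos a). pose proof (Rabs_pos b).
  rewrite <- (sqrt_pow2 (Rabs a + Rabs b)) by lra. apply sqrt_le_1_alt.
  rewrite <- (pow2_abs a), <- (pow2_abs b). nra.
Qed.

Section Reparam.
Context {tau : Rbar} {m psi c1 c2 : R -> R} (H : steered (sqrt_Rbar tau) m psi c1 c2)
  {gamma : R -> C} (Hg : forall t, ico tau t -> gamma t = (c1 (sqrt t), c2 (sqrt t))).

Let X := sqrt_Rbar tau.
Let sg (x : R) : R := RInt m 0 x.

Let sg_lt (a b : R) (h : 0 <= a < b) (hb : Rbar_lt b X) : sg a < sg b := arc_lt H a b h hb.
Let sg_le (a b : R) (h : 0 <= a <= b) (hb : Rbar_lt b X) : sg a <= sg b := arc_le H a b h hb.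

Lemma arc_inj (x y : R) : ico X x -> ico X y -> sg x = sg y -> x = y.
Proof.
  intros [Hx HxX] [Hy HyX] E. destruct (Rtotal_order x y) as [h | [h | h]]; [|assumption|]; exfalso.
  - pose proof (sg_lt x y ltac:(lra) HyX). lra.
  - pose proof (sg_lt y x ltac:(lra) HxX). lra.
Qed.

Lemma length_arc t : ico tau t -> is_length gamma 0 t (sg (sqrt t)).
Proof.
  intros Ht. apply (length_sqrt H gamma t (proj1 Ht) (proj2 (ico_sqrt _ _ Ht))).
  intros s Hs. apply Hg. split; [lra|]. apply (Rbar_le_lt_R s t); [lra | apply Ht].
Qed.

Lemma reparam_exists : exists (eta : R -> C) (L : Rbar), is_arc_length_reparam gamma tau eta L.
Proof.
  pose (inv := fun r => epsilon (inhabits 0) (fun x => ico X x /\ sg x = r)).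
  assert (Hinv : forall r, (exists x, ico X x /\ sg x = r) -> ico X (inv r) /\ sg (inv r) = r)
    by (intros r Hr; exact (epsilon_spec (inhabits 0) (fun x => ico X x /\ sg x = r) Hr)).
  pose (E := fun r => exists x, ico X x /\ r = sg x).
  exists (fun r => (c1 (inv r), c2 (inv r))), (Lub_Rbar E), (fun t => sg (sqrt t)).
  destruct (Lub_Rbar_correct E) as [Hub Hlub].
  split.
  - intros t Ht. split; [apply length_arc, Ht|]. apply ico_sqrt in Ht as Hx.
    split; [split|].
    + pose proof (sg_le 0 (sqrt t) ltac:(pose proof (proj1 Hx); lra) (proj2 Hx)) as L.
      unfold sg in L at 1; rewrite (arc_0 (m := m)) in L. exact L.
    + destruct (Rbar_between _ _ (proj2 Hx)) as (b & Hb & HbX).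
      apply Rbar_lt_le_trans with (sg b).
      * apply sg_lt; [pose proof (proj1 Hx); lra | exact HbX].
      * apply Hub. exists b. split; [|reflexivity]. split; [pose proof (proj1 Hx); lra | exact HbX].
    + destruct (Hinv (sg (sqrt t))) as [h1 h2]; [exists (sqrt t); auto|].
      rewrite (arc_inj _ _ h1 Hx h2). symmetry. apply Hg, Ht.
  - intros r [Hr0 HrL].
    assert (Hex : exists b, ico X b /\ r < sg b).
    { destruct (classic (exists b, ico X b /\ r < sg b)) as [|Hn]; [assumption|]. exfalso.
      apply (Rbar_lt_not_le _ _ HrL). apply Hlub. intros y (x & Hx & ->). simpl.
      apply Rnot_lt_le. intros Hlt. apply Hn. exists x; auto. }
    destruct Hex as (b & [Hb HbX] & Hrb).
    assert (Hx : exists x, ico X x /\ sg x = r).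
    { destruct Hr0 as [Hr0 | <-].
      - assert (H0 : sg 0 = 0) by apply arc_0.
        destruct (IVT_interv (fun x => sg x - r) 0 b) as (z & Hz & Ez).
        + intros a Ha. apply continuity_pt_filterlim. apply (cont_minus sg (fun _ => r)); [|apply continuous_const].
          apply (continuous_of_derive sg a (m a)), (arc_derive H), (Rbar_le_lt_R a b); [lra | exact HbX].
        + destruct Hb as [|<-]; [assumption | lra].
        + lra.
        + lra.
        + exists z. split; [|lra]. split; [lra | apply (Rbar_le_lt_R z b); [lra | exact HbX]].
      - exists 0. split; [|apply arc_0]. split; [lra | apply (steered_X H)]. }
    destruct Hx as (x & Hx & Ex). exists (x ^ 2). split; [apply ico_sqr, Hx|].
    rewrite sqrt_pow2 by apply Hx. exact Ex.
Qed.

Section Given.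
Context {eta : R -> C} {L : Rbar} (He : is_arc_length_reparam gamma tau eta L).

Lemma reparam_spec :
  (forall x, ico X x -> ico L (sg x) /\ eta (sg x) = (c1 x, c2 x)) /\
  (forall r, ico L r -> exists x, ico X x /\ sg x = r).
Proof.
  destruct He as (s & Hs & Hsurj).
  assert (Es : forall t, ico tau t -> s t = sg (sqrt t))
    by (intros t Ht; eapply is_lub_u; [apply (Hs t Ht) | apply length_arc, Ht]).
  split.
  - intros x Hx. pose proof (ico_sqr _ _ Hx) as Ht. destruct (Hs _ Ht) as (_ & h1 & h2).
    rewrite (Es _ Ht), (sqrt_pow2 x) in h1, h2 by apply Hx.
    split; [exact h1|]. rewrite h2, Hg, (sqrt_pow2 x) by (apply Hx || exact Ht). reflexivity.
  - intros r Hr. destruct (Hsurj r Hr) as (t & Ht & E). exists (sqrt t).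
    split; [apply ico_sqrt, Ht | rewrite <- (Es t Ht); exact E].
Qed.

Definition arc_inv (r : R) : R := epsilon (inhabits 0) (fun x => ico X x /\ sg x = r).

Lemma arc_inv_spec r : ico L r -> ico X (arc_inv r) /\ sg (arc_inv r) = r.
Proof. intros Hr. exact (epsilon_spec (inhabits 0) _ (proj2 reparam_spec r Hr)). Qed.

Lemma arc_inv_arc x : ico X x -> arc_inv (sg x) = x.
Proof.
  intros Hx. destruct (arc_inv_spec (sg x) (proj1 (proj1 reparam_spec x Hx))) as [h1 h2].
  apply (arc_inj _ _ h1 Hx h2).
Qed.

Lemma eta_arc_inv r : ico L r -> eta r = (c1 (arc_inv r), c2 (arc_inv r)).
Proof.
  intros Hr. destruct (arc_inv_spec r Hr) as [h1 h2].
  rewrite <- h2 at 1. apply (proj1 reparam_spec _ h1).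
Qed.

Lemma arc_inv_cont r eps : ico L r -> 0 < eps ->
  exists d, 0 < d /\ forall r', ico L r' -> Rabs (r' - r) < d -> Rabs (arc_inv r' - arc_inv r) < eps.
Proof.
  intros Hr Heps. destruct (arc_inv_spec r Hr) as [[Hx HxX] Er].
  set (x := arc_inv r) in *.
  destruct (Rbar_between _ _ HxX) as (b & Hb & HbX).
  pose (b' := Rmin b (x + eps)).
  assert (Hb' : x < b' /\ b' <= x + eps) by (unfold b', Rmin; destruct Rle_dec; lra).
  assert (Hb'X : Rbar_lt b' X) by (apply (Rbar_le_lt_R b' b); [apply Rmin_l | exact HbX]).
  assert (D1 : 0 < sg b' - r) by (pose proof (sg_lt x b' ltac:(lra) Hb'X); lra).
  assert (D2 : exists d2, 0 < d2 /\ forall z, 0 <= z <= x - eps -> sg z <= r - d2).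
  { destruct (Rle_dec (x - eps) 0) as [Hle|Hle].
    - destruct (Rle_dec 0 (x - eps)) as [Hle'|Hle'].
      + exists (r - sg 0). assert (x = eps) by lra. split.
        * pose proof (sg_lt 0 x ltac:(lra) HxX). lra.
        * intros z Hz. replace z with 0 by lra. lra.
      + exists 1. split; [lra|]. intros z Hz. lra.
    - exists (r - sg (x - eps)).
      pose proof (sg_lt (x - eps) x ltac:(lra) HxX). split; [lra|].
      intros z Hz. pose proof (sg_le z (x - eps) Hz ltac:(apply (Rbar_le_lt_R _ x); [lra | exact HxX])).
      lra. }
  destruct D2 as (d2 & Hd2 & D2).
  exists (Rmin (sg b' - r) d2). split; [apply Rmin_pos; assumption|]. intros r' Hr' Hlt.
  pose proof (Rmin_l (sg b' - r) d2). pose proof (Rmin_r (sg b' - r) d2).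
  destruct (arc_inv_spec r' Hr') as [[Hx' HxX'] Er']. apply Rabs_def2 in Hlt.
  apply Rabs_def1.
  - apply Rnot_le_lt. intros Hge.
    pose proof (sg_le b' (arc_inv r') ltac:(lra) HxX'). lra.
  - apply Rnot_le_lt. intros Hge. specialize (D2 (arc_inv r') ltac:(lra)). lra.
Qed.

Lemma comp_arc_inv_cont (f : R -> R) r eps : ico L r -> continuous f (arc_inv r) -> 0 < eps ->
  exists d, 0 < d /\ forall r', ico L r' -> Rabs (r' - r) < d -> Rabs (f (arc_inv r') - f (arc_inv r)) < eps.
Proof.
  intros Hr Hf Heps. destruct (continuous_eps f _ eps Hf Heps) as (e & Hpe & Hfe).
  destruct (arc_inv_cont r e Hr Hpe) as (d & Hd & Hde). exists d. split; [assumption|].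
  intros r' Hr' Hlt. apply Hfe, Hde; assumption.
Qed.

Lemma filterlim_pair_within (f g : R -> R) r : ico L r ->
  continuous f (arc_inv r) -> continuous g (arc_inv r) ->
  filterlim (fun r => (f (arc_inv r), g (arc_inv r)) : C) (within (ico L) (locally r))
    (locally ((f (arc_inv r), g (arc_inv r)) : C)).
Proof.
  intros Hr Hf Hgc. apply filterlim_locally. intros eps.
  destruct (comp_arc_inv_cont f r eps Hr Hf (cond_pos eps)) as (d1 & Hd1 & H1).
  destruct (comp_arc_inv_cont g r eps Hr Hgc (cond_pos eps)) as (d2 & Hd2 & H2).
  apply (within_intro _ _ _ (Rmin d1 d2)); [apply Rmin_pos; assumption|].
  intros s Hs Hlt. pose proof (Rmin_l d1 d2). pose proof (Rmin_r d1 d2).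
  split; [apply H1 | apply H2]; auto; lra.
Qed.

Lemma reparam_C1 : is_C1_unit_speed eta L (fun r => cis (psi (arc_inv r))).
Proof.
  intros r Hr. destruct (arc_inv_spec r Hr) as [[Hx HxX] Er].
  destruct (steered_cont H _ HxX) as (_ & Hpsi & _ & _).
  set (x := arc_inv r) in *.
  pose proof (cont_cos psi x Hpsi) as Hcc. pose proof (cont_sin psi x Hpsi) as Hss.
  split; [|split].
  - apply (is_derive_on_eps (V := C_R_NormedModule)); [exact Hr|]. intros eps Heps.
    destruct (continuous_eps _ x (eps / 2) Hcc ltac:(lra)) as (e1 & He1 & Hc).
    destruct (continuous_eps _ x (eps / 2) Hss ltac:(lra)) as (e2 & He2 & Hs).
    destruct (arc_inv_cont r (Rmin e1 e2) Hr ltac:(apply Rmin_pos; assumption)) as (d & Hd & Hde).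
    exists d. split; [assumption|]. intros r' Hr' Hlt.
    pose proof (Rmin_l e1 e2). pose proof (Rmin_r e1 e2).
    specialize (Hde r' Hr' Hlt). fold x in Hde.
    destruct (arc_inv_spec r' Hr') as [[Hx' HxX'] Er'].
    rewrite norm_C, (eta_arc_inv r Hr), (eta_arc_inv r' Hr'). fold x.
    set (x' := arc_inv r') in *.
    assert (Hi : forall u v, u ^ 2 + v ^ 2 = 1 -> (u = 0 \/ v = 0) ->
      Rabs (u * (c1 x' - c1 x) + v * (c2 x' - c2 x) - (r' - r) * (u * cos (psi x) + v * sin (psi x)))
        <= eps / 2 * Rabs (r' - r)).
    { assert (Ho : forall a b, 0 <= a <= b -> Rbar_lt b X ->
        (forall z, a < z < b -> Rabs (z - x) < Rmin e1 e2) ->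
        forall u v, u ^ 2 + v ^ 2 = 1 -> (u = 0 \/ v = 0) ->
        u * (c1 b - c1 a) + v * (c2 b - c2 a) <= (u * cos (psi x) + v * sin (psi x) + eps / 2) * (sg b - sg a)).
      { intros a b Hab HbX Hz u v Huv Huv0. apply (functional_increment_le H); auto.
        intros z Hzab. specialize (Hz z Hzab). specialize (Hc z ltac:(lra)). specialize (Hs z ltac:(lra)).
        apply Rabs_def2 in Hc. apply Rabs_def2 in Hs.
        destruct Huv0 as [-> | ->].
        - assert (Hv : v = 1 \/ v = -1) by (assert ((v - 1) * (v + 1) = 0) by nra;
            destruct (Rmult_integral _ _ H2); [left | right]; lra).
          destruct Hv as [-> | ->]; lra.
        - assert (Hv : u = 1 \/ u = -1) by (assert ((u - 1) * (u + 1) = 0) by nra;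
            destruct (Rmult_integral _ _ H2); [left | right]; lra).
          destruct Hv as [-> | ->]; lra. }
      intros u v Huv Huv0. 
      assert (Hm : (- u) ^ 2 + (- v) ^ 2 = 1) by (rewrite <- Huv; ring).
      assert (Hm0 : - u = 0 \/ - v = 0) by lra.
      destruct (Rle_dec x x') as [Hle|Hle].
      - assert (Hz : forall z, x < z < x' -> Rabs (z - x) < Rmin e1 e2)
          by (intros z Hz; apply Rabs_def2 in Hde; apply Rabs_def1; lra).
        pose proof (Ho x x' ltac:(lra) HxX' Hz u v Huv Huv0) as O1.
        pose proof (Ho x x' ltac:(lra) HxX' Hz (- u) (- v) Hm Hm0) as O2.
        rewrite Er, Er' in O1, O2.
        assert (Hrr : 0 <= r' - r) by (rewrite <- Er, <- Er'; pose proof (sg_le x x' ltac:(lra) HxX'); lra).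
        rewrite (Rabs_pos_eq (r' - r)) by assumption. apply Rabs_le. lra.
      - assert (Hz : forall z, x' < z < x -> Rabs (z - x) < Rmin e1 e2)
          by (intros z Hz; apply Rabs_def2 in Hde; apply Rabs_def1; lra).
        pose proof (Ho x' x ltac:(lra) HxX Hz u v Huv Huv0) as O1.
        pose proof (Ho x' x ltac:(lra) HxX Hz (- u) (- v) Hm Hm0) as O2.
        rewrite Er, Er' in O1, O2.
        assert (Hrr : r' - r <= 0) by (rewrite <- Er, <- Er'; pose proof (sg_le x' x ltac:(lra) HxX); lra).
        rewrite (Rabs_left1 (r' - r)) by assumption. apply Rabs_le. lra. }
    pose proof (Hi 1 0 ltac:(ring) ltac:(lra)) as I1. pose proof (Hi 0 1 ltac:(ring) ltac:(lra)) as I2.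
    assert (E : @minus C_R_NormedModule (@minus C_R_NormedModule (c1 x', c2 x') (c1 x, c2 x)) (@scal R_AbsRing C_R_NormedModule (r' - r) (cis (psi x)))
      = (1 * (c1 x' - c1 x) + 0 * (c2 x' - c2 x) - (r' - r) * (1 * cos (psi x) + 0 * sin (psi x)),
         0 * (c1 x' - c1 x) + 1 * (c2 x' - c2 x) - (r' - r) * (0 * cos (psi x) + 1 * sin (psi x)))).
    { unfold minus, plus, opp, scal, cis; simpl. unfold prod_plus, prod_opp, prod_scal; simpl.
      unfold plus, opp, scal; simpl. unfold mult; simpl. f_equal; ring. }
    eapply Rle_trans; [right; apply (f_equal Cmod); exact E|].
    eapply Rle_trans; [apply Cmod_le_sum|]. lra.
  - apply (filterlim_pair_within (fun x => cos (psi x)) (fun x => sin (psi x)) r Hr Hcc Hss).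
  - apply Cmod_cis.
Qed.
End Given.
End Reparam.

(** * From the Loewner chain to slit trajectories *)

Arguments sle_chain {rho z0 tau gamma W g life ginv} _.
Arguments sle_inverse {rho z0 tau gamma W g life ginv} _.
Arguments sle_force {rho z0 tau gamma W g life ginv} _.
Arguments sle_start {rho z0 tau gamma W g life ginv} _.
Arguments sle_drive {rho z0 tau gamma W g life ginv} _.
Arguments sle_tau {rho z0 tau gamma W g life ginv} _.
Arguments sle_trace {rho z0 tau gamma W g life ginv} _.

Lemma is_derive_on_components (D : R -> Prop) (f : R -> C) (t : R) (v : C) : D t ->
  is_derive_on (V := C_R_NormedModule) D f t v ->
  is_derive_on (V := R_NormedModule) D (fun s => Re (f s)) t (Re v) /\
  is_derive_on (V := R_NormedModule) D (fun s => Im (f s)) t (Im v).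
Proof.
  intros Dt H. pose proof (proj1 (is_derive_on_eps (V := C_R_NormedModule) D f t v Dt) H) as He.
  split; apply (is_derive_on_eps (V := R_NormedModule)); try exact Dt; intros eps Heps;
    destruct (He eps Heps) as (d & Hd & Hb); exists d; (split; [exact Hd|]);
    intros s Hs Hlt; (eapply Rle_trans; [|exact (Hb s Hs Hlt)]);
    (rewrite norm_C; eapply Rle_trans; [|apply Rmax_Cmod]); [apply Rmax_l | apply Rmax_r].
Qed.

Section Clamp.
Context {T : Rbar} {f df : R -> R} (HT : Rbar_lt 0 T)
  (Hf : forall t, ico T t -> is_derive_on (V := R_NormedModule) (ico T) f t (df t)).

Lemma clamp_cont (s : R) : Rbar_lt s T -> continuous (fun s => f (Rmax 0 s)) s.
Proof.
  intros Hs. set (t := Rmax 0 s).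
  assert (Ht : ico T t).
  { split; [apply Rmax_l|]. unfold t, Rmax. destruct (Rle_dec 0 s); assumption. }
  destruct (proj1 (is_derive_on_eps (V := R_NormedModule) _ f t (df t) Ht) (Hf t Ht) 1 Rlt_0_1) as (d & Hd & Hb).
  destruct (Rbar_between s T Hs) as (b & Hsb & HbT).
  apply (continuous_of_linear_bound _ s (1 + Rabs (df t)) (Rmin d (b - s))); [apply Rmin_pos; lra|].
  intros s' Hs'. pose proof (Rmin_l d (b - s)). pose proof (Rmin_r d (b - s)).
  fold t. set (t' := Rmax 0 s').
  assert (Htt : Rabs (t' - t) <= Rabs (s' - s)).
  { unfold t', t, Rmax. destruct (Rle_dec 0 s'), (Rle_dec 0 s); unfold Rabs; repeat destruct Rcase_abs; lra. }
  assert (Ht' : ico T t').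
  { split; [apply Rmax_l|]. assert (Hs'b := Rabs_def2 _ _ Hs').
    unfold t', Rmax. destruct (Rle_dec 0 s'); [|exact HT]. apply (Rbar_le_lt_R s' b); [lra | assumption]. }
  specialize (Hb t' Ht' ltac:(lra)).
  change (Rabs (f t' - f t - (t' - t) * df t) <= 1 * Rabs (t' - t)) in Hb.
  replace (f t' - f t) with ((f t' - f t - (t' - t) * df t) + (t' - t) * df t) by ring.
  eapply Rle_trans; [apply Rabs_triang|]. rewrite Rabs_mult.
  pose proof (Rabs_pos (t' - t)). pose proof (Rabs_pos (df t)). nra.
Qed.

Lemma clamp_derive (t : R) : 0 < t -> Rbar_lt t T -> is_derive (fun s => f (Rmax 0 s)) t (df t).
Proof.
  intros Ht HtT. apply is_derive_Reals. intros eps Heps.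
  assert (Hi : ico T t) by (split; [lra | assumption]).
  destruct (proj1 (is_derive_on_eps (V := R_NormedModule) _ f t (df t) Hi) (Hf t Hi) (eps / 2) ltac:(lra)) as (d & Hd & Hb).
  destruct (Rbar_between t T HtT) as (b & Htb & HbT).
  assert (Hm : 0 < Rmin d (Rmin t (b - t))) by (repeat apply Rmin_pos; lra).
  exists (mkposreal _ Hm). intros h Hh Hlt. simpl in Hlt.
  pose proof (Rmin_l d (Rmin t (b - t))). pose proof (Rmin_r d (Rmin t (b - t))).
  pose proof (Rmin_l t (b - t)). pose proof (Rmin_r t (b - t)).
  assert (Hl := Rabs_def2 _ _ Hlt). rewrite !Rmax_right by lra.
  assert (Hi' : ico T (t + h)) by (split; [lra | apply (Rbar_le_lt_R _ b); [lra | assumption]]).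
  specialize (Hb (t + h) Hi'). replace (t + h - t) with h in Hb by ring. specialize (Hb ltac:(lra)).
  change (Rabs (f (t + h) - f t - h * df t) <= eps / 2 * Rabs h) in Hb.
  replace ((f (t + h) - f t) / h - df t) with ((f (t + h) - f t - h * df t) / h) by (field; assumption).
  unfold Rdiv. rewrite Rabs_mult, Rabs_inv. pose proof (Rabs_pos_lt h Hh).
  apply (Rmult_lt_reg_r (Rabs h)); [assumption|]. rewrite Rmult_assoc, Rinv_l by lra. nra.
Qed.
End Clamp.

Lemma clamped_bounded (f : R -> R) (T : R) : 0 <= T ->
  (forall s, s <= T -> continuous (fun s => f (Rmax 0 s)) s) ->
  exists lo hi, 0 <= lo <= T /\ 0 <= hi <= T /\
    forall s, s < T -> f lo <= f (Rmax 0 s) <= f hi.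
Proof.
  intros HT Hf.
  assert (Hc : forall c, 0 <= c <= T -> continuity_pt (fun s => f (Rmax 0 s)) c)
    by (intros c Hc; apply continuity_pt_filterlim, Hf; lra).
  destruct (continuity_ab_min _ 0 T HT Hc) as (lo & Hlo & Hlo').
  destruct (continuity_ab_maj _ 0 T HT Hc) as (hi & Hhi & Hhi').
  exists lo, hi. split; [assumption | split; [assumption|]]. intros s Hs.
  assert (Hr : 0 <= Rmax 0 s <= T) by (split; [apply Rmax_l | apply Rmax_lub; lra]).
  specialize (Hlo (Rmax 0 s) Hr). specialize (Hhi (Rmax 0 s) Hr).
  rewrite (Rmax_right 0 (Rmax 0 s)) in Hlo, Hhi by apply Hr.
  rewrite (Rmax_right 0 lo) in Hlo by apply Hlo'. rewrite (Rmax_right 0 hi) in Hhi by apply Hhi'. lra.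
Qed.

(** A trajectory [u] seen from the driving point, continued by a constant. *)
Definition rel_re (W : R -> R) (u : R -> C) (s : R) : R := Re (u (Rmax 0 s)) - W (Rmax 0 s).
Definition rel_im (u : R -> C) (s : R) : R := Im (u (Rmax 0 s)).

Section Data.
Context {rho : R} {z0 : C} {tau : Rbar} {gamma : R -> C} {W : R -> R} {g : R -> C -> C}
  {life : C -> Rbar} {ginv : R -> C -> C}
  (Hz0 : closed_half_plane z0) (Hz0' : z0 <> RtoC 0)
  (HD : sle0_rho_data rho z0 tau gamma W g life ginv).

Lemma tau_pos : Rbar_lt 0 tau.
Proof.
  destruct (Rbar_lt_le_dec 0 tau) as [|Hle]; [assumption|]. exfalso.
  destruct (sle_tau HD) as [_ Hup].
  assert (Ht : Rbar_lt tau 1) by (apply (Rbar_le_lt_trans _ 0); [assumption | simpl; lra]).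
  destruct (at_right_elim _ (Hup 1 Ht)) as (e & He & Hlt).
  specialize (Hlt (e / 2) ltac:(lra)). revert Hlt. apply Rbar_le_not_lt.
  apply (Glb_Rbar_correct (fun t => ico tau t /\ Cmod (W t - g t z0) = e / 2)).
  intros t [[Ht0 HtT] _]. exfalso.
  apply (Rbar_lt_not_le _ _ HtT). apply (Rbar_le_trans _ 0); [assumption | exact Ht0].
Qed.

Let X0 := rel_re W (fun t => g t z0).
Let V0 := rel_im (fun t => g t z0).
Let w (s : R) : R := - rho * X0 s / (X0 s ^ 2 + V0 s ^ 2).
Let X (t y : R) := rel_re W (fun s => g s (ginv t (W t, y))).
Let V (t y : R) := rel_im (fun s => g s (ginv t (W t, y))).

Lemma C_minus_RtoC (z : C) (a : R) : (z - RtoC a)%C = (Re z - a, Im z).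
Proof. destruct z as [x y]. unfold Cminus, Cplus, Copp, RtoC; simpl. f_equal; ring. Qed.

Lemma pair_neq_0 (x y : R) : (x, y) <> RtoC 0 -> 0 < x ^ 2 + y ^ 2.
Proof.
  intros H. destruct (Req_dec x 0) as [Hx|Hx]; destruct (Req_dec y 0) as [Hy|Hy]; subst.
  - exfalso. apply H. reflexivity.
  - pose proof (pow2_gt_0 y Hy). lra.
  - pose proof (pow2_gt_0 x Hx). lra.
  - pose proof (pow2_gt_0 y Hy). pose proof (pow2_gt_0 x Hx). lra.
Qed.

Lemma force_solution : loewner_solution W tau z0 (fun t => g t z0).
Proof.
  destruct (sle_chain HD z0 Hz0) as (_ & Hs & _).
  - rewrite (sle_start HD). exact Hz0'.
  - rewrite (sle_force HD) in Hs. exact Hs.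
Qed.

Lemma rel_nz (T : Rbar) z u (t : R) : loewner_solution W T z u -> ico T t ->
  0 < (Re (u t) - W t) ^ 2 + Im (u t) ^ 2.
Proof.
  intros [_ Hu] Ht. destruct (Hu t Ht) as [Hne _]. apply pair_neq_0. rewrite <- C_minus_RtoC.
  intros E. apply Hne. rewrite <- (Cplus_0_r (W t)), <- E. ring.
Qed.

Lemma drive_derive t : ico tau t -> is_derive_on (V := R_NormedModule) (ico tau) W t (w t).
Proof.
  intros Ht. pose proof (sle_drive HD t Ht) as Hd.
  replace (w t) with (Re (rho / (W t - g t z0))%C); [exact Hd|].
  pose proof (rel_nz _ _ _ t force_solution Ht) as Hn.
  unfold w, X0, V0, rel_re, rel_im. rewrite Rmax_right by apply Ht.
  destruct (g t z0) as [a b]. simpl Re in *. simpl Im in *.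
  unfold Cdiv, Cmult, Cinv, Cminus, Cplus, Copp, RtoC, Re; simpl in *.
  field. nra.
Qed.

Lemma clamp_ico (T : Rbar) (s : R) : Rbar_lt 0 T -> Rbar_lt s T -> ico T (Rmax 0 s).
Proof. intros H0 Hs. split; [apply Rmax_l|]. unfold Rmax. destruct (Rle_dec 0 s); assumption. Qed.

Lemma is_derive_on_sub {U : NormedModule R_AbsRing} (T T' : Rbar) (f : R -> U) t v :
  Rbar_le T' T -> ico T' t -> is_derive_on (ico T) f t v -> is_derive_on (ico T') f t v.
Proof.
  intros HT Ht H.
  assert (Hs : forall s, ico T' s -> ico T s)
    by (intros s [h1 h2]; split; [assumption | apply (Rbar_lt_le_trans _ T'); assumption]).
  apply is_derive_on_eps; [assumption|]. intros eps Heps.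
  destruct (proj1 (is_derive_on_eps _ f t v (Hs t Ht)) H eps Heps) as (d & Hd & Hb).
  exists d. split; [assumption|]. intros s Hi. apply Hb, Hs, Hi.
Qed.

Lemma centered_of_solution (T : R) (Tz : Rbar) z u : 0 < T -> Rbar_le T Tz -> Rbar_le Tz tau ->
  loewner_solution W Tz z u -> centered w T (rel_re W u) (rel_im u).
Proof.
  intros HT HTz Htau Hu.
  assert (H0 : Rbar_lt 0 Tz) by (apply (Rbar_lt_le_trans _ T); assumption).
  assert (HW : forall t, ico Tz t -> is_derive_on (V := R_NormedModule) (ico Tz) W t (w t)).
  { intros t Ht. apply (is_derive_on_sub (U := R_NormedModule) tau); [assumption | assumption|]. apply drive_derive.
    destruct Ht as [h1 h2]. split; [assumption | apply (Rbar_lt_le_trans _ Tz); assumption]. }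
  assert (Hd : forall t, ico Tz t ->
    is_derive_on (V := R_NormedModule) (ico Tz) (fun s => Re (u s)) t (Re (2 / (u t - W t))%C) /\
    is_derive_on (V := R_NormedModule) (ico Tz) (fun s => Im (u s)) t (Im (2 / (u t - W t))%C)).
  { intros t Ht. apply is_derive_on_components; [assumption|]. apply (proj2 Hu t Ht). }
  assert (Hlt : forall s : R, s < T -> Rbar_lt s Tz) by (intros s Hs; apply (Rbar_lt_le_trans _ T); assumption).
  constructor.
  - intros s Hs. split.
    + apply (cont_minus (fun s => Re (u (Rmax 0 s))) (fun s => W (Rmax 0 s))).
      * apply (clamp_cont (T := Tz) (f := fun s => Re (u s)) (df := fun t => Re (2 / (u t - W t))%C) H0); [|apply Hlt, Hs].
        intros t Ht. apply (Hd t Ht).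
      * apply (clamp_cont (T := Tz) (f := W) (df := w) H0 HW). apply Hlt, Hs.
    + apply (clamp_cont (T := Tz) (f := fun s => Im (u s)) (df := fun t => Im (2 / (u t - W t))%C) H0); [|apply Hlt, Hs].
      intros t Ht. apply (Hd t Ht).
  - intros s Hs. apply (rel_nz Tz z u (Rmax 0 s) Hu). apply clamp_ico; [assumption | apply Hlt, Hs].
  - intros s Hs. pose proof (rel_nz Tz z u s Hu ltac:(split; [lra | apply Hlt; lra])) as Hn.
    assert (E : (2 / (u s - W s))%C = (2 * (Re (u s) - W s) / ((Re (u s) - W s) ^ 2 + Im (u s) ^ 2),
      - (2 * Im (u s) / ((Re (u s) - W s) ^ 2 + Im (u s) ^ 2)))).
    { rewrite C_minus_RtoC. set (a := Re (u s) - W s) in *. set (b := Im (u s)) in *.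
      unfold Cdiv, Cmult, Cinv, RtoC; simpl. f_equal; field; simpl in *; lra. }
    assert (dX : is_derive (fun s => Re (u (Rmax 0 s))) s (Re (2 / (u s - W s))%C)).
    { apply (clamp_derive (T := Tz) (f := fun s => Re (u s)) (df := fun t => Re (2 / (u t - W t))%C)); [|lra | apply Hlt; lra].
      intros t Ht. apply (Hd t Ht). }
    assert (dV : is_derive (fun s => Im (u (Rmax 0 s))) s (Im (2 / (u s - W s))%C)).
    { apply (clamp_derive (T := Tz) (f := fun s => Im (u s)) (df := fun t => Im (2 / (u t - W t))%C)); [|lra | apply Hlt; lra].
      intros t Ht. apply (Hd t Ht). }
    assert (dW : is_derive (fun s => W (Rmax 0 s)) s (w s))
      by (apply (clamp_derive (T := Tz) (f := W) (df := w) HW); [lra | apply Hlt; lra]).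
    rewrite E in dX, dV. simpl Re in dX. simpl Im in dV.
    unfold rel_re, rel_im. rewrite (Rmax_right 0 s) by lra.
    split; [|exact dV].
    apply (is_derive_minus (fun s => Re (u (Rmax 0 s))) (fun s => W (Rmax 0 s))); assumption.
Qed.

Lemma slits_of_data (T : R) : 0 < T -> Rbar_lt T tau -> exists K d, slits w T K d X0 V0 X V.
Proof.
  intros HT HTt.
  destruct (Rbar_between T tau HTt) as (T2 & HT2 & HT2t).
  assert (Hf : centered w T2 X0 V0).
  { apply (centered_of_solution T2 tau z0); [lra | apply Rbar_lt_le; assumption | apply Rbar_le_refl | apply force_solution]. }
  assert (cX : forall s, s <= T -> continuous X0 s /\ continuous V0 s)
    by (intros s Hs; apply (centered_cont Hf); lra).
  assert (nX : forall s, s <= T -> 0 < X0 s ^ 2 + V0 s ^ 2)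
    by (intros s Hs; apply (centered_nz Hf); lra).
  assert (cw : forall s, s <= T -> continuous w s).
  { intros s Hs. destruct (cX s Hs). pose proof (nX s Hs). unfold w. cts. }
  assert (cn : forall s, s <= T -> continuous (fun s => X0 s ^ 2 + V0 s ^ 2) s)
    by (intros s Hs; destruct (cX s Hs); cts).
  assert (Hid : forall s, Rmax 0 (Rmax 0 s) = Rmax 0 s) by (intros s; apply Rmax_right, Rmax_l).
  assert (eX : forall s, X0 (Rmax 0 s) = X0 s) by (intros s; unfold X0, rel_re; rewrite Hid; reflexivity).
  assert (eV : forall s, V0 (Rmax 0 s) = V0 s) by (intros s; unfold V0, rel_im; rewrite Hid; reflexivity).
  assert (ew : forall s, w (Rmax 0 s) = w s) by (intros s; unfold w; rewrite eX, eV; reflexivity).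
  destruct (clamped_bounded w T ltac:(lra)) as (lo & hi & _ & _ & Bw).
  { intros s Hs. apply (continuous_ext w); [intros x; symmetry; apply ew | apply cw, Hs]. }
  destruct (clamped_bounded (fun s => X0 s ^ 2 + V0 s ^ 2) T ltac:(lra)) as (lo2 & hi2 & Hlo2 & _ & Bn).
  { intros s Hs. apply (continuous_ext (fun s => X0 s ^ 2 + V0 s ^ 2)); [intros x; rewrite eX, eV; reflexivity | apply cn, Hs]. }
  pose (K := Rabs (w lo) + Rabs (w hi) + 1).
  pose (d := sqrt (X0 lo2 ^ 2 + V0 lo2 ^ 2)).
  pose proof (nX lo2 ltac:(lra)) as Hd0. pose proof (sqrt_sum_pos _ _ Hd0) as Hd. fold d in Hd.
  pose proof (Rabs_pos (w lo)). pose proof (Rabs_pos (w hi)).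
  exists K, d. constructor.
  - assumption.
  - unfold K; lra.
  - assumption.
  - intros s Hs. split; [apply cw; lra|]. specialize (Bw s Hs). rewrite ew in Bw.
    apply Rabs_le. pose proof (Rle_abs (w hi)). pose proof (Rle_abs (- w lo)). rewrite Rabs_Ropp in *. unfold K; lra.
  - apply (centered_mono (T := T2)); [lra | assumption].
  - intros s Hs. specialize (Bn s Hs). rewrite eX, eV in Bn. unfold d. rewrite pow2_sqrt by lra. lra.
  - exists (sqrt (X0 hi2 ^ 2 + V0 hi2 ^ 2)). intros s Hs. specialize (Bn s Hs). rewrite eX, eV in Bn.
    apply sqrt_le_1_alt. lra.
  - unfold V0, rel_im. rewrite Rmax_left by lra. rewrite (proj1 force_solution). exact Hz0.
  - intros t y Ht Hy.
    assert (Hit : ico tau t) by (split; [lra | apply (Rbar_le_lt_R t T); [lra | assumption]]).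
    destruct (sle_inverse HD t (W t, y) Hit Hy) as (Hp & Hlife & Hgp).
    set (p := ginv t (W t, y)) in *.
    assert (Hpne : p <> RtoC (W 0)).
    { intros E. unfold upper_half_plane in Hp. rewrite E in Hp. simpl in Hp. lra. }
    destruct (sle_chain HD p (Rlt_le _ _ Hp) Hpne) as (Hle & Hsol & _).
    destruct (Rbar_between t _ Hlife) as (b & Htb & Hb).
    exists (Rmin b T). split; [apply Rmin_r|].
    assert (Hm : t < Rmin b T) by (apply Rmin_glb_lt; lra).
    constructor.
    + apply (centered_of_solution (Rmin b T) (life p) p); [lra | | assumption | exact Hsol].
      apply (Rbar_le_trans _ b); [apply Rmin_l | apply Rbar_lt_le; assumption].
    + lra.
    + intros s Hs. specialize (Bw s ltac:(lra)). rewrite ew in Bw.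
      apply Rabs_le. pose proof (Rle_abs (w hi)). pose proof (Rle_abs (- w lo)). rewrite Rabs_Ropp in *. unfold K; lra.
    + unfold X, rel_re. rewrite Rmax_right by lra. fold p. rewrite Hgp. simpl. ring.
    + unfold V, rel_im. rewrite Rmax_right by lra. fold p. rewrite Hgp. reflexivity.
    + assumption.
    + unfold V, rel_im. rewrite Rmax_left by lra. fold p. rewrite (proj1 Hsol). exact Hp.
Qed.

Lemma trace_limit t : ico tau t ->
  filterlim (fun y => X t y 0) (at_right 0) (locally (Re (gamma t))) /\
  filterlim (fun y => V t y 0) (at_right 0) (locally (Im (gamma t))).
Proof.
  intros Ht. pose proof (sle_trace HD t Ht) as Hl.
  assert (H1 : filterlim (fun z : C => Re z) (locally (gamma t)) (locally (Re (gamma t))))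
    by (apply (filterlim_comp _ _ _ (fun z : C => z) fst _ (locally (gamma t))); [apply filterlim_id | apply continuous_fst]).
  assert (H2 : filterlim (fun z : C => Im z) (locally (gamma t)) (locally (Im (gamma t))))
    by (apply (filterlim_comp _ _ _ (fun z : C => z) snd _ (locally (gamma t))); [apply filterlim_id | apply continuous_snd]).
  assert (HE : forall y, 0 < y -> g 0 (ginv t (W t, y)) = ginv t (W t, y)).
  { intros y Hy. destruct (sle_inverse HD t (W t, y) Ht Hy) as (Hp & _ & _).
    set (p := ginv t (W t, y)) in *.
    assert (Hpne : p <> RtoC (W 0)).
    { intros E. unfold upper_half_plane in Hp. rewrite E in Hp. simpl in Hp. lra. }
    destruct (sle_chain HD p (Rlt_le _ _ Hp) Hpne) as (_ & Hsol & _). apply (proj1 Hsol). }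
  split.
  - apply (filterlim_ext_loc (fun y => Re (ginv t (W t, y)))); [|exact (filterlim_comp _ _ _ _ _ _ _ _ Hl H1)].
    apply (at_right_intro _ 1); [lra|]. intros y Hy.
    unfold X, rel_re. rewrite Rmax_left, HE, (sle_start HD) by lra. ring.
  - apply (filterlim_ext_loc (fun y => Im (ginv t (W t, y)))); [|exact (filterlim_comp _ _ _ _ _ _ _ _ Hl H2)].
    apply (at_right_intro _ 1); [lra|]. intros y Hy.
    unfold V, rel_im. rewrite Rmax_left, HE by lra. reflexivity.
Qed.
End Data.

(** * The curve in the parameter [sqrt t] *)

Lemma continuous_pos (x : R) : continuous (fun x => Rmax 0 x) x.
Proof.
  assert (H := clamped_lipschitz_continuous (fun x => x) 1 (Rabs x + 1)).
  pose proof (Rabs_pos x). pose proof (Rle_abs x). apply H; [lra | | lra].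
  intros t1 t2 h1 h2 h3. apply Rabs_le; lra.
Qed.

Lemma continuous_comp_sqr (F : R -> R) (x : R) :
  continuous (fun t => F (Rmax 0 t)) (Rmax 0 x ^ 2) -> continuous (fun x => F (Rmax 0 x ^ 2)) x.
Proof.
  intros H. apply (continuous_ext (fun x => F (Rmax 0 (Rmax 0 x ^ 2)))).
  { intros y. rewrite (Rmax_right 0 (Rmax 0 y ^ 2)) by apply pow2_ge_0. reflexivity. }
  apply (continuous_comp (fun x => Rmax 0 x ^ 2) (fun t => F (Rmax 0 t))); [|exact H].
  apply cont_pow, continuous_pos.
Qed.

Lemma arg_H_scale (a b x : R) : 0 < x -> 0 < a ^ 2 + b ^ 2 -> arg_H (a / x, b / x) = arg_H (a, b).
Proof.
  intros Hx Hp. unfold arg_H, Cmod, Re; simpl fst; simpl snd. f_equal.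
  pose proof (sqrt_sum_pos _ _ Hp).
  replace ((a / x) ^ 2 + (b / x) ^ 2) with ((a ^ 2 + b ^ 2) * (/ x) ^ 2) by (field; lra).
  rewrite sqrt_mult by (try apply pow2_ge_0; lra).
  rewrite sqrt_pow2 by (left; apply Rinv_0_lt_compat; lra). field. lra.
Qed.

Lemma continuous_eventually_eq (f h : R -> R) (x d : R) : 0 < d ->
  (forall y, Rabs (y - x) < d -> f y = h y) -> continuous f x -> continuous h x.
Proof.
  intros Hd E. apply (continuous_ext_loc h f x). exists (mkposreal d Hd). intros y Hy. apply E, Hy.
Qed.

Section Curve.
Context {rho : R} {z0 : C} {tau : Rbar} {gamma : R -> C} {W : R -> R} {g : R -> C -> C}
  {life : C -> Rbar} {ginv : R -> C -> C}
  (Hz0 : closed_half_plane z0) (Hz0' : z0 <> RtoC 0)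
  (HD : sle0_rho_data rho z0 tau gamma W g life ginv).

Let X0 := rel_re W (fun t => g t z0).
Let V0 := rel_im (fun t => g t z0).
Let w (s : R) : R := - rho * X0 s / (X0 s ^ 2 + V0 s ^ 2).
Let X (t y : R) := rel_re W (fun s => g s (ginv t (W t, y))).
Let V (t y : R) := rel_im (fun s => g s (ginv t (W t, y))).
Let G1 (t : R) := Re (gamma t).
Let G2 (t : R) := Im (gamma t).
Let B := tip_swing X0 V0 X V.

Lemma slits_beyond (t : R) : 0 <= t -> Rbar_lt t tau -> exists T K d, t < T /\ slits w T K d X0 V0 X V /\
  (forall s, s < T -> w s = - rho * X0 s / (X0 s ^ 2 + V0 s ^ 2)) /\
  (forall t, 0 <= t < T -> filterlim (fun y => X t y 0) (at_right 0) (locally (G1 t))) /\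
  (forall t, 0 <= t < T -> filterlim (fun y => V t y 0) (at_right 0) (locally (G2 t))).
Proof.
  intros H0 Ht. destruct (Rbar_between t tau Ht) as (T & HT & HTt).
  destruct (slits_of_data Hz0 Hz0' HD T ltac:(lra) HTt) as (K & d & S).
  exists T, K, d. split; [assumption | split; [exact S | split; [reflexivity|]]].
  split; intros s Hs; apply (trace_limit HD s); (split; [lra | apply (Rbar_le_lt_R s T); [lra | assumption]]).
Qed.

(* At time [x^2] the tip is [x (al1 + i al2)]. Near [0] the curve is like [2 i sqrt t], so
   its derivative explodes; in the parameter [x = sqrt t] it is regular up to [0],
   where the continuous extension of [al1 + i al2] has the value [2 i]. *)
Let al1 (x : R) : R := if Rle_dec x 0 then 0 else G1 (x ^ 2) / x.
Let al2 (x : R) : R := if Rle_dec x 0 then 2 else G2 (x ^ 2) / x.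
Let psi (x : R) : R := PI - arg_H (al1 x, al2 x) + tip_angle rho X0 V0 X V G1 G2 (Rmax 0 x ^ 2).
Let m (x : R) : R := 2 * (2 / sqrt (al1 x ^ 2 + al2 x ^ 2)) * tip_scale rho X0 V0 G1 G2 (Rmax 0 x ^ 2).
Let c1 (x : R) : R := G1 (Rmax 0 x ^ 2).
Let c2 (x : R) : R := G2 (Rmax 0 x ^ 2).

Lemma pos_sqr_lt (x : R) : Rbar_lt x (sqrt_Rbar tau) -> 0 <= Rmax 0 x ^ 2 /\ Rbar_lt (Rmax 0 x ^ 2) tau.
Proof.
  intros Hx. split; [apply pow2_ge_0|]. apply sqrt_Rbar_lt; [apply Rmax_l|].
  unfold Rmax. destruct (Rle_dec 0 x); [assumption|].
  rewrite <- sqrt_0. apply (ico_sqrt tau 0). split; [lra | apply (tau_pos HD)].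
Qed.

Lemma al_pos (x : R) : Rbar_lt x (sqrt_Rbar tau) -> 0 < al2 x.
Proof.
  intros Hx. unfold al2. destruct (Rle_dec x 0); [lra|].
  destruct (pos_sqr_lt x Hx) as [_ Ht]. rewrite Rmax_right in Ht by lra.
  destruct (slits_beyond (x ^ 2) (pow2_ge_0 x) Ht) as (T & K & d & HT & S & _ & L1 & L2).
  apply Rdiv_lt_0_compat; [|lra]. apply (tip_upper S L1 L2). nra.
Qed.

Lemma al_cont (x : R) : Rbar_lt x (sqrt_Rbar tau) -> continuous al1 x /\ continuous al2 x.
Proof.
  intros Hx. destruct (pos_sqr_lt x Hx) as [Ht0 Ht].
  destruct (slits_beyond _ Ht0 Ht) as (T & K & d & HT & S & _ & L1 & L2).
  pose proof (slits_K S) as HK.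
  destruct (Rtotal_order x 0) as [Hx0 | [-> | Hx0]].
  - split.
    + apply (continuous_eventually_eq (fun _ => 0) _ x (- x)); [lra | | apply continuous_const].
      intros y Hy. apply Rabs_def2 in Hy. unfold al1. destruct (Rle_dec y 0); [reflexivity | lra].
    + apply (continuous_eventually_eq (fun _ => 2) _ x (- x)); [lra | | apply continuous_const].
      intros y Hy. apply Rabs_def2 in Hy. unfold al2. destruct (Rle_dec y 0); [reflexivity | lra].
  - assert (HT0 := slits_T S).
    assert (Hb : forall y, Rabs y < Rmin 1 T -> Rabs (al1 y) <= K * Rabs y /\ Rabs (al2 y - 2) <= K ^ 2 * Rabs y).
    { intros y Hy. pose proof (Rmin_l 1 T). pose proof (Rmin_r 1 T). pose proof (Rabs_pos y).
      assert (HKy : 0 <= K ^ 2 * Rabs y) by (apply Rmult_le_pos; [apply pow2_ge_0 | assumption]).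
      unfold al1, al2. destruct (Rle_dec y 0) as [Hle|Hle].
      - rewrite Rabs_R0, Rminus_diag, Rabs_R0. split; [nra | assumption].
      - rewrite Rabs_pos_eq in Hy by lra. rewrite (Rabs_pos_eq y) in * by lra.
        destruct (tip_bounds S L1 L2 (y ^ 2) ltac:(nra)) as (B1 & [B2 B3] & B4 & _).
        split.
        + unfold Rdiv. rewrite Rabs_mult, Rabs_inv, (Rabs_pos_eq y) by lra.
          apply (Rmult_le_reg_r y); [lra|]. rewrite Rmult_assoc, Rinv_l by lra. lra.
        + set (q := G2 (y ^ 2) / y).
          assert (Eq : G2 (y ^ 2) = q * y) by (unfold q; field; lra).
          assert (Hq : 0 <= q) by (apply Rdiv_le_0_compat; lra).
          rewrite Eq in B2, B3.
          assert (Q1 : q ^ 2 <= 4) by (apply (Rmult_le_reg_r (y ^ 2)); nra).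
          assert (Q2 : 4 - K ^ 2 * y ^ 2 <= q ^ 2).
          { apply (Rmult_le_reg_r (y ^ 2)); [nra|]. replace ((y ^ 2) ^ 2) with (y ^ 2 * y ^ 2) in B2 by ring. lra. }
          assert (Q3 : q <= 2) by nra.
          rewrite Rabs_left1 by lra.
          assert (K ^ 2 * y ^ 2 <= K ^ 2 * y) by (apply Rmult_le_compat_l; [apply pow2_ge_0 | nra]). nra. }
    assert (Hm1 : 0 < Rmin 1 T) by (apply Rmin_pos; lra).
    split.
    + apply (continuous_of_linear_bound al1 0 K (Rmin 1 T) Hm1). intros y. rewrite Rminus_0_r. intros Hy.
      replace (al1 0) with 0 by (unfold al1; destruct (Rle_dec 0 0); [reflexivity | lra]).
      rewrite Rminus_0_r. apply Hb, Hy.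
    + apply (continuous_of_linear_bound al2 0 (K ^ 2) (Rmin 1 T) Hm1). intros y. rewrite Rminus_0_r. intros Hy.
      replace (al2 0) with 2 by (unfold al2; destruct (Rle_dec 0 0); [reflexivity | lra]).
      apply Hb, Hy.
  - destruct (tip_cont S L1 L2 (Rmax 0 x ^ 2) HT) as [k1 k2].
    apply continuous_comp_sqr in k1, k2. pose proof (continuous_id x) as kid.
    split.
    + apply (continuous_eventually_eq (fun x => G1 (Rmax 0 x ^ 2) / x) _ x x); [lra | | cts].
      intros y Hy. apply Rabs_def2 in Hy. unfold al1. destruct (Rle_dec y 0); [lra|]. rewrite Rmax_right by lra. reflexivity.
    + apply (continuous_eventually_eq (fun x => G2 (Rmax 0 x ^ 2) / x) _ x x); [lra | | cts].
      intros y Hy. apply Rabs_def2 in Hy. unfold al2. destruct (Rle_dec y 0); [lra|]. rewrite Rmax_right by lra. reflexivity.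
Qed.

Lemma tip_facts (t : R) : 0 <= t -> Rbar_lt t tau ->
  (continuous (fun t => G1 (Rmax 0 t)) t /\ continuous (fun t => G2 (Rmax 0 t)) t) /\
  continuous (fun t => B (Rmax 0 t)) t /\
  (continuous X0 t /\ continuous V0 t) /\
  0 < X0 t ^ 2 + V0 t ^ 2 /\ 0 <= V0 t /\ 0 <= G2 t /\
  0 < (G1 t - X0 0) ^ 2 + (G2 t - V0 0) ^ 2 /\ 0 < (G1 t - X0 0) ^ 2 + (G2 t + V0 0) ^ 2.
Proof.
  intros H0 Ht. destruct (slits_beyond t H0 Ht) as (T & K & d & HT & S & _ & L1 & L2).
  pose proof (slits_force S) as Hf.
  split; [apply (tip_cont S L1 L2 t HT) | split; [apply (tip_swing_cont S t HT)|]].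
  split; [apply (centered_cont Hf t HT) | split; [apply (centered_nz Hf t HT)|]].
  split; [apply (force_V_nonneg S); lra | split; [apply (tip_bounds S L1 L2); lra|]].
  split; [apply (tip_force_gap S L1 L2); lra | apply (tip_force_gap_conj S L1 L2); lra].
Qed.

Lemma force_clamp (t : R) : X0 (Rmax 0 t) = X0 t /\ V0 (Rmax 0 t) = V0 t.
Proof.
  unfold X0, V0, rel_re, rel_im. rewrite (Rmax_right 0 (Rmax 0 t)) by apply Rmax_l. split; reflexivity.
Qed.

Lemma force_cont_sqr (x : R) : Rbar_lt x (sqrt_Rbar tau) ->
  continuous (fun x => X0 (Rmax 0 x ^ 2)) x /\ continuous (fun x => V0 (Rmax 0 x ^ 2)) x.
Proof.
  intros Hx. destruct (pos_sqr_lt x Hx) as [H0 Ht].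
  destruct (tip_facts _ H0 Ht) as (_ & _ & [k1 k2] & _).
  split; apply continuous_comp_sqr.
  - apply (continuous_ext X0); [intros y; symmetry; apply force_clamp | exact k1].
  - apply (continuous_ext V0); [intros y; symmetry; apply force_clamp | exact k2].
Qed.

(** The derivative [2 x] of [x^2] cancels the modulus [x |al1 + i al2|] of the tip in
    the denominator of its speed, up to a factor which is continuous at [0]. *)
Lemma curve_steered : steered (sqrt_Rbar tau) m psi c1 c2.
Proof.
  constructor.
  - rewrite <- sqrt_0. apply (ico_sqrt tau 0). split; [lra | apply (tau_pos HD)].
  - intros x Hx. destruct (pos_sqr_lt x Hx) as [H0 Ht].
    destruct (tip_facts _ H0 Ht) as ([k1 k2] & kB & _ & n0 & _ & _ & n1 & n2).
    destruct (force_cont_sqr x Hx) as [kX kV].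
    apply continuous_comp_sqr in k1, k2. apply (continuous_comp_sqr B) in kB.
    destruct (al_cont x Hx) as [ka1 ka2]. pose proof (al_pos x Hx) as Ha.
    assert (na : 0 < al1 x ^ 2 + al2 x ^ 2) by (pose proof (pow2_ge_0 (al1 x)); nra).
    pose proof (sqrt_sum_pos _ _ na). pose proof (sqrt_sum_pos _ _ n0) as q0.
    pose proof (sqrt_sum_pos _ _ n1) as q1. pose proof (sqrt_sum_pos _ _ n2) as q2.
    assert (cln : forall f : R -> R, continuous f x -> 0 < f x -> continuous (fun x => ln (f x)) x).
    { intros f Hf Hp. apply (continuous_comp f ln x Hf). apply (continuous_of_derive ln _ (/ f x)), is_derive_ln, Hp. }
    split; [|split; [|split; assumption]].
    + assert (k : continuous (fun x => tip_scale rho X0 V0 G1 G2 (Rmax 0 x ^ 2)) x).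
      { unfold tip_scale.
        assert (e0 : continuous (fun x => ln (sqrt (X0 (Rmax 0 x ^ 2) ^ 2 + V0 (Rmax 0 x ^ 2) ^ 2))) x)
          by (apply cln; [cts | assumption]).
        assert (e1 : continuous (fun x => ln (sqrt ((G1 (Rmax 0 x ^ 2) - X0 0) ^ 2 + (G2 (Rmax 0 x ^ 2) - V0 0) ^ 2))) x)
          by (apply cln; [cts | assumption]).
        assert (e2 : continuous (fun x => ln (sqrt ((G1 (Rmax 0 x ^ 2) - X0 0) ^ 2 + (G2 (Rmax 0 x ^ 2) + V0 0) ^ 2))) x)
          by (apply cln; [cts | assumption]).
        cts. }
      unfold m. cts.
    + pose proof (continuous_arg_H al1 al2 x ka1 ka2 na) as e0.
      assert (e1 : continuous (fun x => arg_H (- X0 (Rmax 0 x ^ 2), V0 (Rmax 0 x ^ 2))) x)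
        by (apply (continuous_arg_H (fun x => - X0 (Rmax 0 x ^ 2)) (fun x => V0 (Rmax 0 x ^ 2))); [cts | assumption | nra]).
      assert (e2 : continuous (fun x => arg_H (G1 (Rmax 0 x ^ 2) - X0 0, G2 (Rmax 0 x ^ 2) + V0 0)) x)
        by (apply (continuous_arg_H (fun x => G1 (Rmax 0 x ^ 2) - X0 0) (fun x => G2 (Rmax 0 x ^ 2) + V0 0)); [cts | cts | assumption]).
      unfold psi, tip_angle. fold B. cts.
  - intros x _ Hx. pose proof (al_pos x Hx) as Ha.
    assert (na : 0 < al1 x ^ 2 + al2 x ^ 2) by (pose proof (pow2_ge_0 (al1 x)); nra).
    unfold m, tip_scale. apply Rmult_lt_0_compat; [|apply exp_pos].
    apply Rmult_lt_0_compat; [lra|]. apply Rdiv_lt_0_compat; [lra | apply sqrt_sum_pos, na].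
  - intros x Hx0 Hx. destruct (pos_sqr_lt x Hx) as [H0 Ht].
    destruct (slits_beyond _ H0 Ht) as (T & K & d & HT & S & Hw & L1 & L2).
    rewrite Rmax_right in HT, Ht by lra.
    assert (Hx2 : 0 < x ^ 2) by nra.
    destruct (tip_derive S Hw L1 L2 (x ^ 2) ltac:(lra)) as [d1 d2].
    pose proof (tip_upper S L1 L2 (x ^ 2) ltac:(lra)) as HG.
    assert (nG : 0 < G1 (x ^ 2) ^ 2 + G2 (x ^ 2) ^ 2) by (pose proof (pow2_ge_0 (G1 (x ^ 2))); nra).
    assert (Ea1 : al1 x = G1 (x ^ 2) / x) by (unfold al1; destruct (Rle_dec x 0); [lra | reflexivity]).
    assert (Ea2 : al2 x = G2 (x ^ 2) / x) by (unfold al2; destruct (Rle_dec x 0); [lra | reflexivity]).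
    assert (Em : m x = 2 * x * (2 * tip_scale rho X0 V0 G1 G2 (x ^ 2) / sqrt (G1 (x ^ 2) ^ 2 + G2 (x ^ 2) ^ 2))).
    { unfold m. rewrite Ea1, Ea2, Rmax_right by lra. pose proof (sqrt_sum_pos _ _ nG).
      replace ((G1 (x ^ 2) / x) ^ 2 + (G2 (x ^ 2) / x) ^ 2) with ((G1 (x ^ 2) ^ 2 + G2 (x ^ 2) ^ 2) * (/ x) ^ 2) by (field; lra).
      rewrite sqrt_mult by (try apply pow2_ge_0; lra).
      rewrite sqrt_pow2 by (left; apply Rinv_0_lt_compat; lra). field. lra. }
    assert (Ep : psi x = PI - arg_H (G1 (x ^ 2), G2 (x ^ 2)) + tip_angle rho X0 V0 X V G1 G2 (x ^ 2)).
    { unfold psi. rewrite Ea1, Ea2, Rmax_right by lra. rewrite arg_H_scale by assumption. reflexivity. }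
    cbv zeta in d1, d2. rewrite <- Ep in d1, d2. 
    set (m0 := 2 * tip_scale rho X0 V0 G1 G2 (x ^ 2) / sqrt (G1 (x ^ 2) ^ 2 + G2 (x ^ 2) ^ 2)) in *.
    assert (Hch : forall (G : R -> R) l, is_derive G (x ^ 2) l -> is_derive (fun x => G (Rmax 0 x ^ 2)) x (2 * x * l)).
    { intros G l HG'. apply (is_derive_ext_loc (fun x => G (x ^ 2))).
      { exists (mkposreal x Hx0). intros y Hy. change (Rabs (y - x) < x) in Hy. apply Rabs_def2 in Hy.
        rewrite Rmax_right by lra. reflexivity. }
      evar_last; [apply (is_derive_comp G (fun x => x ^ 2) x l (2 * x)); [exact HG'|]|reflexivity].
      auto_derive; [exact I | ring]. }
    split.
    + evar_last; [apply (Hch G1 _ d1)|]. rewrite Em. ring.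
    + evar_last; [apply (Hch G2 _ d2)|]. rewrite Em. ring.
Qed.

Lemma gamma_sqrt t : ico tau t -> gamma t = (c1 (sqrt t), c2 (sqrt t)).
Proof.
  intros [H0 _]. unfold c1, c2, G1, G2. rewrite Rmax_right by apply sqrt_pos.
  rewrite pow2_sqrt by assumption. destruct (gamma t) as [a b]. reflexivity.
Qed.

Lemma force_start : X0 0 = Re z0 /\ V0 0 = Im z0.
Proof.
  unfold X0, V0, rel_re, rel_im. rewrite Rmax_left by lra.
  rewrite (proj1 (force_solution Hz0 Hz0' HD)), (sle_start HD). split; [ring | reflexivity].
Qed.

Lemma tip_start : G1 0 = 0 /\ G2 0 = 0 /\ B 0 = 0.
Proof.
  destruct (slits_beyond 0 (Rle_refl 0) (tau_pos HD)) as (T & K & d & HT & S & _ & L1 & L2).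
  destruct (tip_0 S L1 L2). pose proof (tip_swing_0 S). auto.
Qed.

Lemma psi_eq (x : R) : 0 < x -> Rbar_lt x (sqrt_Rbar tau) ->
  0 < G2 (x ^ 2) /\
  psi x = PI - arg_H (G1 (x ^ 2), G2 (x ^ 2)) + tip_angle rho X0 V0 X V G1 G2 (x ^ 2).
Proof.
  intros Hx0 Hx. destruct (pos_sqr_lt x Hx) as [H0 Ht].
  destruct (slits_beyond _ H0 Ht) as (T & K & d & HT & S & Hw & L1 & L2).
  rewrite Rmax_right in HT by lra. assert (Hx2 : 0 < x ^ 2) by nra.
  pose proof (tip_upper S L1 L2 (x ^ 2) ltac:(lra)) as HG. split; [exact HG|].
  unfold psi, al1, al2. destruct (Rle_dec x 0); [lra|]. rewrite Rmax_right by lra.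
  rewrite arg_H_scale; [reflexivity | assumption|]. pose proof (pow2_ge_0 (G1 (x ^ 2))). nra.
Qed.

(** * Force point on the boundary *)

Lemma boundary_V0 t : Im z0 = 0 -> 0 <= t -> Rbar_lt t tau -> V0 t = 0.
Proof.
  intros Hz H0 Ht. destruct (slits_beyond t H0 Ht) as (T & K & d & HT & S & _).
  destruct (centered_V_scale t (slits_force S) ltac:(lra)) as (c & _ & ->).
  rewrite (proj2 force_start), Hz. ring.
Qed.

Lemma arg_H_real (a : R) : a <> 0 -> arg_H (a, 0) = if Rlt_dec 0 a then 0 else PI.
Proof.
  intros Ha. unfold arg_H, Re; simpl fst. rewrite Cmod_pair.
  replace (a ^ 2 + 0 ^ 2) with (Rsqr a) by (unfold Rsqr; ring). rewrite sqrt_Rsqr_abs.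
  destruct (Rlt_dec 0 a).
  - rewrite Rabs_pos_eq by lra. replace (a / a) with 1 by (field; lra). apply acos_1.
  - rewrite Rabs_left by lra. replace (a / - a) with (-1) by (field; lra).
    replace (-1) with (- (1)) by ring. rewrite acos_opp, acos_1. ring.
Qed.

(** The force point cannot change sides, since it does not meet the driving point. *)
Lemma boundary_side t : Im z0 = 0 -> 0 <= t -> Rbar_lt t tau ->
  arg_H (- X0 t, V0 t) = if Rlt_dec 0 (Re z0) then PI else 0.
Proof.
  intros Hz H0 Ht.
  assert (Hlt : forall s, s <= t -> Rbar_lt s tau) by (intros s Hs; apply (Rbar_le_lt_R s t); assumption).
  assert (Hnz : forall s, 0 <= s <= t -> X0 s <> 0).
  { intros s Hs E. destruct (tip_facts s ltac:(lra) (Hlt s ltac:(lra))) as (_ & _ & _ & n & _).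
    rewrite (boundary_V0 s Hz ltac:(lra) (Hlt s ltac:(lra))), E in n. lra. }
  assert (Hc : forall s, 0 <= s <= t -> continuity_pt X0 s).
  { intros s Hs. apply continuity_pt_filterlim. apply (tip_facts s ltac:(lra) (Hlt s ltac:(lra))). }
  rewrite (boundary_V0 t Hz H0 Ht), arg_H_real by (pose proof (Hnz t ltac:(lra)); lra).
  rewrite <- (proj1 force_start). pose proof (Hnz 0 ltac:(lra)). pose proof (Hnz t ltac:(lra)).
  destruct (Req_dec t 0) as [->|Ht0].
  { destruct (Rlt_dec 0 (- X0 0)), (Rlt_dec 0 (X0 0)); try reflexivity; lra. }
  destruct (Rlt_dec 0 (- X0 t)), (Rlt_dec 0 (X0 0)); try reflexivity.
  - exfalso. destruct (IVT_interv (fun s => - X0 s) 0 t) as (z & Hzt & E); try lra.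
    + intros s Hs. apply continuity_pt_opp, Hc, Hs.
    + apply (Hnz z Hzt). lra.
  - exfalso. destruct (IVT_interv X0 0 t) as (z & Hzt & E); try lra.
    + exact Hc.
    + apply (Hnz z Hzt). lra.
Qed.

Lemma tip_polar t : 0 <= t -> Rbar_lt t tau ->
  - X0 t * (G1 t - X0 0) - V0 t * (G2 t - V0 0) =
    sqrt (X0 t ^ 2 + V0 t ^ 2) * sqrt ((G1 t - X0 0) ^ 2 + (G2 t - V0 0) ^ 2) * cos (B t) /\
  X0 t * (G2 t - V0 0) - V0 t * (G1 t - X0 0) =
    sqrt (X0 t ^ 2 + V0 t ^ 2) * sqrt ((G1 t - X0 0) ^ 2 + (G2 t - V0 0) ^ 2) * sin (B t).
Proof.
  intros H0 Ht. destruct (slits_beyond t H0 Ht) as (T & K & d & HT & S & _ & L1 & L2).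
  apply (tip_swing_polar S L1 L2 t ltac:(lra)).
Qed.

(** When the force point is real the tip stays in a half-plane with the force point
    on its boundary, so that [arg_H] is a continuous argument around it. *)
Lemma boundary_swing t : Im z0 = 0 -> 0 <= t -> Rbar_lt t tau ->
  B t = arg_H (- X0 t, V0 t) - arg_H (G1 t - X0 0, G2 t).
Proof.
  intros Hz H0 Ht.
  assert (Hlt : forall s, s <= t -> Rbar_lt s tau) by (intros s Hs; apply (Rbar_le_lt_R s t); assumption).
  assert (HV00 : V0 0 = 0) by (rewrite (proj2 force_start); exact Hz).
  pose proof (angle_unique (fun s => B (Rmax 0 s))
    (fun s => arg_H (- X0 s, V0 s) - arg_H (G1 (Rmax 0 s) - X0 0, G2 (Rmax 0 s))) t) as U.
  cbv beta in U. rewrite <- (Rmax_right 0 t H0) at 1 4 5. apply U; [| | lra].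
  - intros s Hs. destruct (tip_facts s ltac:(lra) (Hlt s ltac:(lra)))
      as ([k1 k2] & kB & [kX kV] & n0 & nV & nG & n1 & _).
    rewrite HV00, Rminus_0_r in n1.
    split; [exact kB | split].
    { assert (e1 : continuous (fun s => arg_H (- X0 s, V0 s)) s)
        by (apply (continuous_arg_H (fun s => - X0 s) V0); [cts | assumption | nra]).
      assert (e2 : continuous (fun s => arg_H (G1 (Rmax 0 s) - X0 0, G2 (Rmax 0 s))) s).
      { apply (continuous_arg_H (fun s => G1 (Rmax 0 s) - X0 0) (fun s => G2 (Rmax 0 s))); [cts | assumption |].
        rewrite Rmax_right by lra. assumption. }
      cts. }
    rewrite Rmax_right by lra.
    destruct (tip_polar s ltac:(lra) (Hlt s ltac:(lra))) as [P1 P2].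
    rewrite HV00, Rminus_0_r in P1, P2.
    rewrite (boundary_V0 s Hz ltac:(lra) (Hlt s ltac:(lra))) in *.
    assert (n0' : 0 < (- X0 s) ^ 2 + 0 ^ 2) by nra.
    destruct (arg_H_polar (- X0 s) 0 n0' (Rle_refl 0)) as [Q1 Q2].
    destruct (arg_H_polar (G1 s - X0 0) (G2 s) n1 nG) as [Q3 Q4].
    replace ((- X0 s) ^ 2 + 0 ^ 2) with (X0 s ^ 2 + 0 ^ 2) in Q1, Q2, n0' by ring.
    pose proof (sqrt_sum_pos _ _ n0') as r0. pose proof (sqrt_sum_pos _ _ n1) as r1.
    set (a := arg_H (- X0 s, 0)) in *. set (b := arg_H (G1 s - X0 0, G2 s)) in *.
    set (R0 := sqrt (X0 s ^ 2 + 0 ^ 2)) in *. set (R1 := sqrt ((G1 s - X0 0) ^ 2 + G2 s ^ 2)) in *.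
    assert (Hr : 0 < R0 * R1) by (apply Rmult_lt_0_compat; assumption).
    rewrite cos_minus, sin_minus.
    assert (Hsa : sin a = 0) by (apply (Rmult_eq_reg_l R0); lra).
    split; apply (Rmult_eq_reg_l (R0 * R1)); try lra.
    + rewrite <- P1, Q1, Q3 at 1. rewrite Hsa. ring.
    + rewrite <- P2. replace (X0 s) with (- (- X0 s)) by ring. rewrite Q1, Q4 at 1. rewrite Hsa. ring.
  - rewrite Rmax_left by lra. destruct tip_start as (-> & -> & ->). rewrite HV00, Rminus_0_l. ring.
Qed.

Lemma psi_boundary (x x0 : R) : z0 = RtoC x0 -> 0 < x -> Rbar_lt x (sqrt_Rbar tau) ->
  psi x = field_boundary rho x0 (gamma (x ^ 2)).
Proof.
  intros Ez Hx0 Hx. destruct (psi_eq x Hx0 Hx) as [_ ->].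
  destruct (pos_sqr_lt x Hx) as [H0 Ht]. rewrite Rmax_right in H0, Ht by lra.
  assert (Hz : Im z0 = 0) by (rewrite Ez; reflexivity).
  unfold tip_angle. fold B. rewrite (boundary_swing _ Hz H0 Ht), (boundary_side _ Hz H0 Ht).
  rewrite (proj1 force_start), (proj2 force_start), Hz, Rplus_0_r.
  unfold field_boundary. rewrite C_minus_RtoC.
  replace (Re z0) with x0 by (rewrite Ez; reflexivity).
  change (Re (gamma (x ^ 2))) with (G1 (x ^ 2)). change (Im (gamma (x ^ 2))) with (G2 (x ^ 2)).
  assert (Eg : gamma (x ^ 2) = (G1 (x ^ 2), G2 (x ^ 2))) by (unfold G1, G2; destruct (gamma (x ^ 2)); reflexivity).
  rewrite Eg. destruct (Rlt_dec 0 x0); field.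
Qed.
(** * Force point in the half-plane *)

(* Argument of the tip around the force point, read off from the swing. *)
Let A (x : R) : R := arg_H (X0 (Rmax 0 x ^ 2), V0 (Rmax 0 x ^ 2)) - PI - B (Rmax 0 x ^ 2).
Let D (x : R) : R := sqrt ((G1 (Rmax 0 x ^ 2) - X0 0) ^ 2 + (G2 (Rmax 0 x ^ 2) - V0 0) ^ 2).

Lemma lift_cont (x : R) : Rbar_lt x (sqrt_Rbar tau) -> continuous A x /\ continuous D x.
Proof.
  intros Hx. destruct (pos_sqr_lt x Hx) as [H0 Ht].
  destruct (tip_facts _ H0 Ht) as ([k1 k2] & kB & _ & n0 & _).
  destruct (force_cont_sqr x Hx) as [kX kV].
  apply continuous_comp_sqr in k1, k2. apply (continuous_comp_sqr B) in kB.
  assert (e : continuous (fun x => arg_H (X0 (Rmax 0 x ^ 2), V0 (Rmax 0 x ^ 2))) x)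
    by (apply (continuous_arg_H (fun x => X0 (Rmax 0 x ^ 2)) (fun x => V0 (Rmax 0 x ^ 2))); assumption).
  split; [unfold A | unfold D]; cts.
Qed.

Lemma lift_polar (x : R) : Rbar_lt x (sqrt_Rbar tau) -> 0 < D x /\
  c1 x - Re z0 = D x * cos (A x) /\ c2 x - Im z0 = D x * sin (A x).
Proof.
  intros Hx. destruct (pos_sqr_lt x Hx) as [H0 Ht].
  rewrite <- (proj1 force_start), <- (proj2 force_start).
  unfold c1, c2, A, D. set (t := Rmax 0 x ^ 2) in *.
  destruct (tip_facts _ H0 Ht) as (_ & _ & _ & n0 & nV & _ & n1 & _).
  destruct (tip_polar _ H0 Ht) as [P1 P2].
  destruct (arg_H_polar (X0 t) (V0 t) n0 nV) as [Q1 Q2].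
  pose proof (sqrt_sum_pos _ _ n0) as r0. pose proof (sqrt_sum_pos _ _ n1) as r1.
  split; [exact r1|].
  set (a := arg_H (X0 t, V0 t)) in *. set (R0 := sqrt (X0 t ^ 2 + V0 t ^ 2)) in *.
  set (R1 := sqrt ((G1 t - X0 0) ^ 2 + (G2 t - V0 0) ^ 2)) in *.
  set (p := G1 t - X0 0) in *. set (q := G2 t - V0 0) in *.
  rewrite Q1, Q2 in P1, P2.
  assert (E1 : R1 * cos (B t) = - cos a * p - sin a * q) by (apply (Rmult_eq_reg_l R0); lra).
  assert (E2 : R1 * sin (B t) = cos a * q - sin a * p) by (apply (Rmult_eq_reg_l R0); lra).
  pose proof (sin2_cos2 a) as Hsc. unfold Rsqr in Hsc.
  replace (a - PI - B t) with (a - B t - PI) by ring.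
  rewrite !sin_minus, !cos_minus, cos_PI, sin_PI. split.
  - transitivity (- (cos a * (R1 * cos (B t)) + sin a * (R1 * sin (B t)))); [|ring].
    rewrite E1, E2. transitivity (p * (sin a * sin a + cos a * cos a)); [rewrite Hsc|]; ring.
  - transitivity (cos a * (R1 * sin (B t)) - sin a * (R1 * cos (B t))); [|ring].
    rewrite E1, E2. transitivity (q * (sin a * sin a + cos a * cos a)); [rewrite Hsc|]; ring.
Qed.

(** The arguments of [z_t - W_t] and [W_t - conj z_t] add up to [PI], which removes the
    dependence of the field on time. *)
Lemma psi_interior (x : R) (p : R * R) : 0 < x -> Rbar_lt x (sqrt_Rbar tau) ->
  log_proj z0 p = gamma (x ^ 2) -> snd p = A x -> psi x = field_interior rho z0 p.
Proof.
  intros Hx0 Hx Ep Es. destruct (psi_eq x Hx0 Hx) as [_ ->].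
  unfold field_interior. rewrite Ep, Es. unfold tip_angle, A. fold B. rewrite Rmax_right by lra.
  rewrite arg_H_opp_conj.
  assert (Eg : gamma (x ^ 2) = (G1 (x ^ 2), G2 (x ^ 2))) by (unfold G1, G2; destruct (gamma (x ^ 2)); reflexivity).
  replace (gamma (x ^ 2) - Cconj z0)%C with (G1 (x ^ 2) - X0 0, G2 (x ^ 2) + V0 0).
  2: { rewrite Eg, (proj1 force_start), (proj2 force_start). destruct z0 as [a b].
       unfold Cminus, Cplus, Copp, Cconj; simpl. f_equal; ring. }
  rewrite Eg. field.
Qed.

(** * The flow lines *)

Section Reparametrized.
Context {eta : R -> C} {L : Rbar} (He : is_arc_length_reparam gamma tau eta L).

Let xi (r : R) : R := @arc_inv tau m r.

Lemma xi_spec r : ico L r -> ico (sqrt_Rbar tau) (xi r) /\ RInt m 0 (xi r) = r /\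
  eta r = gamma (xi r ^ 2) /\ eta r = (c1 (xi r), c2 (xi r)).
Proof.
  intros Hr. destruct (arc_inv_spec curve_steered gamma_sqrt He r Hr) as [h1 h2].
  pose proof (eta_arc_inv curve_steered gamma_sqrt He r Hr) as h3.
  split; [exact h1 | split; [exact h2 | split; [|exact h3]]]. rewrite h3. fold (xi r).
  pose proof (proj1 h1) as Hx. fold (xi r) in Hx. unfold c1, c2, G1, G2. rewrite Rmax_right by lra.
  destruct (gamma (xi r ^ 2)); reflexivity.
Qed.

Lemma xi_pos r : 0 < r -> ico L r -> 0 < xi r.
Proof.
  intros Hr Hi. destruct (xi_spec r Hi) as ([[h|h] _] & E & _); [assumption|].
  rewrite <- h, RInt_point in E. unfold zero in E; simpl in E. lra.
Qed.

Lemma L_pos : ico L 0 /\ xi 0 = 0.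
Proof.
  assert (Hi : ico (sqrt_Rbar tau) 0) by (split; [lra | apply (steered_X curve_steered)]).
  pose proof (proj1 (proj1 (reparam_spec curve_steered gamma_sqrt He) 0 Hi)) as H0.
  pose proof (arc_inv_arc curve_steered gamma_sqrt He 0 Hi) as H1.
  rewrite RInt_point in H0, H1. split; [exact H0 | exact H1].
Qed.

Lemma eta_C1 : is_C1_unit_speed eta L (fun r => cis (psi (xi r))).
Proof. exact (reparam_C1 curve_steered gamma_sqrt He). Qed.

Lemma eta_upper r : 0 < r -> ico L r -> upper_half_plane (eta r).
Proof.
  intros Hr Hi. destruct (xi_spec r Hi) as ([_ hX] & _ & -> & _).
  apply (psi_eq (xi r) (xi_pos r Hr Hi) hX).
Qed.

Lemma boundary_flow_line (x0 : R) : z0 = RtoC x0 ->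
  is_flow_line upper_half_plane (field_boundary rho x0) eta L.
Proof.
  intros Ez. exists (fun r => cis (psi (xi r))). split; [exact eta_C1|]. intros r Hr HrL.
  assert (Hi : ico L r) by (split; [lra | assumption]).
  split; [apply eta_upper; assumption|].
  destruct (xi_spec r Hi) as ([_ hX] & _ & -> & _).
  rewrite (psi_boundary _ x0 Ez (xi_pos r Hr Hi) hX). reflexivity.
Qed.

Lemma A_start (r theta : R) : 0 < r -> 0 < theta < PI -> z0 = (RtoC r * cis theta)%C ->
  D 0 = r /\ A 0 = theta - PI.
Proof.
  intros Hr Hth Ez. destruct force_start as [F1 F2]. destruct tip_start as (S1 & S2 & S3).
  assert (E1 : Re z0 = r * cos theta) by (rewrite Ez; unfold cis, Cmult, RtoC, Re; simpl; ring).
  assert (E2 : Im z0 = r * sin theta) by (rewrite Ez; unfold cis, Cmult, RtoC, Im; simpl; ring).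
  pose proof (sin2_cos2 theta) as Hsc. unfold Rsqr in Hsc.
  assert (En : (r * cos theta) ^ 2 + (r * sin theta) ^ 2 = r ^ 2).
  { transitivity (r ^ 2 * (sin theta * sin theta + cos theta * cos theta)); [|rewrite Hsc]; ring. }
  unfold D, A. rewrite Rmax_left by lra. replace (0 ^ 2) with 0 by ring.
  rewrite S1, S2, S3, F1, F2, E1, E2. split.
  - replace ((0 - r * cos theta) ^ 2 + (0 - r * sin theta) ^ 2) with (r ^ 2) by (rewrite <- En; ring).
    apply sqrt_pow2. lra.
  - unfold arg_H. rewrite Cmod_pair, En, sqrt_pow2 by lra. unfold Re; simpl fst.
    replace (r * cos theta / r) with (cos theta) by (field; lra). rewrite acos_cos by lra. ring.
Qed.

Lemma log_proj_eq (q1 q2 : R) : log_proj z0 (q1, q2) = (Re z0 + q1 * cos q2, Im z0 + q1 * sin q2).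
Proof. unfold log_proj, cis. destruct z0 as [a b]. unfold Cplus, Cmult, RtoC; simpl. f_equal; ring. Qed.

Lemma lift_exists (r theta : R) : 0 < r -> 0 < theta < PI -> z0 = (RtoC r * cis theta)%C ->
  is_log_lift z0 eta L (r, theta - PI) (fun s => (D (xi s), A (xi s))).
Proof.
  intros Hr Hth Ez. destruct (A_start r theta Hr Hth Ez) as [HD0 HA0]. split; [|split].
  - intros s Hs. destruct (xi_spec s Hs) as ([_ hX] & _). split; [apply (lift_polar _ hX)|].
    destruct (lift_cont _ hX) as [kA kD].
    exact (filterlim_pair_within curve_steered gamma_sqrt He D A s Hs kD kA).
  - rewrite (proj2 L_pos), HD0, HA0. reflexivity.
  - intros s Hs. destruct (xi_spec s Hs) as ([_ hX] & _ & _ & ->).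
    destruct (lift_polar _ hX) as (_ & E1 & E2). rewrite log_proj_eq, <- E1, <- E2. f_equal; ring.
Qed.

Lemma clamp_within (f : R -> R) (s : R) : Rbar_lt s L ->
  (forall r eps, ico L r -> 0 < eps -> exists d, 0 < d /\
    forall r', ico L r' -> Rabs (r' - r) < d -> Rabs (f r' - f r) < eps) ->
  continuous (fun r => f (Rmax 0 r)) s.
Proof.
  intros Hs Hf. assert (H0 := proj2 (proj1 L_pos)).
  apply filterlim_locally. intros eps.
  destruct (Hf (Rmax 0 s) eps (clamp_ico L s H0 Hs) (cond_pos eps)) as (d & Hd & Hdd).
  destruct (Rbar_between s L Hs) as (b & Hb & HbL).
  assert (Hm : 0 < Rmin d (b - s)) by (apply Rmin_pos; lra).
  exists (mkposreal _ Hm). intros r Hr. change (Rabs (r - s) < Rmin d (b - s)) in Hr.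
  pose proof (Rmin_l d (b - s)). pose proof (Rmin_r d (b - s)). assert (Hr' := Rabs_def2 _ _ Hr).
  apply Hdd.
  - apply clamp_ico; [assumption|]. apply (Rbar_le_lt_R r b); [lra | assumption].
  - apply Rle_lt_trans with (Rabs (r - s)); [|lra].
    unfold Rmax. destruct (Rle_dec 0 r), (Rle_dec 0 s); unfold Rabs; repeat destruct Rcase_abs; lra.
Qed.

(** Both sides are continuous determinations of the argument of [eta] around the force
    point, and they equal [theta - PI] at the start. *)
Lemma lift_angle (r theta : R) (q : R -> R * R) : 0 < r -> 0 < theta < PI -> z0 = (RtoC r * cis theta)%C ->
  is_log_lift z0 eta L (r, theta - PI) q -> forall s, ico L s -> snd (q s) = A (xi s).
Proof.
  intros Hr Hth Ez (Hq & Hq0 & Hqp) s Hs. destruct (A_start r theta Hr Hth Ez) as [_ HA0].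
  pose proof (angle_unique (fun s => snd (q (Rmax 0 s))) (fun s => A (xi (Rmax 0 s))) s) as U.
  cbv beta in U. rewrite <- (Rmax_right 0 s (proj1 Hs)). apply U; [| | split; [apply Hs | lra]].
  - intros u Hu.
    assert (HuL : Rbar_lt u L) by (apply (Rbar_le_lt_R u s); [lra | apply Hs]).
    assert (Hi : ico L u) by (split; [lra | assumption]).
    split; [|split].
    + apply (clamp_within (fun s => snd (q s)) u HuL). intros v eps Hv Heps.
      destruct (Hq v Hv) as [_ Hl].
      destruct (within_elim _ _ _ (proj1 (filterlim_locally _ _) Hl (mkposreal eps Heps))) as (d & Hd & Hb).
      exists d. split; [assumption|]. intros v' Hv' Hlt. apply (Hb v' Hv' Hlt).
    + apply (clamp_within (fun s => A (xi s)) u HuL). intros v eps Hv Heps.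
      destruct (xi_spec v Hv) as ([_ hX] & _).
      exact (comp_arc_inv_cont curve_steered gamma_sqrt He A v eps Hv (proj1 (lift_cont _ hX)) Heps).
    + rewrite Rmax_right by lra.
      destruct (xi_spec u Hi) as ([_ hX] & _ & _ & E). destruct (lift_polar _ hX) as (HDp & E1 & E2).
      pose proof (Hqp u Hi) as Ep. destruct (Hq u Hi) as [Hp _]. unfold log_surface in Hp.
      destruct (q u) as [q1 q2]. simpl fst in Hp. simpl snd.
      rewrite log_proj_eq, E in Ep. injection Ep as P1 P2.
      assert (F1 : q1 * cos q2 = D (xi u) * cos (A (xi u))) by lra.
      assert (F2 : q1 * sin q2 = D (xi u) * sin (A (xi u))) by lra.
      assert (Eq : q1 = D (xi u)).
      { pose proof (sin2_cos2 q2) as S1. pose proof (sin2_cos2 (A (xi u))) as S2. unfold Rsqr in S1, S2.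
        assert (Esq : q1 * q1 = D (xi u) * D (xi u)).
        { transitivity ((q1 * cos q2) * (q1 * cos q2) + (q1 * sin q2) * (q1 * sin q2)).
          - transitivity (q1 * q1 * (sin q2 * sin q2 + cos q2 * cos q2)); [rewrite S1|]; ring.
          - rewrite F1, F2. transitivity (D (xi u) * D (xi u) * (sin (A (xi u)) * sin (A (xi u)) + cos (A (xi u)) * cos (A (xi u)))); [|rewrite S2]; ring. }
        nra. }
      rewrite Eq in F1, F2. split; apply (Rmult_eq_reg_l (D (xi u))); lra.
  - rewrite Rmax_left by lra. rewrite Hq0, (proj2 L_pos), HA0. reflexivity.
Qed.

Lemma is_C1_unit_speed_ext (f1 f2 : R -> C) (v : R -> C) :
  (forall s, ico L s -> f2 s = f1 s) -> is_C1_unit_speed f1 L v -> is_C1_unit_speed f2 L v.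
Proof.
  intros E H s Hs. destruct (H s Hs) as (h1 & h2 & h3). split; [|split; assumption].
  apply (is_derive_on_eps (V := C_R_NormedModule)); [assumption|]. intros eps Heps.
  destruct (proj1 (is_derive_on_eps (V := C_R_NormedModule) _ _ _ _ Hs) h1 eps Heps) as (d & Hd & Hb).
  exists d. split; [assumption|]. intros u Hu Hlt. rewrite !E by assumption. apply Hb; assumption.
Qed.

Lemma interior_flow_line (r theta : R) (q : R -> R * R) : 0 < r -> 0 < theta < PI ->
  z0 = (RtoC r * cis theta)%C -> is_log_lift z0 eta L (r, theta - PI) q ->
  is_log_flow_line z0 (log_half_plane z0) (field_interior rho z0) q L.
Proof.
  intros Hr Hth Ez Hq. pose proof (lift_angle r theta q Hr Hth Ez Hq) as HA.
  destruct Hq as (Hc & Hq0 & Hqp). split; [exact Hc|]. exists (fun s => cis (psi (xi s))). split.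
  - apply (is_C1_unit_speed_ext eta); [exact Hqp | exact eta_C1].
  - intros s Hs HsL. assert (Hi : ico L s) by (split; [lra | assumption]).
    split; [split; [apply (Hc s Hi) | rewrite (Hqp s Hi); apply eta_upper; assumption]|].
    destruct (xi_spec s Hi) as ([_ hX] & _ & E & _).
    rewrite (psi_interior (xi s) (q s) (xi_pos s Hs Hi) hX); [reflexivity | | apply HA, Hi].
    rewrite (Hqp s Hi). exact E.
Qed.
End Reparametrized.

Lemma curve_reparam_exists : exists (eta : R -> C) (L : Rbar), is_arc_length_reparam gamma tau eta L.
Proof. exact (reparam_exists curve_steered gamma_sqrt). Qed.
End Curve.

Theorem proposition7 (rho : R) (z0 : C) (tau : Rbar) (gamma : R -> C)
  (Hz0 : closed_half_plane z0) (Hz0' : z0 <> RtoC 0)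
  (Hgamma : is_sle0_rho rho z0 tau gamma) :
  (exists (eta : R -> C) (L : Rbar), is_arc_length_reparam gamma tau eta L) /\
  forall (eta : R -> C) (L : Rbar), is_arc_length_reparam gamma tau eta L ->
    (forall x0 : R, z0 = RtoC x0 ->
       is_flow_line upper_half_plane (field_boundary rho x0) eta L) /\
    (forall r theta : R, 0 < r -> 0 < theta < PI ->
       z0 = (RtoC r * cis theta)%C ->
       (exists q : R -> R * R, is_log_lift z0 eta L (r, theta - PI) q) /\
       forall q : R -> R * R, is_log_lift z0 eta L (r, theta - PI) q ->
         is_log_flow_line z0 (log_half_plane z0) (field_interior rho z0) q L).
Proof.
  destruct Hgamma as (W & g & life & ginv & HD). split; [exact (curve_reparam_exists Hz0 Hz0' HD)|].
  intros eta L He. split.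
  - intros x0 Ez. exact (boundary_flow_line Hz0 Hz0' HD He x0 Ez).
  - intros r theta Hr Hth Ez. split.
    + eexists. exact (lift_exists Hz0 Hz0' HD He r theta Hr Hth Ez).
    + intros q Hq. exact (interior_flow_line Hz0 Hz0' HD He r theta q Hr Hth Ez Hq).
Qed.
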